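(* Let $F:\mathbb{R}^d\times\mathbb{R}\to\mathbb{R}$ satisfy Assumption (A). Then the spanning problem (P) for $F$ admits a solution $N$ (equivalently $T$) if and only if $F$ is of class AHa. In that case the solution is unique and is given by $N=N^F$, $T=T^F$, i.e. for every $\varphi\in\mathcal{S}_e$, $$T(\varphi)=N(\varphi-\varphi(\mathbf 0))=-\frac{1}{2}\int_{\mathbb{R}^d}\mathcal{F}^{-1}\varphi(\mathbf{x})\Big(\int_{\mathbb{R}}F(\mathbf{x},k)e^{-ik}\,dk\Big)d\mathbf{x}.$$
   Context: Fix $d\ge 1$. For $\mathbf{z}\in\mathbb{R}^q$, $|\mathbf{z}|$ is the Euclidean norm. $\mathcal{S}(\mathbb{R}^q)$ is the Schwartz space (complex-valued). Fourier transform: $\mathcal{F}f(\mathbf{z})=\int_{\mathbb{R}^q}f(\mathbf{s})e^{-i\mathbf{z}\cdot\mathbf{s}}d\mathbf{s}$, inverse $\mathcal{F}^{-1}f(\mathbf{s})=(2\pi)^{-q}\int_{\mathbb{R}^q}f(\mathbf{z})e^{i\mathbf{s}\cdot\mathbf{z}}d\mathbf{z}$; $\mathcal{F}_k[g(\mathbf{x},k)](r)$ denotes the transform in the variable $k$ only. $\mathcal{S}_0$ is the set of functions $\theta_0(\mathbf{x},k)=e^{-irk}h(\mathbf{x})$ on $\mathbb{R}^d\times\mathbb{R}$ with $r\in\mathbb{R}\setminus\{0\}$ and $h\in\mathcal{S}(\mathbb{R}^d)$. $\mathcal{S}_e$ is the space of even functions in $\mathcal{S}(\mathbb{R}^d)$,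 and $\Sigma_e=\{\varphi-\varphi(\mathbf 0):\varphi\in\mathcal{S}_e\}$; the map $\varphi\mapsto\varphi-\varphi(\mathbf 0)$ is a bijection $\mathcal{S}_e\to\Sigma_e$ with inverse $\psi\mapsto\psi-\lim_{|\mathbf{w}|\to\infty}\psi(\mathbf{w})$. Assumption (A): $F(\mathbf{x},k)$ is continuous in $\mathbf{x}$ for each $k$ and continuous in $k$ for each $\mathbf{x}$, and $\int_{\mathbb{R}^d}\int_{\mathbb{R}}|F(\mathbf{x},k)h(\mathbf{x})|\,dk\,d\mathbf{x}<\infty$ for every $h\in\mathcal{S}(\mathbb{R}^d)$. Spanning problem (P): given $F$ satisfying (A), find a linear form $N$ on $\Sigma_e$ such that for every $\theta_0\in\mathcal{S}_0$, $$\int_{\mathbb{R}^d}\int_{\mathbb{R}}F(\mathbf{x},k)\theta_0(\mathbf{x},k)\,dk\,d\mathbf{x}=N\Big(\mathbf{w}\mapsto\int_{\mathbb{R}^d}\int_{\mathbb{R}}(|\mathbf{w}\cdot\mathbf{x}|-|k|)^+\theta_0(\mathbf{x},k)\,dk\,d\mathbf{x}\Big)$$ (the function of $\mathbf{w}$ inside lies in $\Sigma_e$). Equivalently, find a linear form $T$ on $\mathcal{S}_e$ such that $N$ defined by $N(\varphi-\varphi(\mathbf 0)):=T(\varphi)$ solves this. $F$ is of class AHa if $F(\lambda\mathbf{x},\lambda k)=|\lambda|F(\mathbf{x},k)$ for all $\lambda\ne0$ and $F(\mathbf{x},k)=F(\mathbf{x},-k)=F(-\mathbf{x},k)$ for all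 $(\mathbf{x},k)$. For $F$ satisfying (A), $N^F$ and $T^F$ are the linear forms $T^F(\varphi)=N^F(\varphi-\varphi(\mathbf 0)):=-\frac12\int_{\mathbb{R}^d}\mathcal{F}^{-1}\varphi(\mathbf{x})\,\mathcal{F}_k[F(\mathbf{x},k)](1)\,d\mathbf{x}$, $\varphi\in\mathcal{S}_e$. *)

(* Defs.v *)
From HB Require Import structures.
From mathcomp Require Import all_boot all_order all_algebra.
From mathcomp Require Import all_classical all_reals all_analysis.
From mathcomp Require Import complex.

Set Implicit Arguments.
Unset Strict Implicit.
Unset Printing Implicit Defensive.

Import Order.TTheory GRing.Theory Num.Theory.
Import numFieldNormedType.Exports.

Local Open Scope ring_scope.

Section Defs.
Variable R : realType.
Local Notation C := R[i].
Local Notation leb := (@lebesgue_measure R).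

Definition vdot d (u v : 'rV[R]_d) : R := \sum_(j < d) u ord0 j * v ord0 j.

Definition cexpi (t : R) : C := Complex (cos t) (sin t).

Definition cre (z : C) : R := let: Complex a _ := z in a.
Definition cim (z : C) : R := let: Complex _ b := z in b.

Definition RC (t : R) : C := Complex t 0.

Definition cabs (z : C) : R := Num.sqrt (cre z ^+ 2 + cim z ^+ 2).

Definition ev d (j : 'I_d) : 'rV[R]_d := delta_mx ord0 j.

Fixpoint iderive d (s : seq 'I_d) (f : 'rV[R]_d -> R) : 'rV[R]_d -> R :=
  match s with
  | [::] => f
  | j :: s' => fun x => derive (iderive s' f) x (ev j)
  end.

Definition rschwartz d (f : 'rV[R]_d -> R) : Prop :=
  (forall (s : seq 'I_d) (j : 'I_d) (x : 'rV[R]_d),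
      derivable (iderive s f) x (ev j)) /\
  (forall (alpha : 'I_d -> nat) (s : seq 'I_d), exists M : R,
      forall x : 'rV[R]_d,
        `| (\prod_(j < d) x ord0 j ^+ alpha j) * iderive s f x | <= M).

Definition schwartz d (f : 'rV[R]_d -> C) : Prop :=
  rschwartz (fun x => cre (f x)) /\ rschwartz (fun x => cim (f x)).

Definition in_Se d (phi : 'rV[R]_d -> C) : Prop :=
  schwartz phi /\ forall x, phi (- x) = phi x.

Definition in_Sigmae d (psi : 'rV[R]_d -> C) : Prop :=
  exists phi, in_Se phi /\ forall w, psi w = phi w - phi 0.

(* Lebesgue integral over R^d, computed as the iterated integral over the
   coordinates (Fubini/Tonelli), with extended-real values. *)
Fixpoint eint d : ('rV[R]_d -> \bar R) -> \bar R :=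
  match d with
  | 0 => fun f => f 0
  | n.+1 => fun f =>
      (\int[leb]_t eint (fun v : 'rV[R]_n =>
         f (row_mx (const_mx t : 'rV[R]_1) v)))%E
  end.

Definition rint1 (f : R -> R) : R := fine (\int[leb]_t (f t)%:E)%E.

Definition cint1 (f : R -> C) : C :=
  Complex (rint1 (fun t => cre (f t))) (rint1 (fun t => cim (f t))).

Definition cint d (f : 'rV[R]_d -> C) : C :=
  Complex (fine (eint (fun x => (cre (f x))%:E)))
          (fine (eint (fun x => (cim (f x))%:E))).

Definition cint2 d (g : 'rV[R]_d -> R -> C) : C :=
  Complex (fine (eint (fun x => \int[leb]_k (cre (g x k))%:E)%E))
          (fine (eint (fun x => \int[leb]_k (cim (g x k))%:E)%E)).

Definition theta0 d (r : R) (h : 'rV[R]_d -> C) (x : 'rV[R]_d) (k : R) : C :=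
  cexpi (- (r * k)) * h x.

Definition assumptionA d (F : 'rV[R]_d -> R -> R) : Prop :=
  (forall k, continuous (fun x => F x k)) /\
  (forall x, continuous (fun k => F x k)) /\
  (forall h : 'rV[R]_d -> C, schwartz h ->
     (eint (fun x => \int[leb]_k (`|F x k| * cabs (h x))%:E) < +oo)%E).

Definition AHa d (F : 'rV[R]_d -> R -> R) : Prop :=
  (forall (lam : R) x k, lam != 0 -> F (lam *: x) (lam * k) = `|lam| * F x k) /\
  (forall x k, F x k = F x (- k) /\ F x k = F (- x) k).

(* N is a C-linear form on Sigma_e (values outside Sigma_e are irrelevant) *)
Definition linear_on_Sigmae d (N : ('rV[R]_d -> C) -> C) : Prop :=
  forall (a : C) psi1 psi2, in_Sigmae psi1 -> in_Sigmae psi2 ->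
    N (fun w => a * psi1 w + psi2 w) = a * N psi1 + N psi2.

Definition ramp_transform d (th : 'rV[R]_d -> R -> C) : 'rV[R]_d -> C :=
  fun w => cint2 (fun x k => RC (Num.max (`|vdot w x| - `|k|) 0) * th x k).

Definition solves_P d (F : 'rV[R]_d -> R -> R) (N : ('rV[R]_d -> C) -> C)
  : Prop :=
  linear_on_Sigmae N /\
  forall (r : R) (h : 'rV[R]_d -> C), r != 0 -> schwartz h ->
    cint2 (fun x k => RC (F x k) * theta0 r h x k)
    = N (ramp_transform (theta0 r h)).

Definition finv d (phi : 'rV[R]_d -> C) (s : 'rV[R]_d) : C :=
  RC ((2 * pi) ^- d) * cint (fun z => phi z * cexpi (vdot s z)).

Definition Fk1 d (F : 'rV[R]_d -> R -> R) (x : 'rV[R]_d) : C :=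
  cint1 (fun k => RC (F x k) * cexpi (- k)).

Definition TF d (F : 'rV[R]_d -> R -> R) (phi : 'rV[R]_d -> C) : C :=
  - (RC (1 / 2)) * cint (fun x => finv phi x * Fk1 F x).

End Defs.

(* Main.v *)
Require Import Defs.
From HB Require Import structures.
From mathcomp Require Import all_boot all_order all_algebra.
From mathcomp Require Import all_classical all_reals all_analysis.
From mathcomp Require Import measurable_realfun complex ring lra.

Set Implicit Arguments.
Unset Strict Implicit.
Unset Printing Implicit Defensive.

Import Order.TTheory GRing.Theory Num.Theory.
Import numFieldNormedType.Exports.

Local Open Scope classical_set_scope.
Local Open Scope ring_scope.

(* Write [J F r th h] for the integral of [F(x, k) h(x) cos(r k + th)].  Since
   the integral of (|a| - |k|)^+ cos(r k) in [k] is 2 (1 - cos(r a)) / r^2, the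
   ramp transform of e^{-irk} h(x) is phi(w) - phi(0), where phi is -2/r^2 times
   the cosine transform of [h] at [r w].  Choosing r = 1 and h = -1/2 F^-1 phi
   reaches every even Schwartz phi by Fourier inversion, so any solution of (P)
   is N^F.  Comparing N^F with (P) for general [r] expresses [J F r th h] through
   [J F 1 th] of the symmetrized dilate of [h] by [1/r], an identity invariant
   under (x, k) -> (a x, b k) with |a| = |b| up to the factor |b|.  As a function
   all of whose [J] vanish is zero, [F] is AHa; conversely the AHa symmetries
   turn the identity back into (P).  Vanishing of [J] forces F = 0 because the
   integrals of F(x, k) exp(-|x|^2/2) against all cosines of affine forms vanish;
   polynomials in cosines approximate indicators of half-spaces, and those
   generate the sigma-algebra. *)

(** * Lebesgue measure on row vectors *)

(** A solution is already fixed by the data with r = 1, so the other frequencies are constraints on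
    F, and these force AHa. The symmetrization h(x/r) + h(-x/r) arises because the cosine transform
    sees only the even part of h; the accompanying factor is, up to 1/2, r^-2 from the ramp times
    |r|^-d from the Jacobian of the dilation. Under (x, k) -> (a x, b k) the frequency becomes r/b,
    the factor gains |b|^(d+2), the change of variables costs |b|^-(d+1), and |b| remains. The
    symmetrized function does not notice the sign of a/b, so one identity yields homogeneity and
    both reflections. Two obstacles shape the rest. Integrals over R^d are iterated and infinite
    values collapse to 0, so a product measure with Fubini theorems is needed, and integrability of
    sections of F is known only for almost every x. Moreover (P) tests no r = 0 and F is only
    separately continuous: the zero frequency is reached as a limit, and the passage from almost
    everywhere to everywhere is made in one variable at a time. *)

Section euclidean_measurable.
Variable (R : realType) (n : nat).

(** Generators of the product sigma-algebra; with this choice a map into row vectors is measurable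
    as soon as its coordinates are. *)
Definition cylinders : set (set 'rV[R]_n) :=
  [set A | exists (j : 'I_n) (B : set R), measurable B /\
           A = [set x : 'rV[R]_n | B (x ord0 j)]].

HB.instance Definition _ := Pointed.on 'rV[R]_n.
HB.instance Definition _ := @isMeasurable.Build (sigma_display cylinders)
  'rV[R]_n <<s cylinders >> (@sigma_algebra0 _ setT cylinders)
  (@sigma_algebraC _ cylinders) (@sigma_algebra_bigcup _ setT cylinders).

Lemma measurable_coord (j : 'I_n) :
  measurable_fun setT (fun x : 'rV[R]_n => x ord0 j).
Proof.
move=> _ B mB; rewrite setTI; apply: sub_sigma_algebra.
by exists j, B.
Qed.

Lemma measurable_fun_rVP d (T : measurableType d) (f : T -> 'rV[R]_n) :
  (forall j, measurable_fun setT (fun x => f x ord0 j)) ->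
  measurable_fun setT f.
Proof.
move=> mf; apply: (@measurability _ _ T 'rV[R]_n setT f cylinders) => //.
move=> A [B [j [C [mC ->]]]] <-.
exact: mf.
Qed.

End euclidean_measurable.

(** Both exhaustions are increasing, so the diagonal products F n x G n cover: a point of F n x G k
    lies in the product of index [maxn n k]. *)
Lemma product_sigma_finite d1 d2 (T1 : measurableType d1)
    (T2 : measurableType d2) (R : realType)
    (m1 : {sigma_finite_measure set T1 -> \bar R})
    (m2 : {sigma_finite_measure set T2 -> \bar R}) :
  sigma_finite setT (m1 \x m2)%E.
Proof.
have /sigma_finiteP[F [TF ndF Foo]] := sigma_finiteT m1.
have /sigma_finiteP[G [TG ndG Goo]] := sigma_finiteT m2.
exists (fun n => F n `*` G n).
  rewrite predeqE => -[x y]; split=> // _.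
  have [n _ Fnx] : (\bigcup_n F n) x by rewrite -TF.
  have [k _ Gky] : (\bigcup_n G n) y by rewrite -TG.
  exists (maxn n k) => //; split => /=.
    by move: x Fnx; apply/subsetPset/ndF; rewrite leq_maxl.
  by move: y Gky; apply/subsetPset/ndG; rewrite leq_maxr.
move=> k; have [? ?] := Foo k; have [? ?] := Goo k.
split; first exact: measurableX.
by rewrite product_measure1E// lte_mul_pinfty// ge0_fin_numE.
Qed.

Section mu.
Variable R : realType.
Local Notation leb := (@lebesgue_measure R).

(** The same [row_mx] expression as in [eint], so that integrals against [vol] unfold along its
    recursion. *)
Definition vcons n (p : R * 'rV[R]_n) : 'rV[R]_n.+1 :=
  row_mx (const_mx p.1 : 'rV[R]_1) p.2.

Lemma vcons0 n (p : R * 'rV[R]_n) : vcons p ord0 ord0 = p.1.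
Proof.
rewrite /vcons; have -> : ord0 = lshift n (ord0 : 'I_1) by apply/val_inj.
transitivity ((const_mx p.1 : 'rV[R]_1) ord0 ord0); first exact: row_mxEl.
by rewrite mxE.
Qed.

Lemma vconsS n (p : R * 'rV[R]_n) (j : 'I_n) :
  vcons p ord0 (lift ord0 j) = p.2 ord0 j.
Proof.
rewrite /vcons; have -> : lift ord0 j = rshift 1 j by apply/val_inj.
exact: row_mxEr.
Qed.

Lemma measurable_vcons n : measurable_fun setT (@vcons n).
Proof.
apply: measurable_fun_rVP => j; case: (unliftP ord0 j) => [i|] ->.
  under eq_fun do rewrite vconsS.
  exact: measurableT_comp (measurable_coord _) measurable_snd.
by under eq_fun do rewrite vcons0; exact: measurable_fst.
Qed.

Definition vhead n (x : 'rV[R]_n.+1) : R := x ord0 ord0.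
Definition vtail n (x : 'rV[R]_n.+1) : 'rV[R]_n := \row_j x ord0 (lift ord0 j).

Lemma vtail_vcons n t (x : 'rV[R]_n) : vtail (vcons (t, x)) = x.
Proof. by apply/rowP => j; rewrite mxE vconsS. Qed.

Lemma measurable_vuncons n :
  measurable_fun setT (fun x : 'rV[R]_n.+1 => (vhead x, vtail x)).
Proof.
apply: measurable_fun_pair; first exact: measurable_coord.
apply: measurable_fun_rVP => j.
by under eq_fun do rewrite mxE; exact: measurable_coord.
Qed.

Section step.
Variables (n : nat) (m : {sigma_finite_measure set 'rV[R]_n -> \bar R}).

Definition volS : set 'rV[R]_n.+1 -> \bar R :=
  pushforward (leb \x m)%E (@vcons n).

HB.instance Definition _ := Measure.copy volS
  (@measure_function_pushforward__canonical__measure_function_Measure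
     _ _ _ _ _ (leb \x m)%E _ (@measurable_vcons n)).

Let volS_sigma_finite : sigma_finite setT volS.
Proof.
have [F FT mF] := product_sigma_finite leb m.
exists (fun i => (fun x : 'rV[R]_n.+1 => (vhead x, vtail x)) @^-1` F i).
  by rewrite -preimage_bigcup -FT preimage_setT.
move=> i; have [mFi Fi] := mF i; split.
  by rewrite -[X in measurable X]setTI; exact: measurable_vuncons.
rewrite /volS /pushforward; apply: le_lt_trans Fi.
rewrite le_eqVlt; apply/orP; left; apply/eqP; congr (_ _).
apply/seteqP; split => -[t v] /=; rewrite /vhead vcons0 vtail_vcons//.
Qed.

HB.instance Definition _ := Measure_isSigmaFinite.Build _ _ _ volS
  volS_sigma_finite.

End step.

(** Lebesgue measure, built along the recursion of [eint]. The base case is a Dirac mass because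
    [eint] in dimension 0 is evaluation at the only point. *)
Fixpoint vol n : {sigma_finite_measure set 'rV[R]_n -> \bar R} :=
  match n with
  | 0 => \d_(0 : 'rV[R]_0)
  | m.+1 => volS (vol m)
  end.

Lemma ge0_integral_volS n (f : 'rV[R]_n.+1 -> \bar R) :
  measurable_fun setT f -> (forall x, (0 <= f x)%E) ->
  (\int[vol n.+1]_x f x = \int[(leb \x vol n)%E]_p f (vcons p))%E.
Proof.
move=> mf f0; rewrite /= /volS ge0_integral_pushforward//; exact: measurable_vcons.
Qed.

Lemma measurable_integral2 d (T : measurableType d) d' (S : measurableType d')
    (m : {sigma_finite_measure set S -> \bar R}) (f : T * S -> \bar R) :
  measurable_fun setT f ->
  measurable_fun setT (fun t => \int[m]_s f (t, s))%E.
Proof.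
move=> mf.
under eq_fun do rewrite integralE.
apply: emeasurable_funB.
  under eq_fun do rewrite funepos_comp/=.
  by apply: (measurable_fun_fubini_tonelli_F (f ^\+)%E) => //; exact: measurable_funepos.
under eq_fun do rewrite funeneg_comp/=.
by apply: (measurable_fun_fubini_tonelli_F (f ^\-)%E) => //; exact: measurable_funeneg.
Qed.

(** The parameter space T is arbitrary so that the induction can absorb coordinates: the pair of t
    and the first coordinate is the parameter of the next step. *)
Lemma measurable_eint n d (T : measurableType d) (f : T * 'rV[R]_n -> \bar R) :
  measurable_fun setT f ->
  measurable_fun setT (fun t => eint (fun v => f (t, v))).
Proof.
elim: n d T f => [|n IH] d T f mf /=.
  exact: measurableT_comp mf (measurable_fun_pair _ _).
apply: (@measurable_integral2 _ _ _ _ leb (fun p => eint (fun v => f (p.1, vcons (p.2, v))))).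
apply: (IH _ _ (fun q => f (q.1.1, vcons (q.1.2, q.2)))).
apply: measurableT_comp mf _; apply: measurable_fun_pair => /=.
  exact: measurableT_comp.
apply: measurableT_comp (@measurable_vcons n) _.
by apply: measurable_fun_pair => //; exact: measurableT_comp.
Qed.

Lemma eint_ge0 n (f : 'rV[R]_n -> \bar R) :
  measurable_fun setT f -> (forall x, (0 <= f x)%E) ->
  eint f = (\int[vol n]_x f x)%E.
Proof.
elim: n f => [|n IH] f mf f0.
  rewrite integral_dirac//; first by rewrite diracT mul1e.
rewrite ge0_integral_volS// fubini_tonelli1//=; last first.
  exact: measurableT_comp mf (@measurable_vcons n).
apply: eq_integral => t _; rewrite /fubini_F -IH//.
exact: measurableT_comp mf (measurableT_comp (@measurable_vcons n) (pair1_measurable _)).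
Qed.

Lemma integrable_volS n (f : 'rV[R]_n.+1 -> \bar R) :
  (vol n.+1).-integrable setT f ->
  (leb \x vol n)%E.-integrable setT (f \o @vcons n).
Proof.
move=> /integrableP[mf fi]; apply/integrableP; split.
  exact: measurableT_comp mf (@measurable_vcons n).
by rewrite ge0_integral_volS// in fi; exact: measurableT_comp.
Qed.

(** Sections of an integrable function are integrable only for almost every first coordinate. The
    induction hypothesis thus identifies the inner integrals almost everywhere, and measurability of
    [eint] lets this pass under the outer integral. *)
Lemma eint_integrable n (f : 'rV[R]_n -> \bar R) :
  (vol n).-integrable setT f -> eint f = (\int[vol n]_x f x)%E.
Proof.
elim: n f => [|n IH] f fi.
  rewrite integral_dirac//; first by rewrite diracT mul1e.
  exact: measurable_int fi.
have mf := measurable_int _ fi.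
have mfc : measurable_fun setT (f \o @vcons n).
  exact: measurableT_comp mf (@measurable_vcons n).
have fci := integrable_volS fi.
rewrite /= /volS integral_pushforward//; last exact: measurable_vcons.
rewrite preimage_setT -integral12_prod_meas1//.
apply: ae_eq_integral => //.
- exact: (@measurable_eint n _ _ (fun q => f (vcons q))).
- exact: measurable_fubini_F fci.
- have := ae_integrable1 fci; apply: filterS => t /= ti _.
  by rewrite IH.
Qed.
End mu.

(** A countable index cuts the domain into countably many measurable pieces, on each of which the
    function is a single [g z]. It serves to discretize one variable on a grid. *)
Lemma measurable_fun_countable_param d (T : measurableType d) d'
    (S : measurableType d') (C : countType)
    (c : T -> C) (g : C -> T -> S) :
  (forall z, measurable (c @^-1` [set z])) ->
  (forall z, measurable_fun setT (g z)) ->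
  measurable_fun setT (fun t => g (c t) t).
Proof.
move=> mc mg _ B mB; rewrite setTI.
have -> : (fun t => g (c t) t) @^-1` B =
    \bigcup_z (c @^-1` [set z] `&` g z @^-1` B).
  apply/seteqP; split => t /=; first by move=> Bt; exists (c t).
  by move=> [z _ [/= <-]].
apply: countable_bigcupT_measurable => // z; apply: measurableI => //.
by rewrite -[X in measurable X]setTI; exact: mg.
Qed.

(** * Measurability of continuous functions and affine changes of variables *)

Section euclid.
Variable R : realType.
Local Notation leb := (@lebesgue_measure R).

Lemma measurable_floor_fiber (m : nat) (z : int) :
  measurable ((fun t : R => Num.floor (m.+1%:R * t)) @^-1` [set z]).
Proof.
have -> : (fun t : R => Num.floor (m.+1%:R * t)) @^-1` [set z] =
    `[z%:~R / m.+1%:R, (z + 1)%:~R / m.+1%:R[%classic.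
  apply/seteqP; split => t /=; rewrite in_itv/= ler_pdivrMr// ltr_pdivlMr//.
    by move=> <-; rewrite mulrC floor_itv.
  by rewrite mulrC => tz; exact: floor_def.
exact: measurable_itv.
Qed.

Lemma floor_approx (m : nat) (t : R) :
  `|t - (Num.floor (m.+1%:R * t))%:~R / m.+1%:R| <= m.+1%:R^-1.
Proof.
have := floor_itv (m.+1%:R * t); set z := Num.floor _ => /andP[z1 z2].
have m0 : 0 < m.+1%:R :> R by [].
rewrite -(ler_pM2l m0) divff ?lt0r_neq0// -{1}[m.+1%:R]gtr0_norm// -normrM.
rewrite mulrBr [_ * (_ / _)]mulrC divfK ?lt0r_neq0//.
rewrite ger0_norm ?subr_ge0//.
by rewrite lerBlDl ltW//; move: z2; rewrite intrD.
Qed.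

Lemma cvg_floor (t : R) :
  (Num.floor (m.+1%:R * t))%:~R / m.+1%:R @[m --> \oo] --> t.
Proof.
apply/cvgrPdist_le => e e0.
near=> m; apply: (le_trans (floor_approx m t)).
near: m; have := @cvg_harmonic R => /cvgrPdist_le/(_ _ e0).
by apply: filterS => m /=; rewrite sub0r normrN ger0_norm// invr_ge0.
Unshelve. all: by end_near. Qed.

Lemma cvg_rVP n (T : Type) (F : set_system T) (FF : Filter F)
    (f : T -> 'rV[R]_n) (x : 'rV[R]_n) :
  (forall j, f t ord0 j @[t --> F] --> x ord0 j) -> f t @[t --> F] --> x.
Proof.
move=> fx; apply/cvg_ballP => e e0.
have : \forall t \near F, forall j, ball (x ord0 j) e (f t ord0 j).
  apply: filter_forall => j.
  by move/cvg_ballP : (fx j); exact.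
by apply: filterS => t ft; split => // i j; rewrite ord1.
Qed.

Lemma measurable_box n (A : 'I_n -> set R) : (forall j, measurable (A j)) ->
  measurable [set x : 'rV[R]_n | forall j, A j (x ord0 j)].
Proof.
move=> mA; rewrite -[X in measurable X]setCK; apply: measurableC.
have -> : ~` [set x : 'rV[R]_n | forall j, A j (x ord0 j)] =
    \bigcup_j ((fun x : 'rV[R]_n => x ord0 j) @^-1` (~` A j)).
  apply/seteqP; split => x /=; first by move/existsNP => [j Hj]; exists j.
  by move=> [j _ /= H] /(_ j).
apply: countable_bigcupT_measurable => // j.
rewrite -[X in measurable X]setTI; apply: measurable_coord => //.
exact: measurableC.
Qed.

(** Rounding the coordinates down to a grid of mesh 1/(m+1) gives countably valued measurable
    functions that converge pointwise to f. *)
Lemma continuous_measurable_rV n (f : 'rV[R]_n -> R) :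
  continuous f -> measurable_fun setT f.
Proof.
move=> cf.
pose c m (x : 'rV[R]_n) : 'rV[int]_n := \row_j Num.floor (m.+1%:R * x ord0 j).
pose g m (z : 'rV[int]_n) : 'rV[R]_n := \row_j ((z ord0 j)%:~R / m.+1%:R).
apply: (@measurable_fun_cvg _ _ _ _ (fun m x => f (g m (c m x)))).
  move=> m; apply: (@measurable_fun_countable_param _ _ _ _ _ (c m)
     (fun z _ => f (g m z))) => // z.
  have -> : c m @^-1` [set z] = [set x : 'rV[R]_n | forall j,
       ((fun t : R => Num.floor (m.+1%:R * t)) @^-1` [set z ord0 j]) (x ord0 j)].
    apply/seteqP; split => x /=; first by move=> <- j; rewrite mxE.
    by move=> xz; apply/rowP => j; rewrite mxE.
  apply: (@measurable_box n (fun j => (fun t : R => Num.floor (m.+1%:R * t)) @^-1` [set z ord0 j])) => j.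
  exact: measurable_floor_fiber.
move=> x _; apply: continuous_cvg; first exact: cf.
apply: cvg_rVP => j; under eq_fun do rewrite !mxE.
exact: cvg_floor.
Qed.

(** Assumption (A) grants separate continuity only, so k alone is rounded: each approximation is
    continuous in x on countably many strips. *)
Lemma measurable_caratheodory n (F : 'rV[R]_n -> R -> R) :
  (forall k, continuous (F^~ k)) -> (forall x, continuous (F x)) ->
  measurable_fun setT (fun p : 'rV[R]_n * R => F p.1 p.2).
Proof.
move=> cx ck.
pose c m (p : 'rV[R]_n * R) := Num.floor (m.+1%:R * p.2).
apply: (@measurable_fun_cvg _ _ _ _
    (fun m p => F p.1 ((c m p)%:~R / m.+1%:R))).
  move=> m; apply: (@measurable_fun_countable_param _ _ _ _ _ (c m)
     (fun z p => F p.1 (z%:~R / m.+1%:R))) => z.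
    have := @measurable_snd _ _ 'rV[R]_n R measurableT _ (measurable_floor_fiber m z).
    by rewrite setTI.
  exact: (measurableT_comp (continuous_measurable_rV (cx _)) measurable_fst).
move=> [x k] _ /=; apply: continuous_cvg; first exact: ck.
exact: cvg_floor.
Qed.

(** The push-forward scaled by |c| agrees with Lebesgue measure on half-open intervals, hence equals
    it. For c < 0 the preimage of such an interval is closed at the other end, with the same
    length. *)
Lemma ge0_integral_affine1 (f : R -> \bar R) (a c : R) : c != 0 ->
  measurable_fun setT f -> (forall t, (0 <= f t)%E) ->
  (\int[leb]_t f (a + c * t)%R = (`|c|^-1)%:E * \int[leb]_t f t)%E.
Proof.
move=> c0 mf f0.
pose aff : R -> measurableTypeR R := fun t => a + c * t.
have maff : measurable_fun setT aff.
  by apply: measurable_funD => //; exact: measurable_funM.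
have nc0 : 0 < `|c| by rewrite normr_gt0.
pose nc : {nonneg R} := NngNum (ltW nc0).
pose P : {measure set (measurableTypeR R) -> \bar R} :=
  @measure_function_pushforward__canonical__measure_function_Measure
     _ _ _ _ _ leb _ maff.
pose M : {measure set (measurableTypeR R) -> \bar R} := mscale nc P.
have ME A : measurable A -> leb A = M A.
  move: A; apply: lebesgue_measure_unique => _ [[x y] _ <-].
  rewrite /M /= /mscale /= /pushforward.
  have [cp|cn] : 0 < c \/ c < 0 by move: c0; rewrite neq_lt => /orP[]; tauto.
    have -> : aff @^-1` `]x, y]%classic =
        `](x - a) / c, (y - a) / c]%classic.
      apply/seteqP; split => t /=; rewrite /aff !in_itv/= ltr_pdivrMr// ler_pdivlMr//;
      move=> /andP[? ?]; apply/andP; split; lra.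
    rewrite !lebesgue_measure_itv/= !lte_fin ltr_pM2r ?invr_gt0// ltrD2r.
    case: ifP => xy; last by rewrite mule0.
    rewrite -!EFinB -EFinM (gtr0_norm cp); congr EFin; field.
    by rewrite lt0r_neq0.
  have -> : aff @^-1` `]x, y]%classic =
      `[(y - a) / c, (x - a) / c[%classic.
    apply/seteqP; split => t /=; rewrite /aff !in_itv/= ltr_ndivlMr// ler_ndivrMr//;
    move=> /andP[? ?]; apply/andP; split; lra.
  rewrite !lebesgue_measure_itv/= !lte_fin ltr_nM2r ?invr_lt0// ltrD2r.
  case: ifP => xy; last by rewrite mule0.
  rewrite -!EFinB -EFinM (ltr0_norm cn); congr EFin; field.
  by rewrite ltr0_neq0.
rewrite [X in (_ * X)%E](@eq_measure_integral _ _ _ _ M)//; last first.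
  by move=> A mA _; exact: ME.
rewrite ge0_integral_mscale//= ge0_integral_pushforward// muleA -EFinM.
by rewrite mulVf ?lt0r_neq0// mul1e.
Qed.

Lemma vol_cube n (x : 'rV[R]_n) (e : R) : 0 < e ->
  (0 < vol R n [set y | forall j, (y ord0 j \in `](x ord0 j - e), (x ord0 j + e)[)%R])%E.
Proof.
move=> e0; elim: n x => [|n IH] x.
  rewrite /= diracE/= mem_set// => -[]//.
rewrite /= /volS /pushforward.
set A := (X in (_ \x _)%E X).
have -> : A = `](x ord0 ord0 - e), (x ord0 ord0 + e)%R[%classic `*`
    [set y : 'rV[R]_n | forall j, (y ord0 j \in `]((vtail x) ord0 j - e), ((vtail x) ord0 j + e)[)%R].
  apply/seteqP; split => -[t v] /= H.
    split; first by have := H ord0; rewrite vcons0.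
    by move=> j; have := H (lift ord0 j); rewrite vconsS mxE.
  move: H => [H1 H2] j; case: (unliftP ord0 j) => [i|] ->.
    by have := H2 i; rewrite vconsS mxE.
  by rewrite vcons0.
rewrite product_measure1E//.
- apply: mule_gt0; last exact: IH.
  have L : leb `](x ord0 ord0 - e), (x ord0 ord0 + e)%R[%classic = (e + e)%:E.
    rewrite lebesgue_measure_itv/= lte_fin ltrD2l gtrN// -EFinB; congr EFin; lra.
  by rewrite [X in (_ < X)%E]L lte_fin addr_gt0.
- apply: (@measurable_box n (fun j => `](vtail x ord0 j - e)%R, (vtail x ord0 j + e)%R[%classic)) => j.
  exact: measurable_itv.
Qed.

Lemma ge0_integral_affine n (f : 'rV[R]_n -> \bar R) (a : 'rV[R]_n) (c : R) :
  c != 0 -> measurable_fun setT f -> (forall t, (0 <= f t)%E) ->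
  (\int[vol R n]_x f (a + c *: x)%R = (`|c|^-1 ^+ n)%:E * \int[vol R n]_x f x)%E.
Proof.
move=> c0; elim: n f a => [|n IH] f a mf f0.
  rewrite expr0 mul1e !integral_dirac//; last first.
    (* On the one-point space a preimage is empty or everything, hence measurable. *)
    move=> _ B mB; rewrite setTI.
    by have [BT|B0] := pselect (exists x, ((fun x : 'rV[R]_0 => f (a + c *: x)%R) @^-1` B) x);
     [rewrite (_ : _ @^-1` _ = setT)|rewrite (_ : _ @^-1` _ = set0)]; rewrite ?measurableT ?measurable0//;
     apply/seteqP; split => // x; [move=> _; case: BT => y; rewrite (thinmx0 x) (thinmx0 y)|move=> Bx; apply: B0; exists x].
  by rewrite !diracT !mul1e; congr f; rewrite (thinmx0 a) (thinmx0 (_ + _)).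
have maff m (b : 'rV[R]_m) : measurable_fun setT (fun x : 'rV[R]_m => b + c *: x).
  apply: measurable_fun_rVP => j; under eq_fun do rewrite !mxE.
  apply: measurable_funD => //; apply: measurable_funM => //; exact: measurable_coord.
have mfc := measurableT_comp mf (@measurable_vcons R n).
rewrite !ge0_integral_volS//; last exact: measurableT_comp mf (maff _ a).
rewrite !fubini_tonelli1//=; last first.
  exact: (measurableT_comp (measurableT_comp mf (maff _ a)) (@measurable_vcons R n)).
rewrite /fubini_F.
pose g t := (\int[vol R n]_y f (vcons (t, y)))%E.
rewrite (_ : (fun x => _) = (fun t => (`|c|^-1 ^+ n)%:E * g (a ord0 ord0 + c * t)%R)%E); last first.
  apply/funext => t; rewrite /g -(IH _ (vtail a))//; last first.
    exact: measurableT_comp mfc (pair1_measurable _).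
  apply: eq_integral => y _; congr f; apply/rowP => j.
  rewrite 2!mxE; case: (unliftP ord0 j) => [i|] ->.
    by rewrite !vconsS/= !mxE.
  by rewrite !vcons0.
have mg : measurable_fun setT g.
  exact: (@measurable_fun_fubini_tonelli_F _ _ _ _ _ (vol R n) (fun p => f (vcons p))).
have g0 t : (0 <= g t)%E by exact: integral_ge0.
have K0 : (0 <= (`|c|^-1 ^+ n)%:E :> \bar R)%E.
  by rewrite lee_fin exprn_ge0// invr_ge0.
have mgc : measurable_fun setT (fun t : R => g (a ord0 ord0 + c * t)).
  apply: (measurableT_comp mg).
  by apply: measurable_funD => //; exact: measurable_funM.
rewrite exprS [(`|c|^-1 * _)%R]mulrC EFinM -muleA -(ge0_integral_affine1 (a ord0 ord0) c0 mg g0).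
move: (_ ^+ n)%:E K0 => K K0.
rewrite ge0_integralZl//.
Qed.

End euclid.

Definition L1 d (T : measurableType d) (R : realType) (m : set T -> \bar R)
  (f : T -> R) : Prop := m.-integrable setT (EFin \o f).

(** * Integrable functions *)

Section L1_theory.
Context d (T : measurableType d) (R : realType).
Variable m : {measure set T -> \bar R}.
Implicit Types f g : T -> R.

Lemma L1_measurable f : L1 m f -> measurable_fun setT f.
Proof. by move=> /measurable_int /measurable_EFinP. Qed.

Lemma L1D f g : L1 m f -> L1 m g -> L1 m (fun x => f x + g x).
Proof.
move=> Lf Lg; rewrite /L1 (_ : _ \o _ = (EFin \o f) \+ (EFin \o g))%E.
  exact: integrableD.
by apply/funext => x /=.
Qed.

Lemma L1Z (a : R) f : L1 m f -> L1 m (fun x => a * f x).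
Proof.
move=> Lf; rewrite /L1 (_ : _ \o _ = (fun x => a%:E * (EFin \o f) x)%E).
  exact: integrableZl.
by apply/funext => x /=.
Qed.

Lemma L1_le f g : measurable_fun setT f -> (forall x, `|f x| <= g x) ->
  L1 m g -> L1 m f.
Proof.
move=> mf fg Lg; apply: (le_integrable measurableT _ _ Lg).
  exact/measurable_EFinP.
move=> x _ /=; rewrite lee_fin (le_trans (fg x))// ler_norm//.
Qed.

Lemma L1_norm f : L1 m f -> L1 m (fun x => `|f x|).
Proof. by move=> Lf; apply: integrable_norm. Qed.

Lemma L1M_bounded f g M : L1 m f -> measurable_fun setT g ->
  (forall x, `|g x| <= M) -> L1 m (fun x => f x * g x).
Proof.
move=> Lf mg gM; apply: (@L1_le _ (fun x => M * `|f x|)).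
- by apply: measurable_funM => //; exact: L1_measurable.
- by move=> x; rewrite normrM mulrC ler_wpM2r.
- by apply: L1Z; exact: L1_norm.
Qed.

Lemma RintD f g : L1 m f -> L1 m g ->
  \int[m]_x (f x + g x) = \int[m]_x f x + \int[m]_x g x.
Proof. by move=> Lf Lg; rewrite -RintegralD. Qed.

Lemma RintZ (a : R) f : L1 m f -> \int[m]_x (a * f x) = a * \int[m]_x f x.
Proof. by move=> Lf; rewrite -RintegralZl. Qed.

Lemma RintB f g : L1 m f -> L1 m g ->
  \int[m]_x (f x - g x) = \int[m]_x f x - \int[m]_x g x.
Proof. by move=> Lf Lg; rewrite -RintegralB. Qed.

Lemma Rint_norm f : L1 m f -> `|\int[m]_x f x| <= \int[m]_x `|f x|.
Proof. by move=> Lf; exact: le_normr_Rintegral. Qed.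

Lemma Rint_EFin f : L1 m f -> (\int[m]_x (f x)%:E = (\int[m]_x f x)%R%:E)%E.
Proof. by move=> Lf; rewrite /Rintegral fineK//; apply: integrable_fin_num. Qed.

Lemma eq_Rint f g : (forall x, f x = g x) -> \int[m]_x f x = \int[m]_x g x.
Proof. by move=> fg; apply: eq_Rintegral => x _. Qed.

Lemma L1_ext f g : (forall x, f x = g x) -> L1 m f -> L1 m g.
Proof. by move=> /funext ->. Qed.

Lemma L1N f : L1 m f -> L1 m (fun x => - f x).
Proof. by move=> /(L1Z (-1)); apply: L1_ext => x; rewrite mulN1r. Qed.

Lemma RintN f : L1 m f -> \int[m]_x (- f x) = - \int[m]_x f x.
Proof.
move=> Lf; rewrite -mulN1r -(RintZ _ Lf).
by apply: eq_Rint => x; rewrite mulN1r.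
Qed.

(* The Lebesgue integral of such an [f] is infinite, and [fine] sends it to 0. *)
Lemma Rint_nonL1 f : measurable_fun setT f -> ~ L1 m f -> \int[m]_x f x = 0.
Proof.
move=> mf nL; rewrite /Rintegral; apply: contra_notP nL => I0.
apply/integrableP; split; first exact/measurable_EFinP.
rewrite (integral_fin_num_abs m measurableT mf).
by case: (\int[m]_x _)%E I0.
Qed.

(** Where f is not integrable both sides are 0. This covers the exceptional x at which F(x, .) may
    fail to be integrable although [TF] still integrates it. *)
Lemma Rint_scal (c : R) f :
  measurable_fun setT f -> \int[m]_x (c * f x) = c * \int[m]_x f x.
Proof.
move=> mf; have [->|c0] := eqVneq c 0.
  rewrite mul0r /Rintegral; under eq_integral do rewrite mul0r.
  by rewrite integral0.
have [Lf|nL] := pselect (L1 m f); first exact: RintZ.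
rewrite (Rint_nonL1 mf nL) mulr0 Rint_nonL1//; first exact: measurable_funM.
move=> /(L1Z c^-1) H; apply: nL; apply: L1_ext H => x.
by rewrite mulrA mulVf// mul1r.
Qed.

Lemma dct (f_ : nat -> T -> R) f g :
  (forall n, measurable_fun setT (f_ n)) -> L1 m g ->
  (forall n x, `|f_ n x| <= g x) ->
  (forall x, f_ n x @[n --> \oo] --> f x) ->
  L1 m f /\ \int[m]_x f_ n x @[n --> \oo] --> \int[m]_x f x.
Proof.
move=> mf Lg fg cf.
have mlim : measurable_fun setT f.
  by apply: (measurable_fun_cvg mf) => x _; exact: cf.
have cE x : (f_ n x)%:E @[n --> \oo] --> (f x)%:E.
  by apply: cvg_EFin (cf x); exact: nearW.
have [Lf _ If] := @dominated_convergence _ T R m setT measurableT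
  (fun n => EFin \o f_ n) (EFin \o f) (EFin \o g)
  (fun n => (measurable_EFinP _ _).2 (mf n)) ((measurable_EFinP _ _).2 mlim)
  (aeW _ (fun x _ => cE x)) Lg
  (aeW _ (fun x n _ => fg n x)).
split=> //; apply: fine_cvg; rewrite fineK//.
exact: integrable_fin_num.
Qed.

(** Transfers a substitution rule from nonnegative to integrable functions: it is applied to the
    positive and negative parts, both of finite integral. *)
Lemma L1_subst (phi : T -> T) (c : R) f :
  measurable_fun setT phi -> 0 <= c ->
  (forall g : T -> \bar R, measurable_fun setT g -> (forall x, (0 <= g x)%E) ->
     (\int[m]_x g (phi x) = c%:E * \int[m]_x g x)%E) ->
  L1 m f -> L1 m (f \o phi) /\ \int[m]_x f (phi x) = c * \int[m]_x f x.
Proof.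
move=> mphi c0 H Lf; have mf := L1_measurable Lf.
have mE : measurable_fun setT (EFin \o f) by exact/measurable_EFinP.
have /integrableP[_ fi] := Lf.
split.
  apply/integrableP; split.
    by apply/measurable_EFinP; exact: measurableT_comp mf mphi.
  have mabs : measurable_fun setT (fun x => `|(f x)%:E|%E) by exact: measurableT_comp.
  have /= -> := H _ mabs (fun=> abse_ge0 _).
  exact: lte_mul_pinfty.
rewrite /Rintegral integralE [in RHS]integralE.
have := H (EFin \o f)^\+%E (measurable_funepos mE) (fun=> funepos_ge0 _ _).
have := H (EFin \o f)^\-%E (measurable_funeneg mE) (fun=> funeneg_ge0 _ _).
have Fp : (\int[m]_x ((EFin \o f)^\+)%E x \is a fin_num)%E.
  exact: integrable_pos_fin_num.
have Fn : (\int[m]_x ((EFin \o f)^\-)%E x \is a fin_num)%E.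
  exact: integrable_neg_fin_num.
have E1 : (\int[m]_x (EFin \o (fun x => f (phi x)))^\+ x =
    \int[m]_x (EFin \o f)^\+ (phi x))%E.
  by apply: eq_integral => x _; rewrite !funeposE.
have E2 : (\int[m]_x (EFin \o (fun x => f (phi x)))^\- x =
    \int[m]_x (EFin \o f)^\- (phi x))%E.
  by apply: eq_integral => x _; rewrite !funenegE.
rewrite -E1 -E2 /comp => -> ->.
by rewrite /comp in Fp Fn *; rewrite -(fineK Fp) -(fineK Fn) -!EFinM -!EFinB /= mulrBr.
Qed.

End L1_theory.

(** * Fubini for real-valued integrals *)

Section product.
Context d1 d2 (T1 : measurableType d1) (T2 : measurableType d2) (R : realType).
Variables (m1 : {sigma_finite_measure set T1 -> \bar R})
          (m2 : {sigma_finite_measure set T2 -> \bar R}).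

(** The real inner integral may differ from the extended one where a section is not integrable;
    these x form a null set, so the comparison is made almost everywhere. *)
Lemma L1_section1 (f : T1 * T2 -> R) : L1 (m1 \x m2)%E f ->
  L1 m1 (fun x => \int[m2]_y f (x, y)) /\
  \int[m1]_x (\int[m2]_y f (x, y)) = \int[(m1 \x m2)%E]_p f p.
Proof.
move=> Lf.
have Lx := ae_integrable1 Lf.
have mF := measurable_fubini_F Lf.
have aeF : ae_eq m1 setT (fun x => (\int[m2]_y f (x, y))%R%:E)
   (fubini_F m2 (EFin \o f)).
  by apply: filterS Lx => x Lx _; rewrite -Rint_EFin.
have mI : measurable_fun setT (fun x => (\int[m2]_y f (x, y))%R%:E).
  apply/measurable_EFinP; exact: (measurableT_comp (fine_measurable _) mF).
have LF := integrable_fubini_F Lf.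
split.
  apply/integrableP; split => //.
  rewrite (ge0_ae_eq_integral (g := abse \o fubini_F m2 (EFin \o f)))//.
  - by case/integrableP : LF.
  - exact: measurableT_comp.
  - exact: measurableT_comp.
  - by move=> x _; exact: abse_ge0.
  - exact: ae_eq_abse aeF.
rewrite /Rintegral -integral12_prod_meas1//; congr fine.
exact: ae_eq_integral.
Qed.

Lemma L1_section2 (f : T1 * T2 -> R) : L1 (m1 \x m2)%E f ->
  L1 m2 (fun y => \int[m1]_x f (x, y)) /\
  \int[m2]_y (\int[m1]_x f (x, y)) = \int[(m1 \x m2)%E]_p f p.
Proof.
move=> Lf.
have Lx := ae_integrable2 Lf.
have mF := measurable_fubini_G Lf.
have aeF : ae_eq m2 setT (fun y => (\int[m1]_x f (x, y))%R%:E)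
   (fubini_G m1 (EFin \o f)).
  by apply: filterS Lx => x Lx _; rewrite -Rint_EFin.
have mI : measurable_fun setT (fun y => (\int[m1]_x f (x, y))%R%:E).
  apply/measurable_EFinP; exact: (measurableT_comp (fine_measurable _) mF).
have LF : m2.-integrable setT (fubini_G m1 (EFin \o f)).
  apply/integrableP; split=> //.
  have /integrableP[mf] := Lf; rewrite fubini_tonelli2//; last exact: measurableT_comp.
  apply: le_lt_trans; apply: ge0_le_integral => //.
  - exact: measurableT_comp.
  - apply: (@measurable_fun_fubini_tonelli_G _ _ _ _ _ m1 (abse \o (EFin \o f))) => //.
    exact: measurableT_comp.
  - by move=> p; exact: abse_ge0.
  - move=> y _; apply: le_abse_integral => //.
    by apply: (measurableT_comp mf); exact: pair2_measurable.
split.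
  apply/integrableP; split => //.
  rewrite (ge0_ae_eq_integral (g := abse \o fubini_G m1 (EFin \o f)))//.
  - by case/integrableP : LF.
  - exact: measurableT_comp.
  - exact: measurableT_comp.
  - by move=> x _; exact: abse_ge0.
  - exact: ae_eq_abse aeF.
rewrite /Rintegral -integral21_prod_meas1//; congr fine.
exact: ae_eq_integral.
Qed.

Lemma Rint_swap (f : T1 * T2 -> R) : L1 (m1 \x m2)%E f ->
  \int[m1]_x (\int[m2]_y f (x, y)) = \int[m2]_y (\int[m1]_x f (x, y)).
Proof. by move=> Lf; rewrite (L1_section1 Lf).2 (L1_section2 Lf).2. Qed.

(** Supplies the integrability behind the exchange of integrals in Fourier inversion, where h is the
    kernel cos(y . w). *)
Lemma L1_prod (f : T1 -> R) (g : T2 -> R) (h : T1 * T2 -> R) M :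
  L1 m1 f -> L1 m2 g -> measurable_fun setT h -> (forall p, `|h p| <= M) ->
  L1 (m1 \x m2)%E (fun p => f p.1 * g p.2 * h p).
Proof.
move=> Lf Lg mh hM.
have mf := L1_measurable Lf; have mg := L1_measurable Lg.
apply: L1M_bounded hM => //; apply/integrable12ltyP.
  apply/measurable_EFinP; apply: measurable_funM.
    exact: measurableT_comp mf measurable_fst.
  exact: measurableT_comp mg measurable_snd.
rewrite /=; have /integrableP[_ fi] := Lf; have /integrableP[_ gi] := Lg.
under eq_integral => x _.
  under eq_integral do rewrite normrM EFinM.
  rewrite ge0_integralZl//; last first.
    by apply/measurable_EFinP; exact: measurableT_comp mg.
  over.
rewrite ge0_integralZr//; first by apply: lte_mul_pinfty => //; [exact: integral_ge0|rewrite ge0_fin_numE//; exact: integral_ge0].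
  by apply/measurable_EFinP; exact: measurableT_comp mf.
exact: integral_ge0.
Qed.

End product.

(** * Affine substitution and an integrable weight *)

Section volume.
Variable R : realType.
Local Notation leb := (@lebesgue_measure R).

Lemma L1_affine n (f : 'rV[R]_n -> R) (a : 'rV[R]_n) (c : R) : c != 0 ->
  L1 (vol R n) f -> L1 (vol R n) (fun x => f (a + c *: x)) /\
  \int[vol R n]_x f (a + c *: x) = `|c|^-1 ^+ n * \int[vol R n]_x f x.
Proof.
move=> c0; apply: L1_subst.
- apply: measurable_fun_rVP => j; under eq_fun do rewrite !mxE.
  apply: measurable_funD => //; apply: measurable_funM => //; exact: measurable_coord.
- by rewrite exprn_ge0.
- by move=> g mg g0; exact: ge0_integral_affine.
Qed.

Lemma Rint_reflect n (f : 'rV[R]_n -> R) : L1 (vol R n) f ->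
  L1 (vol R n) (fun x => f (- x)) /\
  \int[vol R n]_x f (- x) = \int[vol R n]_x f x.
Proof.
move=> Lf; have [] := @L1_affine n f 0 (-1) _ Lf; first by rewrite oppr_eq0 oner_eq0.
rewrite normrN1 invr1 expr1n mul1r.
rewrite (_ : (fun x => f (0 + -1 *: x)) = fun x => f (- x)); last first.
  by apply/funext => x; rewrite add0r scaleN1r.
by [].
Qed.

Lemma integral_vol_prod n (g : R -> R) (c : R) :
  measurable_fun setT g -> (forall t, 0 <= g t) ->
  (\int[leb]_t (g t)%:E = c%:E)%E ->
  (\int[vol R n]_x (\prod_(j < n) g (x ord0 j))%:E = (c ^+ n)%:E)%E.
Proof.
move=> mg g0 gc; elim: n => [|n IH].
  under eq_integral do rewrite big_ord0.
  by rewrite /= integral_dirac// diracT mul1e.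
have mP k : measurable_fun setT (fun x : 'rV[R]_k => (\prod_(j < k) g (x ord0 j))%:E).
  apply/measurable_EFinP; apply: measurable_prod => j _.
  exact: measurableT_comp mg (measurable_coord _).
have P0 k (x : 'rV[R]_k) : 0 <= \prod_(j < k) g (x ord0 j) by exact: prodr_ge0.
rewrite ge0_integral_volS//; last by move=> x; rewrite lee_fin.
rewrite fubini_tonelli1//=; last 2 first.
- exact: measurableT_comp (mP n.+1) (@measurable_vcons R n).
- by move=> p; rewrite lee_fin P0.
transitivity (\int[leb]_t ((g t)%:E * (c ^+ n)%:E))%E.
  apply: eq_integral => t _; rewrite -IH /fubini_F.
  rewrite -ge0_integralZl ?lee_fin//; last by move=> x _; rewrite lee_fin.
  apply: eq_integral => y _; rewrite big_ord_recl vcons0 EFinM.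
  by under eq_bigr do rewrite vconsS.
rewrite ge0_integralZr//.
- by rewrite gc exprS EFinM.
- exact/measurable_EFinP.
- by move=> t _; rewrite lee_fin.
- have c0 : (0 <= c%:E)%E by rewrite -gc; apply: integral_ge0 => t _; rewrite lee_fin.
  by rewrite lee_fin exprn_ge0.
Qed.

(** Comparison weight for Schwartz functions; the product form reduces its integral to the
    arctangent integral in one variable. *)
Definition rho n (x : 'rV[R]_n) : R := \prod_(j < n) (1 + x ord0 j ^+ 2)^-1.

Lemma integral_inv_oneDsqr :
  (\int[leb]_t ((1 + t ^+ 2)^-1)%:E = pi%:E)%E.
Proof.
have mf : measurable_fun setT (fun t : R => (1 + t ^+ 2)^-1).
  exact: (continuous_measurable_fun (@continuous_oneDsqrV R)).
have f0 (t : R) : (0 <= ((1 + t ^+ 2)^-1)%:E)%E.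
  by rewrite lee_fin invr_ge0 addr_ge0// sqr_ge0.
have mE : measurable_fun setT (fun t : R => ((1 + t ^+ 2)^-1)%:E) by exact/measurable_EFinP.
have I1 := @integral0y_oneDsqr R.
rewrite -(setUv `[0%R, +oo[%classic) ge0_integral_setU//=; last 3 first.
- exact: measurableC.
- exact: measurable_funTS.
- by apply/disj_setPS; rewrite setICr.
have I2 := @ge0_integration_by_substitution0 R _ mE f0.
rewrite setCitvr.
rewrite [X in (_ + X)%E](_ : _ = \int[leb]_(t in `]-oo, 0%R]) ((1 + t ^+ 2)^-1)%:E)%E; last first.
  by rewrite integral_itv_bndo_bndc//; exact: measurable_funTS.
rewrite [X in (_ + X)%E](_ : _ = \int[leb]_(t in `]-oo, 0%R]) ((1 + (- t) ^+ 2)^-1)%:E)%E; last first.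
  by apply: eq_integral => t _; rewrite sqrrN.
by rewrite -I2 I1 -EFinD -splitr.
Qed.

Lemma L1_rho n : L1 (vol R n) (@rho n).
Proof.
have mf : measurable_fun setT (fun t : R => (1 + t ^+ 2)^-1).
  exact: (continuous_measurable_fun (@continuous_oneDsqrV R)).
have f0 (t : R) : 0 <= (1 + t ^+ 2)^-1.
  by rewrite invr_ge0 addr_ge0// sqr_ge0.
apply/integrableP; split.
  apply/measurable_EFinP; apply: measurable_prod => j _.
  exact: measurableT_comp mf (measurable_coord _).
rewrite (eq_integral (fun x => (rho x)%:E)); last first.
  by move=> x _ /=; rewrite ger0_norm//; exact: prodr_ge0.
by rewrite (integral_vol_prod n mf f0 integral_inv_oneDsqr) ltry.
Qed.

End volume.

(** * Schwartz functions *)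

Section partial_derivatives.
Variables (R : realType) (n : nat).
Local Notation V := 'rV[R]_n.
Implicit Types (f g : V -> R) (x v : V) (j : 'I_n).

(** Reduces directional derivatives to ordinary ones along a line, where the chain rule and the mean
    value theorem of one variable apply. *)
Lemma is_derive_line f x v (t df : R) :
  is_derive (x + t *: v) v f df <-> is_derive t 1 (fun s => f (x + s *: v)) df.
Proof.
have E : (fun h : R => h^-1 *: (((fun s => f (x + s *: v)) \o shift t) (h *: 1) -
      f (x + t *: v))) =
    (fun h : R => h^-1 *: ((f \o shift (x + t *: v)) (h *: v) - f (x + t *: v))).
  apply/funext => h /=; congr (_ *: (f _ - _)).
  by rewrite -[h *: 1]/(h * 1) mulr1 scalerDl addrCA.
have D1 : derivable (fun s : R => f (x + s *: v)) t 1 = derivable f (x + t *: v) v.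
  by rewrite /derivable -E; reflexivity.
have D2 : derive (fun s : R => f (x + s *: v)) t 1 = derive f (x + t *: v) v.
  by rewrite /derive -E; reflexivity.
split => -[H1 H2]; split.
- by rewrite D1; exact: H1.
- by rewrite D2; exact: H2.
- by rewrite -D1; exact: H1.
- by rewrite -D2; exact: H2.
Qed.

Lemma is_derive_line0 f x v (df : R) :
  is_derive x v f df <-> is_derive (0 : R) 1 (fun s => f (x + s *: v)) df.
Proof. by rewrite -is_derive_line scale0r addr0. Qed.

Definition partial j f : V -> R := fun x => derive f x (ev R j).

Lemma is_derive_partial f (df : V -> R) j :
  (forall x, is_derive x (ev R j) f (df x)) -> partial j f = df.
Proof. by move=> H; apply/funext => x; exact: (@derive_val _ _ _ _ _ _ _ (H x)). Qed.

Lemma derivable_partial f j x : derivable f x (ev R j) ->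
  is_derive x (ev R j) f (partial j f x).
Proof. by move=> H; split. Qed.

Lemma is_derive_add f g x v (df dg : R) : is_derive x v f df ->
  is_derive x v g dg -> is_derive x v (fun y => f y + g y) (df + dg).
Proof. by move=> Hf Hg; exact: is_deriveD. Qed.

Lemma is_derive_mul f g x v (df dg : R) : is_derive x v f df ->
  is_derive x v g dg ->
  is_derive x v (fun y => f y * g y) (df * g x + f x * dg).
Proof.
move=> Hf Hg; have := @is_deriveM _ _ f g x v df dg Hf Hg.
by move=> H; apply: (is_derive_eq H); rewrite addrC; congr (_ + _); exact: mulrC.
Qed.

Lemma is_derive_scal f x v (a df : R) : is_derive x v f df ->
  is_derive x v (fun y => a * f y) (a * df).
Proof. by move=> Hf; exact: (@is_deriveZ _ _ _ f a x v df Hf). Qed.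

Lemma is_derive_affine1 (a b t : R) : is_derive t 1 (fun s => a + s * b) b.
Proof.
have H : is_derive t 1 (cst a + id * cst b : R -> R) (0 + (t *: 0 + b *: 1)).
  exact: is_deriveD.
by apply: (is_derive_eq H); rewrite scaler0 !add0r -[b *: 1]/(b * 1) mulr1.
Qed.

Lemma is_derive_coord x i j :
  is_derive x (ev R j) (fun y : V => y ord0 i) (i == j)%:R.
Proof.
apply/is_derive_line0; rewrite (_ : (fun s => _) =
   (fun s => x ord0 i + s * (i == j)%:R)); first exact: is_derive_affine1.
by apply/funext => s; rewrite !mxE eqxx.
Qed.

Lemma vdotDr (w x y : V) : vdot w (x + y) = vdot w x + vdot w y.
Proof. by rewrite /vdot -big_split; apply: eq_bigr => j _; rewrite mxE mulrDr. Qed.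

Lemma vdotZr (w x : V) (a : R) : vdot w (a *: x) = a * vdot w x.
Proof. by rewrite /vdot big_distrr; apply: eq_bigr => j _; rewrite mxE mulrCA. Qed.

Lemma vdotC (w x : V) : vdot w x = vdot x w.
Proof. by apply: eq_bigr => j _; rewrite mulrC. Qed.

Lemma vdotDl (w x y : V) : vdot (x + y) w = vdot x w + vdot y w.
Proof. by rewrite vdotC vdotDr !(vdotC w). Qed.

Lemma vdotZl (w x : V) (a : R) : vdot (a *: x) w = a * vdot x w.
Proof. by rewrite vdotC vdotZr !(vdotC w). Qed.

Lemma vdotNr (w x : V) : vdot w (- x) = - vdot w x.
Proof. by rewrite -scaleN1r vdotZr mulN1r. Qed.

Lemma vdotNl (w x : V) : vdot (- x) w = - vdot x w.
Proof. by rewrite vdotC vdotNr vdotC. Qed.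

Lemma vdot0l (w : V) : vdot 0 w = 0.
Proof. by rewrite /vdot big1// => j _; rewrite mxE mul0r. Qed.

Lemma vdot_ev (w : V) j : vdot w (ev R j) = w ord0 j.
Proof.
rewrite /vdot (bigD1 j)//= big1 ?addr0; first by rewrite mxE !eqxx mulr1.
by move=> i ij; rewrite mxE eqxx (negbTE ij) mulr0.
Qed.

Lemma is_derive_vdot (w x : V) j :
  is_derive x (ev R j) (fun y => vdot w y) (w ord0 j).
Proof.
apply/is_derive_line0; rewrite (_ : (fun s => _) =
   (fun s => vdot w x + s * w ord0 j)); first exact: is_derive_affine1.
by apply/funext => s; rewrite vdotDr vdotZr vdot_ev.
Qed.

Lemma is_derive_comp1 (phi : R -> R) (g : V -> R) x v (dphi dg : R) :
  is_derive (g x) 1 phi dphi -> is_derive x v g dg ->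
  is_derive x v (fun y => phi (g y)) (dphi * dg).
Proof.
move=> Hp /is_derive_line0 Hg; apply/is_derive_line0.
apply: (@is_derive1_comp R phi (fun s => g (x + s *: v)) 0 dphi dg) => //.
by rewrite scale0r addr0.
Qed.

Lemma is_derive_dilate f x (c df : R) j : is_derive (c *: x) (ev R j) f df ->
  is_derive x (ev R j) (fun y => f (c *: y)) (c * df).
Proof.
move=> /is_derive_line0 Hf; apply/is_derive_line0.
rewrite (_ : (fun s => _) = (fun s => f (c *: x + (0 + s * c) *: ev R j))); last first.
  by apply/funext => s; rewrite add0r scalerDr scalerA mulrC.
rewrite mulrC.
apply: (@is_derive1_comp R (fun s => f (c *: x + s *: ev R j)) (fun s => 0 + s * c) 0 df c).
  by rewrite mul0r addr0.
exact: is_derive_affine1.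
Qed.

Lemma mvt_line f (df : V -> R) j x (t M : R) :
  (forall y, is_derive y (ev R j) f (df y)) -> (forall y, `|df y| <= M) ->
  `|f (x + t *: ev R j) - f x| <= M * `|t|.
Proof.
move=> Hf HM.
pose g (s : R) := f (x + s *: ev R j).
have dg (s : R) : is_derive s 1 g (df (x + s *: ev R j)) by exact/is_derive_line.
have cg (a b : R) : {within `[a, b], continuous g}.
  by apply: derivable_within_continuous => s _; case: (dg s).
have key (a b : R) : a < b -> `|g b - g a| <= M * `|b - a|.
  move=> ab; have [c _ ->] := MVT ab (fun s _ => dg s) (cg a b).
  by rewrite normrM ler_wpM2r.
have -> : f x = g 0 by rewrite /g scale0r addr0.
rewrite -/(g t) -[X in `|X|]subr0.
have [t0|t0|->] := ltgtP t 0.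
- by rewrite subr0 distrC; have := key _ _ t0; rewrite sub0r normrN.
- by rewrite subr0; have := key _ _ t0; rewrite subr0.
- by rewrite subr0 subrr !normr0 mulr0.
Qed.

(** [rschwartz] provides derivatives along the axes only, which alone do not give continuity. Moving
    from x to y one coordinate at a time, with the mean value theorem on each leg, turns bounded
    partials into a Lipschitz bound. *)
Lemma lipschitz_partial f (df : 'I_n -> V -> R) (M : R) :
  (forall j y, is_derive y (ev R j) f (df j y)) ->
  (forall j y, `|df j y| <= M) ->
  forall x y, `|f y - f x| <= M * \sum_j `|y ord0 j - x ord0 j|.
Proof.
move=> Hf HM x y.
have key (s : seq 'I_n) :
    `|f (x + \sum_(j <- s) (y ord0 j - x ord0 j) *: ev R j) - f x| <=
    M * \sum_(j <- s) `|y ord0 j - x ord0 j|.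
  elim: s => [|j s IH]; first by rewrite !big_nil addr0 subrr normr0 mulr0.
  rewrite !big_cons addrCA addrC mulrDr.
  set z := x + _ in IH *; set c := y ord0 j - _.
  rewrite -(subrKA (f z)); apply: (le_trans (ler_normD _ _)).
  by apply: lerD => //; exact: (mvt_line _ _ (Hf j)).
have := key (index_enum _); congr (`|f _ - _| <= _).
transitivity (x + (y - x)); last by rewrite addrC subrK.
congr (x + _); rewrite [RHS]row_sum_delta.
by apply: eq_bigr => j _; rewrite !mxE.
Qed.

Lemma lipschitz_continuous_rV f (M : R) :
  (forall x y : V, `|f y - f x| <= M * \sum_j `|y ord0 j - x ord0 j|) ->
  continuous f.
Proof.
move=> Hf x A /nbhs_ballP[e e0 eA].
(* The increments keep D positive when M or n vanishes and make the last estimate strict. *)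
pose D := (`|M| + 1) * n.+1%:R.
have D0 : 0 < D by rewrite mulr_gt0// ltr_wpDl.
have d0 : 0 < e / D by rewrite divr_gt0.
apply/nbhs_ballP; exists (e / D) => // y [_ xy]; apply: eA.
have yx j : `|y ord0 j - x ord0 j| <= e / D.
  by rewrite distrC; apply: ltW; exact: xy.
rewrite /ball/= distrC (le_lt_trans (Hf x y))//.
apply: (@le_lt_trans _ _ (`|M| * \sum_(j < n) (e / D))).
  apply: (@le_trans _ _ (`|M| * \sum_j `|y ord0 j - x ord0 j|)).
    by apply: ler_wpM2r; [exact: sumr_ge0|exact: ler_norm].
  by apply: ler_wpM2l => //; apply: ler_sum => j _.
rewrite sumr_const card_ord -mulr_natr.
rewrite [ltRHS](_ : e = D * (e / D)); last by rewrite mulrC divfK ?lt0r_neq0.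
rewrite [_ / D * _]mulrC mulrA ltr_pM2r//.
apply: (@le_lt_trans _ _ (`|M| * n.+1%:R)).
  by rewrite ler_wpM2l// ler_nat.
by rewrite /D ltr_pM2r// ltrDl.
Qed.

End partial_derivatives.

(** * Closure properties and decay of Schwartz functions *)

Section schwartz_class.
Variables (R : realType) (n : nat).
Local Notation V := 'rV[R]_n.
Implicit Types (f g : V -> R) (x v : V) (j : 'I_n).

Definition monom (al : 'I_n -> nat) x : R := \prod_(j < n) x ord0 j ^+ al j.

Lemma monomS (al : 'I_n -> nat) i x :
  monom (fun j => al j + (j == i))%N x = x ord0 i * monom al x.
Proof.
rewrite /monom (bigD1 i)//= [in RHS](bigD1 i)//= eqxx addn1 exprS -mulrA.
congr (_ * (_ * _)); apply: eq_bigr => j /negbTE ->.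
by rewrite addn0.
Qed.

(** A class closed under partial derivatives contains all iterated ones, so bounds on its members
    suffice. Exhibiting such a class replaces any formula for iterated derivatives. *)
Lemma rschwartz_class (G : (V -> R) -> Prop) :
  (forall f j, G f -> exists2 df, G df &
     forall x, is_derive x (ev R j) f (df x)) ->
  (forall f al, G f -> exists M : R, forall x, `|monom al x * f x| <= M) ->
  forall f, G f -> rschwartz f.
Proof.
move=> Gd Gb f Gf.
have Gi (s : seq 'I_n) : G (iderive s f).
  elim: s => //= j s IH; have [df Gdf Hdf] := Gd _ j IH.
  by rewrite -/(partial j (iderive s f)) (is_derive_partial Hdf).
split=> [s j x|al s]; last exact: Gb.
have [df _ Hdf] := Gd _ j (Gi s); exact: (@ex_derive _ _ _ _ _ _ _ (Hdf x)).
Qed.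

Lemma rschwartz_derive f j x : rschwartz f ->
  is_derive x (ev R j) f (partial j f x).
Proof. by move=> [H _]; apply: derivable_partial; exact: (H [::] j x). Qed.

Lemma rschwartz_partial f j : rschwartz f -> rschwartz (partial j f).
Proof.
have E s : iderive s (partial j f) = iderive (rcons s j) f.
  by elim: s => //= i s ->.
by move=> [H1 H2]; split => [s i x|al s]; rewrite E; [exact: H1|exact: H2].
Qed.

Lemma rschwartz_monom f al : rschwartz f ->
  exists M : R, forall x, `|monom al x * f x| <= M.
Proof. by move=> [_ /(_ al [::])]. Qed.

Lemma rschwartz_bounded f : rschwartz f -> exists M : R, forall x, `|f x| <= M.
Proof.
move=> Sf; have [M HM] := rschwartz_monom (fun=> 0%N) Sf; exists M => x.
by have := HM x; rewrite /monom big1 ?mul1r// => j _; rewrite expr0.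
Qed.

Lemma rschwartz_lipschitz f : rschwartz f ->
  exists M : R, forall x y : V, `|f y - f x| <= M * \sum_j `|y ord0 j - x ord0 j|.
Proof.
move=> Sf.
have /choice[M HM] j := rschwartz_bounded (rschwartz_partial j Sf).
exists (\sum_j `|M j|).
apply: (@lipschitz_partial _ _ _ (fun j => partial j f)) => [j y|j y].
  exact: rschwartz_derive.
rewrite (le_trans (HM j y))// (le_trans (ler_norm _))//.
by rewrite (bigD1 j)//= lerDl sumr_ge0.
Qed.

Lemma rschwartz_continuous f : rschwartz f -> continuous f.
Proof. by move=> /rschwartz_lipschitz[M]; exact: lipschitz_continuous_rV. Qed.

Lemma rschwartz_measurable f : rschwartz f -> measurable_fun setT f.
Proof. by move=> Sf; apply: continuous_measurable_rV; exact: rschwartz_continuous. Qed.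

Lemma rho_gt0 x : 0 < rho x.
Proof. by apply: prodr_gt0 => j _; rewrite invr_gt0 ltr_wpDr// sqr_ge0. Qed.

(** The inverse of [rho] is the product of the 1 + x_j^2; expanding one factor at a time leaves
    monomials times f, which are bounded. *)
Lemma rschwartz_rho f : rschwartz f ->
  exists2 M : R, 0 <= M & forall x, `|f x| <= M * rho x.
Proof.
move=> Sf.
have key (s : seq 'I_n) al : exists M : R, forall x,
    `|(\prod_(j <- s) (1 + x ord0 j ^+ 2)) * (monom al x * f x)| <= M.
  elim: s al => [|i s IH] al.
    have [M HM] := rschwartz_monom al Sf; exists M => x.
    by rewrite big_nil mul1r.
  have [M1 H1] := IH al.
  (* The exponent of x_i is raised twice to account for the term x_i^2 of the new factor. *)
  have [M2 H2] := IH (fun j => (al j + (j == i)) + (j == i))%N.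
  exists (M1 + M2) => x; rewrite big_cons.
  rewrite (_ : _ * _ = \prod_(j <- s) (1 + x ord0 j ^+ 2) * (monom al x * f x) +
     \prod_(j <- s) (1 + x ord0 j ^+ 2) *
      (monom (fun j => (al j + (j == i)) + (j == i))%N x * f x)).
    by rewrite (le_trans (ler_normD _ _))// lerD.
  by rewrite !monomS; ring.
have [M HM] := key (index_enum _) (fun=> 0%N).
exists `|M| => // x; apply: (@le_trans _ _ (M * rho x)); last first.
  by rewrite ler_wpM2r ?ler_norm// ltW// rho_gt0.
rewrite -ler_pdivrMr ?rho_gt0//.
apply: le_trans (HM x); rewrite normrM mulrC.
have -> : monom (fun=> 0%N) x = 1 by rewrite /monom big1// => j _; rewrite expr0.
rewrite mul1r.
by rewrite ler_wpM2r// /rho prodfV invrK ler_norm//.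
Qed.

Lemma rschwartz_L1 f : rschwartz f -> L1 (vol R n) f.
Proof.
move=> Sf; have [M M0 HM] := rschwartz_rho Sf.
apply: (L1_le (rschwartz_measurable Sf) HM).
by apply: L1Z; exact: L1_rho.
Qed.

Lemma rschwartz_lin f g (a b : R) : rschwartz f -> rschwartz g ->
  rschwartz (fun x => a * f x + b * g x).
Proof.
move=> Sf Sg.
apply: (@rschwartz_class (fun h => exists f g, [/\ rschwartz f, rschwartz g &
  h = fun x => a * f x + b * g x])).
- move=> _ j [f1 [g1 [Sf1 Sg1 ->]]].
  exists (fun x => a * partial j f1 x + b * partial j g1 x).
    by exists (partial j f1), (partial j g1); split => //; exact: rschwartz_partial.
  by move=> x; apply: is_derive_add; apply: is_derive_scal; exact: rschwartz_derive.
- move=> _ al [f1 [g1 [Sf1 Sg1 ->]]].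
  have [M1 H1] := rschwartz_monom al Sf1; have [M2 H2] := rschwartz_monom al Sg1.
  exists (`|a| * M1 + `|b| * M2) => x.
  rewrite mulrDr (le_trans (ler_normD _ _))// !(mulrCA (monom al x)) !(normrM _ (monom al x * _)).
  by rewrite lerD// ler_wpM2l.
- by exists f, g.
Qed.

Lemma rschwartz_dilate f (c : R) : c != 0 -> rschwartz f ->
  rschwartz (fun x => f (c *: x)).
Proof.
move=> c0 Sf.
apply: (@rschwartz_class (fun h => exists2 f, rschwartz f &
  h = fun x => f (c *: x))).
- move=> _ j [f1 Sf1 ->]; exists (fun x => c * partial j f1 (c *: x)).
    exists (fun x => c * partial j f1 x + 0 * partial j f1 x).
      by apply: rschwartz_lin; exact: rschwartz_partial.
    by apply/funext => x; rewrite mul0r addr0.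
  by move=> x; apply: is_derive_dilate; exact: rschwartz_derive.
- move=> _ al [f1 Sf1 ->].
  have [M HM] := rschwartz_monom al Sf1.
  exists (`|\prod_(j < n) c^-1 ^+ al j| * M) => x.
  have -> : monom al x = (\prod_(j < n) c^-1 ^+ al j) * monom al (c *: x).
    rewrite /monom -big_split; apply: eq_bigr => j _ /=.
    by rewrite mxE exprMn mulrA -exprMn mulVf// expr1n mul1r.
  by rewrite -mulrA normrM ler_wpM2l.
- by exists f.
Qed.

Lemma rschwartz_scal f (a : R) : rschwartz f -> rschwartz (fun x => a * f x).
Proof.
by move=> Sf; have := rschwartz_lin a 0 Sf Sf; under eq_fun do rewrite mul0r addr0.
Qed.

Lemma rschwartzD f g : rschwartz f -> rschwartz g ->
  rschwartz (fun x => f x + g x).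
Proof.
by move=> Sf Sg; have := rschwartz_lin 1 1 Sf Sg; under eq_fun do rewrite !mul1r.
Qed.

(** By Leibniz, a partial derivative of x_i f is a sum that leaves the set of such products; this
    closure is stable, as [rschwartz_class] demands. *)
Inductive coord_closure : (V -> R) -> Prop :=
| coord_closure_base f : rschwartz f -> coord_closure f
| coord_closure_mul i f : coord_closure f ->
    coord_closure (fun x => x ord0 i * f x)
| coord_closure_add f g : coord_closure f -> coord_closure g ->
    coord_closure (fun x => f x + g x).

Lemma rschwartz_mulcoord f i : rschwartz f ->
  rschwartz (fun x => x ord0 i * f x).
Proof.
move=> Sf; apply: (@rschwartz_class coord_closure).
- move=> h j; elim=> {h} [h Sh|k h Ch [dh Cdh Hdh]|h1 h2 C1 [d1 Cd1 H1] C2 [d2 Cd2 H2]].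
  + by exists (partial j h) => [|x]; [apply: coord_closure_base; exact: rschwartz_partial|exact: rschwartz_derive].
  + exists (fun x => (k == j)%:R * h x + x ord0 k * dh x).
      case: (k == j).
        under eq_fun do rewrite mul1r.
        by apply: coord_closure_add => //; exact: coord_closure_mul.
      by under eq_fun do rewrite mul0r add0r; exact: coord_closure_mul.
    by move=> x; apply: is_derive_mul => //; exact: is_derive_coord.
  + exists (fun x => d1 x + d2 x); first exact: coord_closure_add.
    by move=> x; exact: is_derive_add.
- move=> h al Ch; elim: Ch al => {h} [h Sh|k h Ch IH|h1 h2 C1 IH1 C2 IH2] al.
  + exact: rschwartz_monom.
  + have [M HM] := IH (fun j => al j + (j == k))%N; exists M => x.
    by have := HM x; rewrite monomS mulrCA mulrA.
  + have [M1 H1] := IH1 al; have [M2 H2] := IH2 al; exists (M1 + M2) => x.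
    by rewrite mulrDr (le_trans (ler_normD _ _))// lerD.
- by apply: coord_closure_mul; exact: coord_closure_base.
Qed.

End schwartz_class.

(** Domination for |t| < 1 suffices for a derivative at 0; other points are reached by recentring
    the line. *)
Lemma is_derive_Rintegral d (T : measurableType d) (R : realType)
    (m : {measure set T -> \bar R}) (f df : R -> T -> R) (G : T -> R) :
  (forall t, L1 m (f t)) -> (forall (t : R) y, is_derive t 1 (f^~ y) (df t y)) ->
  L1 m G -> (forall t y, `|t| < 1 -> `|df t y| <= G y) ->
  is_derive (0 : R) 1 (fun t => \int[m]_y f t y) (\int[m]_y df 0 y).
Proof.
move=> Lf Hd LG HG.
have E t y : partial1of2 f t y = df t y.
  by rewrite /partial1of2 derive1E; case: (Hd t y).
have I0 : `](-1), 1[%classic (0 : R) by rewrite /= in_itv/=; apply/andP; split; lra.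
have G0 y : 0 <= G y.
  by apply: le_trans (HG 0 y _); rewrite // normr0.
have HG' (t : R) y : `](-1), 1[%classic t -> [set: T] y -> `|partial1of2 f t y| <= G y.
  by rewrite E => /= t1 _; apply: HG; move: t1; rewrite in_itv/= ltr_norml.
have D1 := @derivable_under_integral R d T m f setT measurableT 0 (-1) 1 I0
  (fun t _ => Lf t) (fun t y _ _ => @ex_derive _ _ _ _ _ _ _ (Hd t y)) G G0 LG HG'.
have D2 := @differentiation_under_integral R d T m f setT measurableT 0 (-1) 1 I0
  (fun t _ => Lf t) (fun t y _ _ => @ex_derive _ _ _ _ _ _ _ (Hd t y)) G G0 LG HG'.
split; first exact: D1.
rewrite -derive1E D2.
by apply: eq_Rint => y; exact: E.
Qed.

(** * Cosine transform and Fourier inversion *)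

Section fourier.
Variables (R : realType) (n : nat).
Local Notation V := 'rV[R]_n.
Implicit Types (f g : V -> R) (x w : V) (j : 'I_n) (th : R).
Local Notation mu := (vol R n).

Lemma measurable_vdot2 : measurable_fun setT (fun p : V * V => vdot p.1 p.2).
Proof.
apply: measurable_sum => j; apply: measurable_funM.
  exact: measurableT_comp (measurable_coord j) measurable_fst.
exact: measurableT_comp (measurable_coord j) measurable_snd.
Qed.

Lemma measurable_vdot w : measurable_fun setT (vdot w).
Proof. exact: measurableT_comp measurable_vdot2 (pair1_measurable w). Qed.

Lemma measurable_cos_comp d (T : measurableType d) (g : T -> R) :
  measurable_fun setT g -> measurable_fun setT (fun t => cos (g t)).
Proof.
by move=> mg; apply: measurableT_comp mg; apply: continuous_measurable_fun; exact: continuous_cos.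
Qed.

Lemma measurable_cos_vdot w th :
  measurable_fun setT (fun x : V => cos (vdot w x + th)).
Proof.
by apply: measurable_cos_comp; apply: measurable_funD => //; exact: measurable_vdot.
Qed.

Lemma cos_norm_le1 (a : R) : `|cos a| <= 1.
Proof. by rewrite ler_norml cos_geN1 cos_le1. Qed.

Lemma sin_norm_le1 (a : R) : `|sin a| <= 1.
Proof. by rewrite ler_norml sin_geN1 sin_le1. Qed.

(** Dominates all short translates of [rho] at once, as differentiation under the integral
    requires. *)
Lemma rho_shift x j (t : R) : `|t| < 1 -> rho (x + t *: ev R j) <= 3 * rho x.
Proof.
move=> t1; rewrite /rho (bigD1 j)//= [in leRHS](bigD1 j)//= mulrA.
rewrite (_ : \prod_(i < n | i != j) (1 + (x + t *: ev R j) ord0 i ^+ 2)^-1 =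
    \prod_(i < n | i != j) (1 + x ord0 i ^+ 2)^-1); last first.
  apply: eq_bigr => i /negbTE ij; rewrite !mxE eqxx ij mulr0 addr0//.
apply: ler_wpM2r.
  by apply: prodr_ge0 => i _; rewrite invr_ge0 addr_ge0// sqr_ge0.
rewrite !mxE !eqxx mulr1.
set a := x ord0 j.
have a0 : 0 < 1 + a ^+ 2 by rewrite ltr_wpDr// sqr_ge0.
have b0 : 0 < 1 + (a + t) ^+ 2 by rewrite ltr_wpDr// sqr_ge0.
rewrite -[leLHS]mul1r ler_pdivrMr// mulrAC ler_pdivlMr// mul1r.
have : t ^+ 2 <= 1 by rewrite -real_normK ?num_real// expr_le1// ltW.
(* (a + 2t)^2 = 2(a + t)^2 + 2t^2 - a^2, so a^2 <= 2(a + t)^2 + 2, which yields the constant 3. *)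
have := sqr_ge0 (a + 2 * t).
rewrite !expr2; nra.
Qed.

(* Translation invariance makes [t |-> \int g (x + t e_j) dx] constant. *)
Lemma Rint_partial0 (g dg : V -> R) j (M : R) :
  measurable_fun setT g -> measurable_fun setT dg ->
  (forall x, is_derive x (ev R j) g (dg x)) ->
  (forall x, `|g x| <= M * rho x) -> (forall x, `|dg x| <= M * rho x) ->
  \int[mu]_x dg x = 0.
Proof.
move=> mg mdg Hd Hg Hdg.
have Lr : L1 mu (fun x => M * rho x) by apply: L1Z; exact: L1_rho.
have Lg : L1 mu g by exact: L1_le Lr.
have M0 : 0 <= M.
  by have := le_trans (normr_ge0 _) (Hg 0); rewrite pmulr_lge0// rho_gt0.
have tr (t : R) : L1 mu (fun x => g (x + t *: ev R j)) /\
    \int[mu]_x g (x + t *: ev R j) = \int[mu]_x g x.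
  have [] := @L1_affine R n g (t *: ev R j) 1 (oner_neq0 _) Lg.
  rewrite normr1 invr1 expr1n mul1r.
  by under eq_fun do rewrite scale1r addrC.
have := @is_derive_Rintegral _ _ _ mu (fun t x => g (x + t *: ev R j))
  (fun t x => dg (x + t *: ev R j)) (fun x => 3 * (M * rho x))
  (fun t => (tr t).1) _ _ _.
case.
- by move=> t y; apply/is_derive_line.
- by apply: L1Z.
- move=> t y t1; rewrite (le_trans (Hdg _))// mulrCA ler_wpM2l//.
  exact: rho_shift.
move=> _; rewrite (_ : (fun t => _) = cst (\int[mu]_x g x)); last first.
  by apply/funext => t; rewrite (tr t).2.
rewrite derive_cst => /esym.
by under eq_Rint do rewrite scale0r addr0.
Qed.

(** Fourier transform in real form: th = 0 is the cosine transform, th = -pi/2 the sine transform.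
    Carrying the phase keeps the family stable, since differentiation shifts it by pi/2. *)
Definition K f th w : R := \int[mu]_x (f x * cos (vdot w x + th)).

Lemma L1_K f th w : L1 mu f -> L1 mu (fun x => f x * cos (vdot w x + th)).
Proof.
move=> Lf; apply: (L1M_bounded (M := 1) Lf (measurable_cos_vdot _ _)) => x.
exact: cos_norm_le1.
Qed.

Lemma K_bounded f th w : L1 mu f -> `|K f th w| <= \int[mu]_x `|f x|.
Proof.
move=> Lf; have LK := L1_K th w Lf.
rewrite /K (le_trans (Rint_norm LK))// le_Rintegral//; try exact: L1_norm.
move=> x _; rewrite normrM ler_piMr// cos_norm_le1//.
Qed.

Lemma is_derive_cos_vdot w x j th :
  is_derive x (ev R j) (fun y => cos (vdot w y + th))
    (w ord0 j * cos (vdot w x + (th + pi / 2))).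
Proof.
have H : is_derive x (ev R j) (fun y => vdot w y + th) (w ord0 j + 0).
  by apply: is_derive_add; exact: is_derive_vdot.
have := is_derive_comp1 (is_derive_cos (vdot w x + th)) H.
move=> H'; apply: (is_derive_eq H').
by rewrite addrA cosDpihalf addr0 mulrC.
Qed.

Lemma K_derive f th w j : rschwartz f ->
  is_derive w (ev R j) (K f th)
    (K (fun x => x ord0 j * f x) (th + pi / 2) w).
Proof.
move=> Sf; apply/is_derive_line0.
have Sxf := rschwartz_mulcoord j Sf.
have E (t : R) x : vdot (w + t *: ev R j) x = vdot x w + t * x ord0 j.
  by rewrite vdotDl vdotZl !(vdotC _ x) vdot_ev.
have H := @is_derive_Rintegral _ _ _ mu
  (fun t x => f x * cos (vdot (w + t *: ev R j) x + th))
  (fun t x => x ord0 j * f x * cos (vdot (w + t *: ev R j) x + (th + pi / 2)))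
  (fun x => `|x ord0 j * f x|) _ _ _ _.
apply: (is_derive_eq (H _ _ _ _)).
- by move=> t; apply: L1_K; exact: rschwartz_L1.
- move=> t x.
  have H1 : is_derive t 1 (fun s => vdot (w + s *: ev R j) x + th) (x ord0 j).
    rewrite (_ : (fun s => _) = (fun s => (vdot x w + th) + s * x ord0 j)).
      exact: is_derive_affine1.
    by apply/funext => s; rewrite E addrAC.
  have H2 := @is_derive1_comp R cos (fun s => vdot (w + s *: ev R j) x + th) t _ _
     (is_derive_cos _) H1.
  have H3 := @is_deriveZ _ _ _ _ (f x) t 1 _ H2.
  apply: (is_derive_eq H3).
  by rewrite addrA cosDpihalf -[_ *: _]/(f x * _); ring.
- by apply: L1_norm; exact: rschwartz_L1.
- by move=> t x _; rewrite normrM ler_piMr// cos_norm_le1.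
- by rewrite /K; under eq_Rint do rewrite scale0r addr0.
Qed.

(** Integration by parts, with [Rint_partial0] discarding the boundary term. *)
Lemma K_mulcoord f th w j : rschwartz f ->
  w ord0 j * K f th w = K (partial j f) (th + pi / 2) w.
Proof.
move=> Sf; have Sdf := rschwartz_partial j Sf.
(* Lowering the phase by pi/2 makes the differentiated cosine return to phase th; the other term has
   phase th - pi/2, that is, minus the cosine of phase th + pi/2. *)
pose a := th - pi / 2.
have HD x : is_derive x (ev R j) (fun x => f x * cos (vdot w x + a))
   (partial j f x * cos (vdot w x + a) + w ord0 j * (f x * cos (vdot w x + th))).
  have := is_derive_mul (rschwartz_derive j x Sf) (is_derive_cos_vdot w x j a).
  move=> H; apply: (is_derive_eq H).
  by rewrite /a subrK; congr (_ + _); ring.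
have [M1 M10 H1] := rschwartz_rho Sf; have [M2 M20 H2] := rschwartz_rho Sdf.
have mf := rschwartz_measurable Sf; have mdf := rschwartz_measurable Sdf.
have mc b := measurable_cos_vdot w b.
have := @Rint_partial0 _ _ j (M1 + M2 + `|w ord0 j| * M1) _ _ HD.
have r0 x := ltW (rho_gt0 x).
move=> /(_ (measurable_funM mf (mc a))) H.
have {H} I0 : \int[mu]_x (partial j f x * cos (vdot w x + a) +
    w ord0 j * (f x * cos (vdot w x + th))) = 0.
  apply: H.
  - apply: measurable_funD; first exact: measurable_funM.
    by apply: measurable_funM => //; exact: measurable_funM.
  - move=> x; rewrite normrM; apply: (@le_trans _ _ (M1 * rho x)).
      by apply: le_trans (H1 x); rewrite ler_piMr// cos_norm_le1.
    by rewrite ler_wpM2r// -addrA lerDl addr_ge0// mulr_ge0.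
  - move=> x; rewrite (le_trans (ler_normD _ _))// mulrDl [leLHS]addrC [leRHS]addrC.
    apply: lerD.
      rewrite !normrM -mulrA ler_wpM2l//; apply: le_trans (H1 x).
      by rewrite ler_piMr// cos_norm_le1.
    rewrite normrM; apply: (@le_trans _ _ (M2 * rho x)).
      by apply: le_trans (H2 x); rewrite ler_piMr// cos_norm_le1.
    by rewrite ler_wpM2r// lerDr.
move: I0.
have L2 := L1_K a w (rschwartz_L1 Sdf).
have L3 := L1_K th w (rschwartz_L1 Sf).
rewrite RintD//; last exact: L1Z.
rewrite RintZ// -/(K f th w) => /eqP; rewrite addr_eq0 => /eqP.
move=> /(congr1 -%R); rewrite opprK => <-.
rewrite /K -mulN1r -RintZ//; apply: eq_Rint => x.
by rewrite /a !addrA cosDpihalf cosBpihalf; ring.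
Qed.

(** Differentiating K multiplies f by a coordinate, and multiplying K by a coordinate differentiates
    f, so the class of all [K f th] is stable. Monomial bounds follow by induction on the total
    degree. *)
Lemma rschwartz_K f th : rschwartz f -> rschwartz (K f th).
Proof.
move=> Sf; apply: (@rschwartz_class _ _
  (fun h => exists f th, rschwartz f /\ h = K f th)).
- move=> _ j [f1 [th1 [Sf1 ->]]].
  exists (K (fun x => x ord0 j * f1 x) (th1 + pi / 2)).
    exists (fun x => x ord0 j * f1 x), (th1 + pi / 2); split=> //.
    exact: rschwartz_mulcoord.
  by move=> w; exact: K_derive.
- move=> _ al [f1 [th1 [Sf1 ->]]].
  have key (N : nat) (be : 'I_n -> nat) f2 th2 : (\sum_j be j = N)%N -> rschwartz f2 ->
      exists M : R, forall w, `|monom be w * K f2 th2 w| <= M.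
    elim: N be f2 th2 => [|N IH] be f2 th2.
      move=> /eqP; rewrite sum_nat_eq0 => /forallP be0 Sf2.
      exists (\int[mu]_x `|f2 x|) => w.
      rewrite /monom big1 ?mul1r; last by move=> j _; rewrite (eqP (implyP (be0 j) isT)) expr0.
      by apply: K_bounded; exact: rschwartz_L1.
    move=> beN Sf2.
    have [j bj] : exists j, (0 < be j)%N.
      apply: contrapT => /forallNP bj; move: beN; rewrite big1// => j _.
      by have := bj j; case: (be j).
    pose ga i := (be i - (i == j))%N.
    have beE : be = fun i => (ga i + (i == j))%N.
      apply/funext => i; rewrite /ga; case: eqP => [->|_]; last by rewrite subn0 addn0.
      by rewrite subnK.
    have [|M HM] := IH ga (partial j f2) (th2 + pi / 2) _ (rschwartz_partial j Sf2).
      move: beN; rewrite beE big_split/= [X in (_ + X)%N](bigD1 j)//= eqxx.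
      rewrite [X in (true + X)%N]big1; last by move=> i /negbTE ->.
      by rewrite addn0 addn1 => -[].
    exists M => w; have := HM w; rewrite -K_mulcoord// beE monomS.
    by rewrite mulrCA mulrA.
  exact: (key _ _ _ _ erefl Sf1).
- by exists f, th.
Qed.

End fourier.

(** * The Gaussian and its transform *)

Section gaussian.
Variables (R : realType) (n : nat).
Local Notation V := 'rV[R]_n.
Implicit Types (f g : V -> R) (x w : V) (j : 'I_n) (th : R).
Local Notation mu := (vol R n).
Local Notation leb := (@lebesgue_measure R).

Definition gauss x : R := expR (- (vdot x x / 2)).

Lemma gauss_gt0 x : 0 < gauss x.
Proof. exact: expR_gt0. Qed.

Lemma is_derive_sqr_half x j :
  is_derive x (ev R j) (fun y => vdot y y / 2) (x ord0 j).
Proof.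
apply/is_derive_line0; rewrite (_ : (fun s => _) =
   ((fun s => vdot x x / 2 + s * x ord0 j) + (2^-1 *: (id * id : R -> R)))); last first.
  apply/funext => s; rewrite !vdotDl !vdotDr !vdotZl !vdotZr !(vdotC _ x) !vdot_ev.
  rewrite -[RHS]/(vdot x x / 2 + s * x ord0 j + 2^-1 * (s * s)) /ev mxE !eqxx mulr1.
  by field.
have H1 := is_derive_affine1 (vdot x x / 2) (x ord0 j) 0.
have H2 : is_derive (0 : R) 1 (2^-1 *: (id * id : R -> R)) (2^-1 *: (0 *: 1 + 0 *: 1)).
  have H3 : is_derive (0 : R) 1 (id * id : R -> R) (0 *: 1 + 0 *: 1) by exact: is_deriveM.
  exact: is_deriveZ.
have := is_deriveD H1 H2; move=> H; apply: (is_derive_eq H).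
by rewrite !scale0r addr0 scaler0 addr0.
Qed.

Lemma is_derive_gauss x j :
  is_derive x (ev R j) gauss (- (x ord0 j * gauss x)).
Proof.
have H1 : is_derive x (ev R j) (fun y => -1 * (vdot y y / 2)) (-1 * x ord0 j).
  by apply: is_derive_scal; exact: is_derive_sqr_half.
have := is_derive_comp1 (is_derive_expR _) H1.
rewrite (_ : (fun y => _) = gauss); last first.
  by apply/funext => y; rewrite /gauss mulN1r.
by move=> H; apply: (is_derive_eq H); rewrite /gauss mulN1r; ring.
Qed.

Lemma gauss_prod x : gauss x = \prod_(j < n) expR (- (x ord0 j ^+ 2 / 2)).
Proof.
rewrite /gauss /vdot mulr_suml -sumrN expR_sum.
by apply: eq_bigr => j _; rewrite expr2.
Qed.

(** For k > 0, exp u >= u at u = t^2/(2k), raised to the power k, gives t^(2k) <= (2k)^k exp(t^2/2).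
    This dominates |t|^k when |t| > 1; otherwise the bound 1 is enough. *)
Lemma expR_sqr_decay k : exists M : R, forall t : R,
  `|t ^+ k * expR (- (t ^+ 2 / 2))| <= M.
Proof.
have key (t : R) : (t ^+ 2) ^+ k <= (2 * k%:R) ^+ k * expR (t ^+ 2 / 2).
  case: k => [|k]; first by rewrite !expr0 mul1r -expR0 ler_expR divr_ge0// sqr_ge0.
  have -> : t ^+ 2 / 2 = k.+1%:R * (t ^+ 2 / (2 * k.+1%:R)).
    have : k.+1%:R != 0 :> R by rewrite pnatr_eq0.
    by move: (k.+1%:R) => N N0; field.
  rewrite expRM_natl -exprMn; apply: lerXn2r; rewrite ?nnegrE ?sqr_ge0//.
  rewrite mulrC -ler_pdivrMr; last by rewrite mulr_gt0.
  by apply: le_trans (expR_ge1Dx _); rewrite lerDr.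
exists (1 + (2 * k%:R) ^+ k) => t.
rewrite normrM (gtr0_norm (expR_gt0 _)) expRN ler_pdivrMr ?expR_gt0//.
rewrite mulrDl mul1r.
have e1 : 1 <= expR (t ^+ 2 / 2) by rewrite -expR0 ler_expR divr_ge0// sqr_ge0.
have [t1|t1] := lerP `|t| 1.
  rewrite normrX; apply: (@le_trans _ _ 1); first by rewrite exprn_ile1.
  by apply: (le_trans e1); rewrite lerDl mulr_ge0// ?expR_ge0// exprn_ge0.
apply: (@le_trans _ _ ((t ^+ 2) ^+ k)); last first.
  by apply: (le_trans (key t)); rewrite lerDr expR_ge0.
rewrite normrX -(real_normK (num_real t)); apply: lerXn2r; rewrite ?nnegrE ?sqr_ge0//.
by rewrite expr2 ler_peMl// ltW.
Qed.

Lemma gauss_monom al : exists M : R, forall x, `|monom al x * gauss x| <= M.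
Proof.
have /choice[M HM] j := expR_sqr_decay (al j).
exists (\prod_(j < n) M j) => x.
rewrite gauss_prod /monom -big_split normr_prod; apply: ler_prod => j _.
by rewrite normr_ge0 HM.
Qed.

(** The device of [coord_closure] again: a partial derivative of cosine times Gaussian produces a
    shifted phase and a coordinate factor. *)
Inductive gauss_class w : (V -> R) -> Prop :=
| gauss_class_base th : gauss_class w (fun x => cos (vdot w x + th) * gauss x)
| gauss_class_mul i f : gauss_class w f -> gauss_class w (fun x => x ord0 i * f x)
| gauss_class_lin a b f g : gauss_class w f -> gauss_class w g ->
    gauss_class w (fun x => a * f x + b * g x).

Lemma rschwartz_cos_gauss w th :
  rschwartz (fun x => cos (vdot w x + th) * gauss x).
Proof.
apply: (@rschwartz_class _ _ (gauss_class w)).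
- move=> h j; elim=> {h} [t|k h Ch [dh Cdh Hdh]|a b h1 h2 C1 [d1 Cd1 H1] C2 [d2 Cd2 H2]].
  + exists (fun x => w ord0 j * (cos (vdot w x + (t + pi / 2)) * gauss x) +
       -1 * (x ord0 j * (cos (vdot w x + t) * gauss x))).
      apply: gauss_class_lin; first exact: gauss_class_base.
      by apply: gauss_class_mul; exact: gauss_class_base.
    move=> x; have := is_derive_mul (is_derive_cos_vdot w x j t) (is_derive_gauss x j).
    by move=> H; apply: (is_derive_eq H); ring.
  + exists (fun x => (k == j)%:R * h x + 1 * (x ord0 k * dh x)).
      by apply: gauss_class_lin => //; exact: gauss_class_mul.
    move=> x; have := is_derive_mul (is_derive_coord x k j) (Hdh x).
    by rewrite mul1r.
  + exists (fun x => a * d1 x + b * d2 x); first exact: gauss_class_lin.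
    by move=> x; apply: is_derive_add; exact: is_derive_scal.
- move=> h al Ch; elim: Ch al => {h} [t|k h Ch IH|a b h1 h2 C1 IH1 C2 IH2] al.
  + have [M HM] := gauss_monom al; exists M => x.
    rewrite mulrCA normrM; apply: le_trans (HM x).
    by rewrite ler_piMl// cos_norm_le1.
  + have [M HM] := IH (fun j => al j + (j == k))%N; exists M => x.
    by have := HM x; rewrite monomS mulrCA mulrA.
  + have [M1 H1] := IH1 al; have [M2 H2] := IH2 al.
    exists (`|a| * M1 + `|b| * M2) => x.
    rewrite mulrDr (le_trans (ler_normD _ _))// !(mulrCA (monom al x)) !(normrM _ (monom al x * _)).
    by rewrite lerD// ler_wpM2l.
- exact: gauss_class_base.
Qed.

Lemma rschwartz_gauss : rschwartz gauss.
Proof.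
have := rschwartz_cos_gauss 0 0.
by under eq_fun do rewrite vdot0l addr0 cos0 mul1r.
Qed.

Lemma L1_gauss : L1 mu gauss.
Proof. exact: rschwartz_L1 rschwartz_gauss. Qed.

Definition gauss_mass : R := \int[mu]_x gauss x.

Lemma integral_gauss1 :
  (\int[leb]_t (expR (- (t ^+ 2 / 2)))%:E = (Num.sqrt (2 * pi))%:E)%E.
Proof.
have p0 : 0 < Num.sqrt (2 * pi) :> R by rewrite sqrtr_gt0 mulr_gt0// pi_gt0.
have H := @integral_normal_pdf R 0 1.
have H1 : (\int[leb]_t (expR (- (t ^+ 2 / 2)))%:E =
    (Num.sqrt (2 * pi))%:E * \int[leb]_x (normal_pdf 0 1 x)%:E)%E.
  rewrite -ge0_integralZl//.
  - apply: eq_integral => t _; rewrite -EFinM; congr EFin.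
    rewrite normal_pdfE ?oner_eq0// /normal_peak /normal_fun.
    rewrite subr0 expr1n mul1r -[pi *+ 2]mulr_natl mulrA divff ?lt0r_neq0// mul1r.
    by rewrite -mulNr.
  - by apply/measurable_EFinP; exact: measurable_normal_pdf.
  - by move=> t _; rewrite lee_fin normal_pdf_ge0.
by rewrite H1 H mule1.
Qed.

(** Only the square is needed: inversion meets the mass once through [K_gauss] and once as the
    integral of [gauss]. *)
Lemma gauss_massE : gauss_mass ^+ 2 = (2 * pi) ^+ n.
Proof.
have p0 : 0 <= 2 * pi :> R by rewrite mulr_ge0// pi_ge0.
have mg : measurable_fun setT (fun t : R => expR (- (t ^+ 2 / 2))).
  apply: measurableT_comp => //; apply: measurableT_comp => //.
  apply: measurable_funM => //; exact: measurable_funX.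
have := @integral_vol_prod R n _ _ mg (fun t => expR_ge0 _) integral_gauss1.
rewrite /gauss_mass /Rintegral => H.
under eq_integral do rewrite gauss_prod.
by rewrite H /= -exprM mulnC exprM sqr_sqrtr.
Qed.

(* [K gauss th] and [gauss] solve the same linear first order system. *)
Lemma K_gauss th w : K gauss th w = gauss_mass * cos th * gauss w.
Proof.
have SG := rschwartz_gauss.
pose E w := K gauss th w * (gauss w)^-1.
have gE x : (gauss x)^-1 = expR (vdot x x / 2) by rewrite /gauss expRN invrK.
have dgi x j : is_derive x (ev R j) (fun y => (gauss y)^-1) (x ord0 j * (gauss x)^-1).
  have := is_derive_comp1 (is_derive_expR _) (is_derive_sqr_half x j).
  rewrite (_ : (fun y => _) = (fun y => (gauss y)^-1)); last first.
    by apply/funext => y; rewrite gE.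
  by move=> H; apply: (is_derive_eq H); rewrite gE mulrC.
have dK x j : is_derive x (ev R j) (K gauss th) (- (x ord0 j * K gauss th x)).
  have := K_derive th x j SG.
  rewrite K_mulcoord// (is_derive_partial (fun x => is_derive_gauss x j)) => H.
  apply: (is_derive_eq H).
  rewrite /K -mulN1r -RintZ; last first.
    apply: L1_K; apply: rschwartz_L1.
    have := rschwartz_scal (-1) (rschwartz_mulcoord j SG).
    by under eq_fun do rewrite mulN1r.
  by apply: eq_Rint => y; ring.
have dE j x : is_derive x (ev R j) E 0.
  have := is_derive_mul (dK x j) (dgi x j).
  by move=> H; apply: (is_derive_eq H); ring.
have z0 (j : 'I_n) (x : V) : `|0 : R| <= 0 by rewrite normr0.
(* A Lipschitz constant 0 makes the quotient E constant, so it equals its value at the origin. *)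
have := @lipschitz_partial R n E (fun _ _ => 0) 0 dE z0 0 w.
rewrite mul0r normr_le0 subr_eq0 /E => /eqP H.
have g0 : gauss 0 = 1 by rewrite /gauss vdot0l mul0r oppr0 expR0.
rewrite -[LHS](divfK (lt0r_neq0 (gauss_gt0 w))) H g0 invr1 mulr1.
congr (_ * _); rewrite /K /gauss_mass.
under eq_Rint do rewrite vdot0l add0r mulrC.
exact: etrans (RintZ (cos th) L1_gauss) (mulrC _ _).
Qed.

End gaussian.

(** * Inversion of the cosine transform *)

Section inversion.
Variables (R : realType) (n : nat).
Local Notation V := 'rV[R]_n.
Implicit Types (f g : V -> R) (x w : V) (j : 'I_n) (th : R).
Local Notation mu := (vol R n).

(** Separates the phase from the transform, so that a phase depending on w can be handled with two
    fixed transforms. *)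
Lemma K_phase f th w : rschwartz f ->
  K f th w = cos th * K f 0 w + sin th * K f (pi / 2) w.
Proof.
move=> Sf; have Lf := rschwartz_L1 Sf.
rewrite /K -!RintZ; try exact: L1_K.
rewrite -RintD; try by apply: L1Z; exact: L1_K.
by apply: eq_Rint => x; rewrite addr0 cosDpihalf cosD; ring.
Qed.

Section fixed.
Variables (f : V -> R) (x : V).
Hypothesis Sf : rschwartz f.

(** Real part of e^{-i w . x} times the integral of f(z) e^{i w . z}; its integral over w is to be
    (2 pi)^n f(x). *)
Let H w : R := K f (- vdot w x) w.

Let HE w : H w = \int[mu]_z (f z * cos (vdot w (z - x))).
Proof. by apply: eq_Rint => z; rewrite vdotDr vdotNr. Qed.

Let mH : measurable_fun setT H.
Proof.
rewrite (_ : H = fun w => cos (- vdot w x) * K f 0 w + sin (- vdot w x) * K f (pi / 2) w).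
  have mv : measurable_fun setT (fun w : V => - vdot w x).
    apply: measurableT_comp => //; under eq_fun do rewrite vdotC.
    exact: measurable_vdot.
  apply: measurable_funD; apply: measurable_funM.
  - exact: measurable_cos_comp.
  - exact: rschwartz_measurable (rschwartz_K _ Sf).
  - by apply: measurableT_comp mv; apply: continuous_measurable_fun; exact: continuous_sin.
  - exact: rschwartz_measurable (rschwartz_K _ Sf).
by apply/funext => w; exact: K_phase.
Qed.

Let LH : L1 mu H.
Proof.
apply: (L1_le (g := fun w => `|K f 0 w| + `|K f (pi / 2) w|)) => //.
  move=> w; rewrite /H K_phase// (le_trans (ler_normD _ _))// !normrM.
  by rewrite lerD// ler_piMl// ?cos_norm_le1 ?sin_norm_le1.
by apply: L1D; apply: L1_norm; apply: rschwartz_L1; exact: rschwartz_K.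
Qed.

(** Gaussian regularization: averaging f around x at scale c corresponds to damping H by
    [gauss (c *: w)], because the Gaussian is its own transform. *)
Let approx (c : R) : 0 < c ->
  \int[mu]_y (gauss_mass R n * (f (x + c *: y) * gauss y)) =
  \int[mu]_w (gauss (c *: w) * H w).
Proof.
move=> c0; have cn0 := lt0r_neq0 c0.
have Lf := rschwartz_L1 Sf.
have Lfc := (L1_affine x cn0 Lf).1.
have mh : measurable_fun setT (fun p : V * V => cos (vdot p.1 p.2 + 0)).
  by apply: measurable_cos_comp; apply: measurable_funD => //; exact: measurable_vdot2.
have LP := @L1_prod _ _ _ _ _ mu mu _ _ _ 1 Lfc (@L1_gauss R n) mh
  (fun p => cos_norm_le1 _).
(* [K_gauss] rewrites the mass times [gauss y] as an integral in w, after which the integrals are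
   exchanged. *)
transitivity (\int[mu]_y \int[mu]_w (f (x + c *: y) * gauss w * cos (vdot y w + 0))).
  apply: eq_Rint => y.
  transitivity (f (x + c *: y) * K (@gauss R n) 0 y).
    by rewrite K_gauss cos0; ring.
  rewrite /K -RintZ; last exact: L1_K (@L1_gauss R n).
  by apply: eq_Rint => w; rewrite mulrA.
rewrite (Rint_swap LP) /=.
pose Phi w : R := gauss (c *: w) * H w.
have LPhi : L1 mu Phi.
  have := @L1M_bounded _ _ _ mu H (fun w => gauss (c *: w)) 1 LH.
  rewrite /Phi; under [in X in _ -> X]eq_fun do rewrite mulrC; apply.
    apply: rschwartz_measurable; apply: rschwartz_dilate => //; exact: rschwartz_gauss.
  move=> w; rewrite gtr0_norm ?gauss_gt0// -expR0 ler_expR oppr_le0.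
  by apply: divr_ge0 => //; apply: sumr_ge0 => j _; rewrite -expr2 sqr_ge0.
have ci0 : c^-1 != 0 by rewrite invr_eq0.
have [LPc] := L1_affine 0 ci0 LPhi.
rewrite -/(Phi _) (gtr0_norm (_ : 0 < c^-1)) ?invr_gt0// invrK => EP.
(* The factor c^-n of this substitution in w is consumed by the substitution z = x + c y inside
   H. *)
transitivity (\int[mu]_w (c^-1 ^+ n * Phi (0 + c^-1 *: w))); last first.
  by rewrite (RintZ _ LPc) EP mulrA -exprMn (mulVf cn0) expr1n mul1r.
apply: eq_Rint => w; rewrite /Phi add0r scalerA divff// scale1r.
pose phi (z : V) : R := f z * cos (vdot (c^-1 *: w) (z - x)).
have Lphi : L1 mu phi.
  have := L1_K (- vdot (c^-1 *: w) x) (c^-1 *: w) Lf.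
  by rewrite /phi; under [in X in _ -> X]eq_fun do rewrite vdotDr vdotNr.
have [Lphc Ephi] := L1_affine x cn0 Lphi.
rewrite (gtr0_norm c0) in Ephi.
rewrite HE mulrCA -Ephi -RintZ//; apply: eq_Rint => y.
have E : x + c *: y - x = c *: y by rewrite addrAC subrr add0r.
have E2 : vdot (c^-1 *: w) (c *: y) = vdot y w.
  by rewrite vdotZl vdotZr (vdotC w); field.
by rewrite /phi E E2 addr0; ring.
Qed.

(** Let c = 1/(m+1) tend to 0 in [approx]: by dominated convergence the left side tends to the
    squared mass times f(x), the right side to the integral of H. *)
Lemma Rint_phase_transform :
  \int[mu]_w K f (- vdot w x) w = (2 * pi) ^+ n * f x.
Proof.
have hc (y : V) : (harmonic m : R) *: y @[m --> \oo] --> (0 : V).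
  apply: cvg_rVP => j; rewrite mxE; under eq_fun do rewrite mxE.
  have H0 : (harmonic m : R) * y ord0 j @[m --> \oo] --> 0 * y ord0 j.
    by apply: cvgM; [exact: cvg_harmonic|exact: cvg_cst].
  by rewrite mul0r in H0.
have h0 m : 0 < harmonic m :> R by rewrite invr_gt0.
have mG := rschwartz_measurable (@rschwartz_gauss R n).
have [M HM] := rschwartz_bounded Sf.
have LG := @L1_gauss R n.
have C1 : \int[mu]_y (gauss_mass R n * (f (x + harmonic m *: y) * gauss y))
    @[m --> \oo] --> \int[mu]_y (gauss_mass R n * (f x * gauss y)).
  apply: (@dct _ _ _ mu
    (fun m y => gauss_mass R n * (f (x + harmonic m *: y) * gauss y)) _
    (fun y => `|gauss_mass R n| * (M * gauss y)) _ _ _ _).2.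
  - move=> m; apply: measurable_funM => //; apply: measurable_funM => //.
    apply: L1_measurable; apply: (L1_affine x _ (rschwartz_L1 Sf)).1.
    by rewrite lt0r_neq0.
  - by apply: L1Z; apply: L1Z.
  - move=> m y; rewrite normrM ler_wpM2l// normrM (gtr0_norm (gauss_gt0 y)).
    by rewrite ler_wpM2r// ltW// gauss_gt0.
  - move=> y; apply: cvgM; first exact: cvg_cst.
    apply: cvgM; last exact: cvg_cst.
    apply: continuous_cvg; first exact: rschwartz_continuous.
    rewrite -[X in _ --> X]addr0; apply: cvgD; [exact: cvg_cst|exact: hc].
have C2 : \int[mu]_w (gauss (harmonic m *: w) * H w) @[m --> \oo] --> \int[mu]_w H w.
  apply: (@dct _ _ _ mu (fun m w => gauss (harmonic m *: w) * H w) H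
    (fun w => `|H w|) _ _ _ _).2.
  - move=> m; apply: measurable_funM => //.
    apply: rschwartz_measurable; apply: rschwartz_dilate; last exact: rschwartz_gauss.
    by rewrite lt0r_neq0.
  - exact: L1_norm.
  - move=> m w; rewrite normrM ler_piMl// gtr0_norm ?gauss_gt0//.
    rewrite -expR0 ler_expR oppr_le0.
    by apply: divr_ge0 => //; apply: sumr_ge0 => j _; rewrite -expr2 sqr_ge0.
  - move=> w; rewrite -[X in _ --> X]mul1r; apply: cvgM; last exact: cvg_cst.
    have g0 : gauss (0 : V) = 1 by rewrite /gauss vdot0l mul0r oppr0 expR0.
    rewrite -g0; apply: continuous_cvg; last exact: hc.
    exact: rschwartz_continuous (@rschwartz_gauss R n) _.
have E1 := cvg_lim (@Rhausdorff R) C1; have E2 := cvg_lim (@Rhausdorff R) C2.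
rewrite -/(H _) -E2.
under eq_fun do rewrite -approx//.
rewrite E1.
rewrite RintZ; last exact: L1Z.
by rewrite (RintZ _ LG) -/(gauss_mass R n) mulrCA -expr2 gauss_massE mulrC.
Qed.

End fixed.

(** Adding [Rint_phase_transform] at x and at -x cancels the sine terms and doubles the cosine term;
    only the even part of f survives. *)
Lemma K_inversion f x : rschwartz f ->
  K (K f 0) 0 x = (2 * pi) ^+ n / 2 * (f x + f (- x)).
Proof.
move=> Sf.
have E y : \int[mu]_w K f (- vdot w y) w =
    \int[mu]_w (cos (vdot w y) * K f 0 w) - \int[mu]_w (sin (vdot w y) * K f (pi / 2) w).
  rewrite -RintB; last 2 first.
  - have := L1_K 0 y (rschwartz_L1 (rschwartz_K 0 Sf)).
    by apply: L1_ext => w; rewrite addr0 mulrC vdotC.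
  - have := L1_K (- (pi / 2)) y (rschwartz_L1 (rschwartz_K (pi / 2) Sf)).
    by apply: L1_ext => w; rewrite cosBpihalf mulrC vdotC.
  by apply: eq_Rint => w; rewrite K_phase// cosN sinN mulNr.
have := Rint_phase_transform x Sf; have := Rint_phase_transform (- x) Sf.
rewrite !E.
under eq_Rint do rewrite vdotNr cosN.
under [X in _ - X = _ -> _]eq_Rint do rewrite vdotNr sinN mulNr.
have -> : \int[mu]_w (- (sin (vdot w x) * K f (pi / 2) w)) =
   - \int[mu]_w (sin (vdot w x) * K f (pi / 2) w).
  rewrite -mulN1r -RintZ; first by apply: eq_Rint => w; rewrite mulN1r.
  have := L1_K (- (pi / 2)) x (rschwartz_L1 (rschwartz_K (pi / 2) Sf)).
  by apply: L1_ext => w; rewrite cosBpihalf mulrC vdotC.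
have -> : K (K f 0) 0 x = \int[mu]_w (cos (vdot w x) * K f 0 w).
  by apply: eq_Rint => w; rewrite addr0 mulrC vdotC.
move: (\int[mu]_w (cos _ * _)) (\int[mu]_w (sin _ * _)) => A B H1 H2.
rewrite mulrDr -!mulrA !(mulrCA _ 2^-1) -H1 -H2; by field.
Qed.
End inversion.

(** * Injectivity of the Fourier transform of integrable functions *)

Section sign_approximation.
Variable R : realType.
Implicit Types s t : R.

(* Newton's iteration for the sign function. *)
Fixpoint sgn_iter (k : nat) s : R :=
  if k is k'.+1 then (3 * sgn_iter k' s - sgn_iter k' s ^+ 3) / 2 else s.

Lemma sgn_iterN k s : sgn_iter k (- s) = - sgn_iter k s.
Proof. by elim: k => //= k ->; field. Qed.

Lemma sgn_iter_pos k s : 0 < s -> s <= 1 ->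
  s <= sgn_iter k s <= 1 /\ 1 - sgn_iter k s <= (1 - s / 2) ^+ k.
Proof.
move=> s0 s1; elim: k => [|k [/andP[H1 H2] H3]].
  by rewrite /= lexx s1 expr0; split => //; lra.
rewrite exprS /=; move: (sgn_iter k s) H1 H2 H3 => q H1 H2 H3.
(* One step multiplies the error 1 - q by 1 - q/2 - q^2/2, at most 1 - s/2 because q >= s;
   convergence is geometric. *)
have E : 1 - (3 * q - q ^+ 3) / 2 = (1 - q) * ((2 - q - q ^+ 2) / 2).
  by rewrite !exprS expr0; field.
have q1 : 0 <= 1 - q by rewrite subr_ge0.
have F1 : (2 - q - q ^+ 2) / 2 <= 1 - s / 2.
  by have := sqr_ge0 q; lra.
split.
  rewrite -[_ <= 1]subr_ge0 E; apply/andP; split; last first.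
    by apply: mulr_ge0 => //; rewrite expr2; nra.
  apply: (le_trans H1); rewrite -subr_ge0.
  have -> : (3 * q - q ^+ 3) / 2 - q = q * (1 - q) * (1 + q) / 2.
    by rewrite !exprS expr0; field.
  by rewrite !mulr_ge0// ?invr_ge0//; lra.
rewrite E; apply: (@le_trans _ _ ((1 - q) * (1 - s / 2))).
  exact: ler_wpM2l.
by rewrite mulrC; apply: ler_wpM2l => //; lra.
Qed.

Lemma sgn_iter_le1 k s : `|s| <= 1 -> `|sgn_iter k s| <= 1.
Proof.
move=> s1; have key t : 0 < t -> `|t| <= 1 -> `|sgn_iter k t| <= 1.
  move=> t0; rewrite gtr0_norm// => t1; have [/andP[H1 H2] _] := sgn_iter_pos k t0 t1.
  by rewrite gtr0_norm//; exact: lt_le_trans H1.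
have [s0|s0|->] := ltgtP s 0.
- by rewrite -[s]opprK sgn_iterN normrN; apply: key; rewrite ?oppr_gt0// normrN.
- exact: key.
- have -> : sgn_iter k 0 = 0.
    by have := sgn_iterN k 0; rewrite oppr0; lra.
  by rewrite normr0.
Qed.

Lemma cvg_sgn_iter s : `|s| <= 1 -> sgn_iter k s @[k --> \oo] --> Num.sg s.
Proof.
have key t : 0 < t -> t <= 1 -> sgn_iter k t @[k --> \oo] --> (1 : R).
  move=> t0 t1.
  have H : (1 - (1 - t / 2) ^+ k) @[k --> \oo] --> (1 - 0 : R).
    apply: cvgB; first exact: cvg_cst.
    by apply: cvg_expr; rewrite ltr_norml; apply/andP; split; lra.
  rewrite subr0 in H.
  have : \forall k \near \oo, 1 - (1 - t / 2) ^+ k <= sgn_iter k t <= cst 1 k.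
    apply: nearW => k; have [/andP[_ H2] H3] := sgn_iter_pos k t0 t1.
    by rewrite H2 andbT; lra.
  by move/squeeze_cvgr; apply => //; exact: cvg_cst.
move=> s1; have [s0|s0|->] := ltgtP s 0.
- rewrite ltr0_sg//.
  rewrite (_ : (fun k => _) = (fun k => - sgn_iter k (- s))); last first.
    by apply/funext => k; rewrite sgn_iterN opprK.
  apply: cvgN; apply: key; first by rewrite oppr_gt0.
  by rewrite -ltr0_norm.
- by rewrite gtr0_sg//; apply: key => //; rewrite -(gtr0_norm s0).
- rewrite sgr0; rewrite (_ : (fun k => _) = cst 0); first exact: cvg_cst.
  by apply/funext => k; have := sgn_iterN k 0; rewrite oppr0 /=; lra.
Qed.

End sign_approximation.

(** * Multipliers preserving orthogonality to cosines *)

Section annihilator.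
Context d (Y : measurableType d) (R : realType).
Variables (m : {measure set Y -> \bar R}) (N : Y -> R) (L : (Y -> R) -> Prop).
Hypotheses (LN : L1 m N) (mL : forall l, L l -> measurable_fun setT l)
  (L0 : L (fun=> 0))
  (LD : forall l l', L l -> L l' -> L (fun y => l y + l' y))
  (LB : forall l l', L l -> L l' -> L (fun y => l y - l' y))
  (LI : forall l, L l -> \int[m]_y (N y * cos (l y)) = 0).
Implicit Types g q u : Y -> R.

Lemma annihilates_lim_bound (a C t b : R) : `|a| <= C ->
  `|b * a * cos t| <= C * `|b|.
Proof.
move=> aC; rewrite !normrM -[leRHS]mulr1 mulrC [leRHS]mulrC; apply: ler_pM => //.
  exact: cos_norm_le1.
by rewrite mulrC ler_wpM2r.
Qed.

Definition annihilates g : Prop := [/\ measurable_fun setT g,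
  (exists C : R, forall y, `|g y| <= C) &
  forall l, L l -> \int[m]_y (N y * g y * cos (l y)) = 0].

(** Unlike annihilating functions, multipliers are visibly closed under products, so they form an
    algebra closed under bounded pointwise limits. *)
Definition multiplier q : Prop := [/\ measurable_fun setT q,
  (exists C : R, forall y, `|q y| <= C) &
  forall g, annihilates g -> annihilates (fun y => g y * q y)].

Lemma annihilates_L1 g l : annihilates g -> L l ->
  L1 m (fun y => N y * g y * cos (l y)).
Proof.
move=> [mg [C HC] _] Ll.
apply: (@L1M_bounded _ _ _ _ _ _ 1) => [||y]; last exact: cos_norm_le1.
  exact: L1M_bounded HC.
by apply: measurable_cos_comp; exact: mL.
Qed.

Lemma annihilates1 : annihilates (fun=> 1).
Proof.
split=> //; first by exists 1 => y; rewrite normr1.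
by move=> l Ll; under eq_Rint do rewrite mulr1; exact: LI.
Qed.

Lemma annihilates_lin g g' (a b : R) : annihilates g -> annihilates g' ->
  annihilates (fun y => a * g y + b * g' y).
Proof.
move=> Ag Ag'; have [mg [C HC] Ig] := Ag; have [mg' [C' HC'] Ig'] := Ag'.
split.
- by apply: measurable_funD; apply: measurable_funM.
- exists (`|a| * C + `|b| * C') => y.
  by rewrite (le_trans (ler_normD _ _))// !normrM lerD// ler_wpM2l.
- move=> l Ll.
  have := RintD (L1Z a (annihilates_L1 Ag Ll)) (L1Z b (annihilates_L1 Ag' Ll)).
  rewrite !RintZ; try exact: annihilates_L1.
  rewrite Ig// Ig'// !mulr0 addr0 => <-.
  by apply: eq_Rint => y; ring.
Qed.

Lemma annihilates_lim (gk : nat -> Y -> R) g (C : R) :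
  (forall k, annihilates (gk k)) -> (forall k y, `|gk k y| <= C) ->
  (forall y, gk k y @[k --> \oo] --> g y) -> annihilates g.
Proof.
move=> Ag HC cg.
have mg : measurable_fun setT g.
  apply: (@measurable_fun_cvg _ _ _ _ gk) => [k|y _]; last exact: cg.
  by have [] := Ag k.
split => //.
  exists C => y; have H : `|gk k y| @[k --> \oo] --> `|g y| by exact: cvg_norm (cg y).
  rewrite -(cvg_lim (@Rhausdorff R) H); apply: limr_le; first exact: (cvgP _ H).
  by apply: nearW => k; exact: HC.
move=> l Ll.
have mN := L1_measurable LN.
have mcl : measurable_fun setT (fun y => cos (l y)).
  by apply: measurable_cos_comp; exact: mL.
have [_ H] := @dct _ _ _ m (fun k y => N y * gk k y * cos (l y))
  (fun y => N y * g y * cos (l y)) (fun y => C * `|N y|)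
  (fun k => L1_measurable (annihilates_L1 (Ag k) Ll)) (L1Z C (L1_norm LN))
  (fun k y => annihilates_lim_bound (l y) (N y) (HC k y))
  (fun y => cvgM (cvgM (cvg_cst (N y)) (cg y)) (cvg_cst (cos (l y)))).
rewrite -(cvg_lim (@Rhausdorff R) H).
rewrite (_ : (fun k => _) = cst 0); first exact: lim_cst.
by apply/funext => k; have [_ _ ->] := Ag k.
Qed.

(** The product formula turns cos l cos l' into cosines of l + l' and l - l', both phases in L. *)
Lemma multiplier_cos l : L l -> multiplier (fun y => cos (l y)).
Proof.
move=> Ll; split.
- by apply: measurable_cos_comp; exact: mL.
- by exists 1 => y; exact: cos_norm_le1.
- move=> g Ag; have [mg [C HC] Ig] := Ag; split.
  + apply: measurable_funM => //; apply: measurable_cos_comp; exact: mL.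
  + exists C => y; rewrite normrM; apply: le_trans (HC y).
    by rewrite ler_piMr// cos_norm_le1.
  + move=> l' Ll'.
    have H1 := annihilates_L1 Ag (LD Ll Ll').
    have H2 := annihilates_L1 Ag (LB Ll Ll').
    transitivity (2^-1 * \int[m]_y (N y * g y * cos (l y + l' y) + N y * g y * cos (l y - l' y))).
      rewrite -RintZ; last exact: L1D.
      by apply: eq_Rint => y; rewrite cosD cosB; field.
    by rewrite RintD// Ig ?Ig ?addr0 ?mulr0//; [exact: LB|exact: LD].
Qed.

Lemma multiplier1 : multiplier (fun=> 1).
Proof.
split=> //; first by exists 1 => y; rewrite normr1.
by move=> g; under eq_fun do rewrite mulr1.
Qed.

Lemma multiplier_lin q q' (a b : R) : multiplier q -> multiplier q' ->
  multiplier (fun y => a * q y + b * q' y).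
Proof.
move=> [mq [C HC] Iq] [mq' [C' HC'] Iq']; split.
- by apply: measurable_funD; apply: measurable_funM.
- exists (`|a| * C + `|b| * C') => y.
  by rewrite (le_trans (ler_normD _ _))// !normrM lerD// ler_wpM2l.
- move=> g Ag; have := annihilates_lin a b (Iq _ Ag) (Iq' _ Ag).
  congr annihilates; apply/funext => y; ring.
Qed.

Lemma multiplier_mul q q' : multiplier q -> multiplier q' ->
  multiplier (fun y => q y * q' y).
Proof.
move=> [mq [C HC] Iq] [mq' [C' HC'] Iq']; split.
- exact: measurable_funM.
- exists (C * C') => y; rewrite normrM; exact: ler_pM.
- move=> g Ag; have := Iq' _ (Iq _ Ag).
  by congr annihilates; apply/funext => y; rewrite mulrA.
Qed.

Lemma multiplier_lim (qk : nat -> Y -> R) q (C : R) :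
  (forall k, multiplier (qk k)) -> (forall k y, `|qk k y| <= C) ->
  (forall y, qk k y @[k --> \oo] --> q y) -> multiplier q.
Proof.
move=> Mq HC cq.
have key g : annihilates g -> annihilates (fun y => g y * q y).
  move=> Ag; have [_ [Cg HCg] _] := Ag.
  apply: (@annihilates_lim (fun k y => g y * qk k y) _ (Cg * C)).
  - by move=> k; have [_ _ /(_ _ Ag)] := Mq k.
  - by move=> k y; rewrite normrM ler_pM.
  - by move=> y; apply: cvgM; [exact: cvg_cst|exact: cq].
(* Testing on g = 1 also delivers measurability and a bound for the limit q. *)
have E : (fun y => 1 * q y) = q by apply/funext => y; rewrite mul1r.
have := key _ annihilates1; rewrite E => -[mq bq _].
by split.
Qed.

Lemma multiplier_sgn_cos l : L l -> multiplier (fun y => Num.sg (cos (l y))).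
Proof.
move=> Ll; apply: (@multiplier_lim (fun k y => sgn_iter k (cos (l y))) _ 1).
- elim=> [|k IH]; first exact: multiplier_cos.
  have := multiplier_lin (3 / 2) (- 2^-1) IH (multiplier_mul IH (multiplier_mul IH IH)).
  by congr multiplier; apply/funext => y /=; field.
- by move=> k y; apply: sgn_iter_le1; exact: cos_norm_le1.
- by move=> y; apply: cvg_sgn_iter; exact: cos_norm_le1.
Qed.

Variable u : Y -> R.
Hypothesis Lu : forall a b : R, L (fun y => a * u y + b).

Lemma sg_sin_small (t : R) : `|t| < pi -> Num.sg (sin t) = Num.sg t.
Proof.
move=> tpi; have [t0|t0|->] := ltgtP t 0; last by rewrite sin0.
- rewrite !ltr0_sg// -[t]opprK sinN oppr_lt0; apply: sin_gt0_pi.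
  by rewrite oppr_gt0 t0/= -ltr0_norm.
- rewrite !gtr0_sg//; apply: sin_gt0_pi.
  by rewrite t0/= -(gtr0_norm t0).
Qed.

(** Slow oscillation: once (u - a)/(k+1) lies in (-pi, pi), its sine has the sign of u - a, so the
    approximations are eventually constant at each point. *)
Lemma multiplier_sg (a : R) : multiplier (fun y => Num.sg (u y - a)).
Proof.
apply: (@multiplier_lim (fun k y => Num.sg (sin (harmonic k * (u y - a)))) _ 1).
- move=> k; have := multiplier_sgn_cos (Lu (harmonic k) (- (harmonic k * a) - pi / 2)).
  congr multiplier; apply/funext => y; congr (Num.sg _).
  by rewrite addrA cosBpihalf mulrBr.
- by move=> k y; rewrite normr_sg; case: (_ != 0).
- move=> y; apply: cvg_near_cst.
  have H : harmonic k * (u y - a) @[k --> \oo] --> (0 : R).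
    rewrite -[X in _ --> X](mul0r (u y - a)); apply: cvgM; last exact: cvg_cst.
    exact: cvg_harmonic.
  have /cvgrPdist_lt/(_ _ (pi_gt0 R)) := H.
  apply: filterS => k; rewrite sub0r normrN => hk.
  by rewrite sg_sin_small// sgrM gtr0_sg ?mul1r// invr_gt0.
Qed.

(** Moving the threshold to a + 1/(k+1) gives the value 0 rather than 1/2 where u = a, hence the
    strict half-line in the limit. *)
Lemma multiplier_itv (a : R) : multiplier (\1_(u @^-1` `]a, +oo[)).
Proof.
apply: (@multiplier_lim
  (fun k y => 2^-1 * 1 + 2^-1 * Num.sg (u y - (a + harmonic k))) _ 1).
- by move=> k; apply: multiplier_lin; [exact: multiplier1|exact: multiplier_sg].
- move=> k y; rewrite -mulrDr normrM ger0_norm ?invr_ge0//.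
  rewrite mulrC ler_pdivrMr// mul1r (le_trans (ler_normD _ _))// normr1.
  by rewrite -[2]/(1 + 1) lerD2l normr_sg; case: (_ != 0).
- move=> y; apply: cvg_near_cst.
  rewrite indicE.
  have -> : (y \in u @^-1` `]a, +oo[%classic) = (a < u y).
    by apply/idP/idP; rewrite inE /= in_itv/= andbT.
  have [ua|ua] := ltP a (u y).
    have d0 : 0 < u y - a by rewrite subr_gt0.
    have /cvgrPdist_lt/(_ _ d0) := @cvg_harmonic R.
    apply: filterS => k; rewrite sub0r normrN gtr0_norm ?invr_gt0// => hk.
    rewrite gtr0_sg; last by rewrite opprD addrA subr_gt0.
    by rewrite !mulr1 -[true%:R]/(1 : R); field.
  apply: nearW => k; rewrite ltr0_sg; first by rewrite mulr1 mulrN1 subrr.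
  rewrite subr_lt0; apply: (le_lt_trans ua); rewrite ltrDl invr_gt0//.
Qed.

End annihilator.

Section uniqueness.
Context d (Y : measurableType d) (R : realType).
Variables (m : {measure set Y -> \bar R}) (N : Y -> R) (L : (Y -> R) -> Prop).
Hypotheses (LN : L1 m N) (mL : forall l, L l -> measurable_fun setT l)
  (L0 : L (fun=> 0))
  (LD : forall l l', L l -> L l' -> L (fun y => l y + l' y))
  (LB : forall l l', L l -> L l' -> L (fun y => l y - l' y))
  (LI : forall l, L l -> \int[m]_y (N y * cos (l y)) = 0).

Let S : set (set Y) := [set A | multiplier m N L (\1_A : Y -> R)].

(** Complements come from 1 - q and finite intersections from products; a countable union is the
    complement of the limit of the decreasing sets B k avoiding the first k members. *)
Lemma multiplier_sigma_algebra : sigma_algebra setT S.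
Proof.
have SC A : S A -> S (~` A).
  rewrite /S /= => SA; have := multiplier_lin LN mL 1 (-1) (multiplier1 _ _ _) SA.
  congr multiplier; apply/funext => y; rewrite !indicE in_setC.
  by case: (y \in A) => /=; lra.
have ST : S setT.
  rewrite /S/= (_ : \1_setT = fun=> 1); first exact: multiplier1.
  by apply/funext => y; rewrite indicE in_setT.
have SI A B : S A -> S B -> S (A `&` B).
  rewrite /S /= => SA SB; have := multiplier_mul SA SB.
  by congr multiplier; apply/funext => y; rewrite !indicE in_setI -natrM mulnb.
split.
- by rewrite -setCT; exact: SC.
- by move=> A SA; rewrite setTD; exact: SC.
- move=> A SA.
  rewrite -[\bigcup_k _]setCK setC_bigcup; apply: (SC _).
  pose B (k : nat) : set Y := [set y | forall i, (i < k)%N -> ~ A i y].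
  have SB k : S (B k).
    elim: k => [|k IH]; first by rewrite (_ : B 0%N = setT)//; apply/seteqP; split.
    rewrite (_ : B k.+1 = B k `&` ~` A k); first by apply: SI => //; exact: SC.
    apply/seteqP; split => y /=.
      by move=> H; split; [move=> i ik; apply: H; exact: ltnW|exact: H].
    by move=> [H1 H2] i; rewrite ltnS leq_eqVlt => /orP[/eqP -> //|]; exact: H1.
  apply: (multiplier_lim LN mL LI (qk := fun k => \1_(B k)) (C := 1)) => //.
    by move=> k y; rewrite indicE; case: (_ \in _); rewrite ?normr1 ?normr0.
  move=> y; apply: cvg_near_cst.
  have [H|H] := pselect ((\bigcap_i ~` A i) y).
    apply: nearW => k; rewrite !indicE !mem_set//.
    by move=> i _; exact: H.
  have [i Hi] : exists i, A i y.
    by apply: contrapT => /forallNP H'; apply: H => i _; exact: H'.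
  exists i.+1 => // k /= ik; rewrite !indicE !memNset//.
  by move=> /(_ i ik).
Qed.

Lemma multiplier_preimage d' (Z : measurableType d') (G : set (set Z)) (u : Y -> Z) :
  @measurable _ Z = <<s G >> -> (forall B, G B -> S (u @^-1` B)) ->
  forall B, measurable B -> S (u @^-1` B).
Proof.
move=> -> SG; have [S0 SC SU] := multiplier_sigma_algebra.
apply: smallest_sub => //; split => /=.
- by rewrite preimage_set0.
- by move=> A SA; have := SC _ SA; rewrite !setTD.
- by move=> A SA; rewrite preimage_bigcup; exact: SU.
Qed.

(** The indicator of A applied to g = 1 and tested on the zero phase says that N integrates to 0
    over A. *)
Lemma annihilated_ae0 : (forall A, measurable A -> S A) ->
  ae_eq m setT (EFin \o N) (cst 0%E).
Proof.
move=> SA; apply: integral_ae_eq => // E _ mE.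
rewrite integral_cst// mul0e.
have [_ _ /(_ _ (annihilates1 LI))] := SA _ mE.
move=> [_ _ /(_ _ L0)].
have LE : L1 m (fun y => N y * \1_E y).
  apply: (@L1M_bounded _ _ _ _ _ _ 1) => //.
  by move=> y; rewrite indicE; case: (_ \in _); rewrite ?normr1 ?normr0.
move=> H; rewrite integral_mkcond.
have -> : ((EFin \o N) \_ E = fun y => (N y * \1_E y)%:E)%E.
  apply/funext => y; rewrite /patch indicE.
  by case: (_ \in _); rewrite ?mulr1 ?mulr0.
rewrite Rint_EFin//; congr EFin; rewrite -[RHS]H.
by apply: eq_Rint => y; rewrite cos0 mulr1 mul1r.
Qed.

End uniqueness.

(** * Orthogonality to all affine phases on R^d x R *)

Section joint_uniqueness.
Variables (R : realType) (n : nat).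
Local Notation V := 'rV[R]_n.
Local Notation leb := (@lebesgue_measure R).
Local Notation mu := (vol R n).

Definition phase (l : V * R -> R) : Prop :=
  exists w r th, l = fun p => vdot w p.1 + r * p.2 + th.

Lemma measurable_phase l : phase l -> measurable_fun setT l.
Proof.
move=> [w [r [th ->]]]; apply: measurable_funD => //; apply: measurable_funD.
  exact: measurableT_comp (measurable_vdot w) measurable_fst.
by apply: measurable_funM => //; exact: measurable_snd.
Qed.

Lemma ae0_of_phases (N : V * R -> R) : L1 (mu \x leb)%E N ->
  (forall l, phase l -> \int[(mu \x leb)%E]_p (N p * cos (l p)) = 0) ->
  ae_eq (mu \x leb)%E setT (EFin \o N) (cst 0%E).
Proof.
move=> LN HN.
have P0 : phase (fun=> 0).
  by exists 0, 0, 0; apply/funext => p; rewrite vdot0l mul0r !addr0.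
have PD l l' : phase l -> phase l' -> phase (fun y => l y + l' y).
  move=> [w [r [t ->]]] [w' [r' [t' ->]]]; exists (w + w'), (r + r'), (t + t').
  by apply/funext => p; rewrite vdotDl; ring.
have PB l l' : phase l -> phase l' -> phase (fun y => l y - l' y).
  move=> [w [r [t ->]]] [w' [r' [t' ->]]]; exists (w - w'), (r - r'), (t - t').
  by apply/funext => p; rewrite vdotDl vdotNl; ring.
have mr (u : V * R -> R) :
    (forall a b : R, phase (fun y => a * u y + b)) ->
    forall B, measurable B -> multiplier (mu \x leb)%E N phase (\1_(u @^-1` B)).
  move=> Pu; apply: (multiplier_preimage LN measurable_phase HN
    (RGenOInfty.measurableE R)).
  move=> _ [a ->]; exact: (multiplier_itv LN measurable_phase PD PB HN Pu a).
apply: (annihilated_ae0 LN P0 HN) => A mA.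
have [S0 SC SU] := multiplier_sigma_algebra LN measurable_phase HN.
(* The product sigma-algebra is generated by the preimages under the two projections; those under
   [fst] reduce further to single coordinates. *)
move: A mA; apply: smallest_sub => // A [] [B mB <-]; rewrite setTI.
  move: B mB; apply: (@multiplier_preimage _ _ _ _ _ _ LN measurable_phase HN _ 'rV[R]_n (@cylinders R n) fst erefl).
  move=> _ [j [B [mB ->]]].
  apply: (mr (fun p => p.1 ord0 j)) => // a b.
  exists (a *: ev R j), 0, b; apply/funext => p.
  by rewrite vdotZl vdotC vdot_ev mul0r addr0.
apply: (mr snd) => // a b.
by exists 0, a, b; apply/funext => p; rewrite vdot0l add0r.
Qed.

End joint_uniqueness.

(** Tonelli for |f|: the integrals of the sections of |f| have integral 0, hence vanish for almost
    every x. *)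
Lemma ae0_section d1 d2 (T1 : measurableType d1) (T2 : measurableType d2)
    (R : realType) (m1 : {sigma_finite_measure set T1 -> \bar R})
    (m2 : {sigma_finite_measure set T2 -> \bar R}) (f : T1 * T2 -> R) :
  measurable_fun setT f -> ae_eq (m1 \x m2)%E setT (EFin \o f) (cst 0%E) ->
  {ae m1, forall x, ae_eq m2 setT (fun y => (f (x, y))%:E) (cst 0%E)}.
Proof.
move=> /measurable_EFinP mf f0.
have maf : measurable_fun setT (abse \o (EFin \o f)) by exact: measurableT_comp.
pose G x := (\int[m2]_y `|(f (x, y))%:E|)%E.
have G0 x : (0 <= G x)%E by exact: integral_ge0.
have mG : measurable_fun setT G by exact: (measurable_integral2 m2 maf).
have IG : (\int[m1]_x G x = 0)%E.
  transitivity (\int[(m1 \x m2)%E]_p `|(f p)%:E|)%E.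
    by rewrite (@fubini_tonelli1 _ _ _ _ _ m1 m2 (abse \o (EFin \o f)))// => p; exact: abse_ge0.
  rewrite (ae_eq_integral (cst 0%E))// ?integral0//.
  by move: f0; apply: filterS => p /= /(_ I) [->] _; rewrite normr0.
have : ae_eq m1 setT G (cst 0%E).
  apply/(ae_eq_integral_abs m1 measurableT mG).
  by rewrite -[RHS]IG; apply: eq_integral => x _; rewrite gee0_abs.
apply: filterS => x /= /(_ I) Gx.
apply/(ae_eq_integral_abs m2 measurableT) => //.
exact: (measurableT_comp mf (pair1_measurable x)).
Qed.

(** * Admissible integrands and the vanishing of J *)

Section admissible.
Variables (R : realType) (n : nat).
Local Notation V := 'rV[R]_n.
Local Notation leb := (@lebesgue_measure R).
Local Notation mu := (vol R n).
Local Notation mu2 := (mu \x leb)%E.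
Implicit Types (F D : V -> R -> R) (f g h : V -> R) (x w : V) (r th k : R).

(** Assumption (A) for real h, carried from the iterated integral to the product measure, where
    Fubini and dominated convergence apply. *)
Definition admissible F : Prop := [/\ forall k, continuous (F^~ k),
  forall x, continuous (F x) &
  forall h, rschwartz h -> L1 mu2 (fun p => F p.1 p.2 * h p.1)].

Definition J F r th h : R :=
  \int[mu2]_p (F p.1 p.2 * h p.1 * cos (r * p.2 + th)).

Lemma measurable_cos_snd r th :
  measurable_fun setT (fun p : V * R => cos (r * p.2 + th)).
Proof.
apply: measurable_cos_comp; apply: measurable_funD => //.
by apply: measurable_funM => //; exact: measurable_snd.
Qed.

Lemma L1_J F r th h : admissible F -> rschwartz h ->
  L1 mu2 (fun p => F p.1 p.2 * h p.1 * cos (r * p.2 + th)).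
Proof.
move=> [_ _ LF] Sh.
apply: (L1M_bounded (M := 1) (LF _ Sh) (measurable_cos_snd r th)) => p.
exact: cos_norm_le1.
Qed.

(** A nonzero value would persist on a whole cube, which has positive volume by [vol_cube]. *)
Lemma ae0_continuous_rV f : continuous f -> {ae mu, forall x, f x = 0} ->
  forall x, f x = 0.
Proof.
move=> cf [A [mA A0 sub]] x; apply/eqP/negP => /negP fx0.
have : nbhs x (fun y => f y != 0).
  by have /cvgr_neq0 := cf x; apply.
move=> /nbhs_ballP[e e0 eP].
have := vol_cube x e0; rewrite ltNge => /negP; apply.
rewrite -A0; apply: le_measure; rewrite ?inE//.
  apply: (@measurable_box R n (fun j => `](x ord0 j - e)%R, (x ord0 j + e)%R[%classic)) => j.
  exact: measurable_itv.
move=> y yc; apply: sub => /= fy; move/eqP: fy; apply/negP; apply: eP.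
split=> // i j; rewrite ord1 /ball/=.
by have := yc j; rewrite in_itv/= ltr_distlC.
Qed.

Lemma ae0_continuous_R (f : R -> R) : continuous f ->
  {ae leb, forall t, f t = 0} -> forall t, f t = 0.
Proof.
move=> cf [A [mA A0 sub]] x; apply/eqP/negP => /negP fx0.
have : nbhs x (fun y => f y != 0).
  by have /cvgr_neq0 := cf x; apply.
move=> /nbhs_ballP[e /= e0 eP].
have : (leb `](x - e)%R, (x + e)%R[%classic <= leb A)%E.
  apply: le_measure; rewrite ?inE//.
  move=> y /=; rewrite in_itv/= => yc; apply: sub => /= fy; move/eqP: fy; apply/negP; apply: eP.
  by rewrite /ball/= ltr_distlC.
rewrite [X in (_ <= X)%E]A0 lebesgue_measure_itv/= lte_fin ltrD2l gtrN// -EFinB lee_fin.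
clear -e0 => H; by lra.
Qed.

Lemma admissible_eq0 D : admissible D ->
  (forall r h, r != 0 -> rschwartz h ->
     J D r 0 h = 0 /\ J D r (- (pi / 2)) h = 0) ->
  forall x k, D x k = 0.
Proof.
move=> AD HJ; have [cx ck LD] := AD.
(* The Gaussian makes D integrable without creating zeros. *)
pose N (p : V * R) : R := D p.1 p.2 * gauss p.1.
have LN : L1 mu2 N by exact: LD (rschwartz_gauss _ _).
have HN r w th : r != 0 ->
    \int[mu2]_p (N p * cos (vdot w p.1 + r * p.2 + th)) = 0.
  move=> r0.
  have S1 := rschwartz_cos_gauss w th.
  have S2 := rschwartz_cos_gauss w (th - pi / 2).
  have [E1 _] := HJ r _ r0 S1; have [_ E2] := HJ r _ r0 S2.
  (* Addition formula for (w . x + th) + r k, each sine being a cosine of phase -pi/2; the factors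
     in x become the Schwartz test functions. *)
  transitivity (J D r 0 (fun x => cos (vdot w x + th) * gauss x) -
    J D r (- (pi / 2)) (fun x => cos (vdot w x + (th - pi / 2)) * gauss x)).
    rewrite /J -(RintB (L1_J r 0 AD S1) (L1_J r (- (pi / 2)) AD S2)).
    apply: eq_Rint => p; rewrite /N addr0 addrA !cosBpihalf.
    have -> : vdot w p.1 + r * p.2 + th = (vdot w p.1 + th) + r * p.2 by rewrite addrAC.
    by rewrite cosD; ring.
  by rewrite E1 E2 subrr.
have ae0 : ae_eq mu2 setT (EFin \o N) (cst 0%E).
  apply: ae0_of_phases => // _ [w [r [th ->]]].
  have [->|r0] := eqVneq r 0; last exact: HN.
  (* The hypothesis excludes r = 0; that frequency is the limit of r = 1/(m+1). *)
  have H : \int[mu2]_p (N p * cos (vdot w p.1 + harmonic m * p.2 + th)) @[m --> \oo]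
      --> \int[mu2]_p (N p * cos (vdot w p.1 + 0 * p.2 + th)).
    apply: (@dct _ _ _ mu2 (fun m p => N p * cos (vdot w p.1 + harmonic m * p.2 + th))
      _ (fun p => `|N p|) _ _ _ _).2.
    - move=> m; apply: measurable_funM; first exact: (L1_measurable LN).
      apply: measurable_cos_comp; apply: measurable_phase.
      by exists w, (harmonic m), th.
    - exact: L1_norm.
    - by move=> m p; rewrite normrM ler_piMr// cos_norm_le1.
    - move=> p; apply: cvgM; first exact: cvg_cst.
      apply: continuous_cvg; first exact: continuous_cos.
      apply: cvgD; last exact: cvg_cst.
      apply: cvgD; first exact: cvg_cst.
      by apply: cvgM; [exact: cvg_harmonic|exact: cvg_cst].
  rewrite -(cvg_lim (@Rhausdorff R) H).
  under eq_fun do rewrite HN ?lt0r_neq0 ?invr_gt0//.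
  exact: lim_cst.
(* Continuity in k first gives vanishing for all k at almost every x; continuity in x for fixed k
   then removes the exceptional x. *)
have aex : {ae mu, forall x, forall k, D x k = 0}.
  have := ae0_section (L1_measurable LN) ae0.
  apply: filterS => x H k; move: k; apply: ae0_continuous_R; first exact: ck.
  move: H; apply: filterS => k /= /(_ I) [] /eqP.
  by rewrite mulf_eq0 [X in _ || X](gt_eqF (gauss_gt0 _)) orbF => /eqP.
move=> x k; move: x; apply: ae0_continuous_rV; first exact: cx.
by move: aex; apply: filterS => x /(_ k).
Qed.

End admissible.

(** * Dilations *)

Section scaling.
Variables (R : realType) (n : nat).
Local Notation V := 'rV[R]_n.
Local Notation leb := (@lebesgue_measure R).
Local Notation mu := (vol R n).
Local Notation mu2 := (mu \x leb)%E.
Implicit Types (F D : V -> R -> R) (h : V -> R) (x w : V) (r th k a b c : R).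

Lemma measurable_dilate2 a b :
  measurable_fun setT (fun p : V * R => (a *: p.1, b * p.2)).
Proof.
apply: measurable_fun_pair; last by apply: measurable_funM => //; exact: measurable_snd.
apply: measurable_fun_rVP => j; under eq_fun do rewrite mxE.
by apply: measurable_funM => //; exact: measurableT_comp (measurable_coord j) measurable_fst.
Qed.

Lemma ge0_integral_dilate2 a b (g : V * R -> \bar R) : a != 0 -> b != 0 ->
  measurable_fun setT g -> (forall p, (0 <= g p)%E) ->
  (\int[mu2]_p g (a *: p.1, b * p.2)%R =
   (`|b|^-1 * `|a|^-1 ^+ n)%:E * \int[mu2]_p g p)%E.
Proof.
move=> a0 b0 mg g0.
have mgd : measurable_fun setT (fun p : V * R => g (a *: p.1, b * p.2)).
  exact: measurableT_comp mg (measurable_dilate2 a b).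
rewrite (@fubini_tonelli1 _ _ _ _ _ mu leb (fun p => g (a *: p.1, b * p.2)%R))// fubini_tonelli1//.
pose G x := (\int[leb]_k g (x, k))%E.
have mG : measurable_fun setT G by exact: measurable_integral2.
have G0 x : (0 <= G x)%E by exact: integral_ge0.
transitivity (\int[mu]_x ((`|b|^-1)%:E * G (0 + a *: x)%R))%E.
  apply: eq_integral => x _; rewrite /fubini_F /= add0r.
  rewrite -(@ge0_integral_affine1 R (fun k => g (a *: x, k)) 0 b b0)//.
    by apply: eq_integral => k _; rewrite add0r.
  exact: measurableT_comp mg (pair1_measurable _).
have mGa : measurable_fun setT (fun x => G (0 + a *: x)).
  apply: (measurableT_comp mG).
  apply: measurable_fun_rVP => j; under eq_fun do rewrite !mxE.
  apply: measurable_funD => //; apply: measurable_funM => //; exact: measurable_coord.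
have b1 : (0 <= (`|b|^-1)%:E :> \bar R)%E by rewrite lee_fin invr_ge0.
rewrite (ge0_integralZl mu measurableT mGa (fun x _ => G0 _) b1).
by rewrite ge0_integral_affine// muleA -EFinM.
Qed.

Lemma L1_dilate2 a b (f : V * R -> R) : a != 0 -> b != 0 -> L1 mu2 f ->
  L1 mu2 (fun p => f (a *: p.1, b * p.2)) /\
  \int[mu2]_p f (a *: p.1, b * p.2) =
    (`|b|^-1 * `|a|^-1 ^+ n) * \int[mu2]_p f p.
Proof.
move=> a0 b0; apply: (@L1_subst _ _ _ mu2 (fun p => (a *: p.1, b * p.2))).
- exact: measurable_dilate2.
- by rewrite mulr_ge0// ?exprn_ge0// invr_ge0.
- by move=> g mg g0; exact: ge0_integral_dilate2.
Qed.

Lemma admissible_dilate F a b : a != 0 -> b != 0 -> admissible F ->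
  admissible (fun x k => F (a *: x) (b * k)).
Proof.
move=> a0 b0 [c1 c2 LF]; split.
- move=> k x; apply: (@continuous_cvg _ _ _ (nbhs x) _ (fun x => a *: x) (F^~ (b * k))); first exact: (c1 _ _).
  by apply: cvgZr; exact: cvg_id.
- move=> x k.
  apply: (@continuous_cvg _ _ _ (nbhs k) _ (fun k => b * k) (F (a *: x))); first exact: (c2 _ _).
  by apply: cvgM; [exact: cvg_cst|exact: cvg_id].
- move=> h Sh.
  have ai0 : a^-1 != 0 by rewrite invr_eq0.
  have [] := L1_dilate2 a0 b0 (LF _ (rschwartz_dilate ai0 Sh)).
  move=> + _; by apply: L1_ext => p /=; rewrite scalerA mulVf// scale1r.
Qed.

Lemma admissible_subZ F G c : admissible F -> admissible G ->
  admissible (fun x k => F x k - c * G x k).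
Proof.
move=> [c1 c2 LF] [d1 d2 LG]; split.
- move=> k x; exact: (cvgB (c1 k x) (cvgM (cvg_cst _) (d1 k x))).
- move=> x k; exact: (cvgB (c2 x k) (cvgM (cvg_cst _) (d2 x k))).
- move=> h Sh; have := L1D (LF _ Sh) (L1Z (- c) (LG _ Sh)).
  by apply: L1_ext => p; ring.
Qed.

Lemma J_subZ F G c r th h : admissible F -> admissible G -> rschwartz h ->
  J (fun x k => F x k - c * G x k) r th h = J F r th h - c * J G r th h.
Proof.
move=> AF AG Sh; have LG := L1_J r th AG Sh.
rewrite /J -(RintZ c LG) -(RintB (L1_J r th AF Sh) (L1Z c LG)).
by apply: eq_Rint => p; ring.
Qed.

Lemma J_dilate F a b r th h : a != 0 -> b != 0 -> admissible F ->
  rschwartz h ->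
  J (fun x k => F (a *: x) (b * k)) r th h =
  `|b|^-1 * `|a|^-1 ^+ n * J F (r / b) th (fun x => h (a^-1 *: x)).
Proof.
move=> a0 b0 AF Sh; have ai0 : a^-1 != 0 by rewrite invr_eq0.
have [_ <-] := L1_dilate2 a0 b0 (L1_J (r / b) th AF (rschwartz_dilate ai0 Sh)).
apply: eq_Rint => p; rewrite /= scalerA mulVf// scale1r; congr (_ * cos (_ + _)).
by field.
Qed.

Lemma JZ F r th h c : admissible F -> rschwartz h ->
  J F r th (fun x => c * h x) = c * J F r th h.
Proof.
move=> AF Sh; rewrite /J -(RintZ c (L1_J r th AF Sh)).
by apply: eq_Rint => p; ring.
Qed.

Lemma JD F r th g h : admissible F -> rschwartz g -> rschwartz h ->
  J F r th (fun x => g x + h x) = J F r th g + J F r th h.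
Proof.
move=> AF Sg Sh; rewrite /J -(RintD (L1_J r th AF Sg) (L1_J r th AF Sh)).
by apply: eq_Rint => p; ring.
Qed.

Lemma fine_eint_product (f : V * R -> R) : L1 mu2 f ->
  fine (eint (fun x => \int[leb]_k (f (x, k))%:E)%E) = \int[mu2]_p f p.
Proof.
move=> Lf; have LF := integrable_fubini_F Lf.
by rewrite (eint_integrable LF) /Rintegral -integral12_prod_meas1.
Qed.

(** Separate continuity gives joint measurability, and Tonelli identifies the iterated bound of (A),
    tested on [RC (h x)], with integrability on the product. *)
Lemma assumptionA_admissible F : assumptionA F -> admissible F.
Proof.
move=> [c1 [c2 FI]]; split=> // h Sh.
have SC : schwartz (fun x => RC (h x)).
  split; first exact: Sh.
  by have := rschwartz_scal 0 Sh; under eq_fun do rewrite mul0r.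
have mF := measurable_caratheodory c1 c2.
have mh := rschwartz_measurable Sh.
have mFh : measurable_fun setT (fun p : V * R => F p.1 p.2 * h p.1).
  by apply: measurable_funM => //; exact: measurableT_comp mh measurable_fst.
have mE : measurable_fun setT (fun p : V * R => `|(F p.1 p.2 * h p.1)%:E|%E).
  by apply: measurableT_comp => //; exact/measurable_EFinP.
apply/integrableP; split; first exact/measurable_EFinP.
rewrite (@fubini_tonelli1 _ _ _ _ _ mu leb (fun p => `|(F p.1 p.2 * h p.1)%:E|%E))//.
have := FI _ SC.
rewrite (_ : (fun x => _) = (fun x => \int[leb]_k `|(F x k * h x)%:E|)%E); last first.
  apply/funext => x; apply: eq_integral => k _ /=.
  by rewrite /cabs /= expr0n addr0 sqrtr_sqr -normrM.
rewrite eint_ge0//; first exact: (measurable_integral2 leb mE).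
by move=> x; exact: integral_ge0.
Qed.

End scaling.

(** * Transform of the ramp *)

Section ramp.
Variable R : realType.
Local Notation leb := (@lebesgue_measure R).
Implicit Types (r th a b k A : R) (f Phi : R -> R).

Lemma Rint_FTC f Phi a b : a < b -> continuous f ->
  (forall t : R, is_derive t 1 Phi (f t)) ->
  \int[leb]_(t in `[a, b]) f t = Phi b - Phi a.
Proof.
move=> ab cf dPhi.
have cPhi : continuous Phi.
  by move=> t; apply/differentiable_continuous/derivable1_diffP; case: (dPhi t).
rewrite /Rintegral (continuous_FTC2 (F := Phi))//.
- exact: continuous_subspaceT.
- split; first by move=> t _; case: (dPhi t).
  + by apply: cvg_at_right_filter; exact: cPhi.
  + by apply: cvg_at_left_filter; exact: cPhi.
- by move=> t _; rewrite derive1E; exact: (@derive_val _ _ _ _ _ _ _ (dPhi t)).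
Qed.

Lemma continuous_cos_affine r th : continuous (fun k => cos (r * k + th)).
Proof.
move=> k; apply: continuous_comp; last exact: continuous_cos.
apply: cvgD; last exact: cvg_cst.
by apply: cvgM; [exact: cvg_cst|exact: cvg_id].
Qed.

Lemma Rint_affine_cos (p q r th a b : R) : r != 0 -> a < b ->
  \int[leb]_(k in `[a, b]) ((p + q * k) * cos (r * k + th)) =
  ((p + q * b) * (sin (r * b + th) / r) + q * (cos (r * b + th) / r ^+ 2)) -
  ((p + q * a) * (sin (r * a + th) / r) + q * (cos (r * a + th) / r ^+ 2)).
Proof.
move=> r0 ab.
apply: (Rint_FTC (Phi := fun k => (p + q * k) * (sin (r * k + th) / r) +
   q * (cos (r * k + th) / r ^+ 2))) => //.
- move=> k; apply: cvgM; last exact: continuous_cos_affine.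
  apply: cvgD; first exact: cvg_cst.
  by apply: cvgM; [exact: cvg_cst|exact: cvg_id].
- move=> t; apply: is_derive_eq.
  by rewrite /GRing.scale /=; field.
Qed.

Lemma tri_support A k : ~~ (k \in `[- A, A]) -> Num.max (A - `|k|) 0 = 0.
Proof.
move=> kA; apply/max_idPr; rewrite subr_le0 leNgt; apply: contra kA => /ltW.
by rewrite ler_norml in_itv.
Qed.

Lemma tri_restrict A r th :
  (fun k => Num.max (A - `|k|) 0 * cos (r * k + th)) =
  (fun k => Num.max (A - `|k|) 0 * cos (r * k + th)) \_ `[- A, A].
Proof.
apply/funext => k; rewrite patchE; case: ifPn => // kA.
by rewrite tri_support ?mul0r//; apply: contra kA => ?; rewrite inE.
Qed.

Lemma continuous_tri A r th :
  continuous (fun k => Num.max (A - `|k|) 0 * cos (r * k + th)).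
Proof.
move=> k; apply: cvgM; last exact: continuous_cos_affine.
apply: (@continuous_max _ _ (fun k => A - `|k|) (fun=> 0)); last exact: cvg_cst.
apply: cvgB; first exact: cvg_cst.
exact: norm_continuous.
Qed.

Lemma tri_transform A r th : r != 0 -> 0 <= A ->
  L1 leb (fun k => Num.max (A - `|k|) 0 * cos (r * k + th)) /\
  \int[leb]_k (Num.max (A - `|k|) 0 * cos (r * k + th)) =
    2 * cos th * (1 - cos (r * A)) / r ^+ 2.
Proof.
move=> r0 A0; set f := (fun k => _).
have fE : f = f \_ `[- A, A] := tri_restrict A r th.
have fi : leb.-integrable `[- A, A] (EFin \o f).
  apply: continuous_compact_integrable; first exact: segment_compact.
  apply: continuous_subspaceT; exact: continuous_tri.
split.
  have := (@integrable_mkcond _ _ _ leb `[- A, A]%classic (EFin \o f) (measurable_itv _)).1 fi.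
  rewrite /L1 [in X in _ -> X]fE; congr (_.-integrable _ _).
  by apply/funext => k; rewrite /= !patchE; case: ifP.
move: A0; rewrite le_eqVlt => /predU1P[A0|A0].
  (* The degenerate interval is treated apart, since the antiderivative formula used below needs
     strict bounds. *)
  rewrite -A0 mulr0 cos0 subrr mulr0 mul0r.
  have -> : f = fun=> 0.
    by apply/funext => k; rewrite /f -A0 sub0r (max_idPr _) ?oppr_le0// mul0r.
  by rewrite /Rintegral integral0.
rewrite fE -Rintegral_mkcond.
have N0 : - A < 0 by rewrite oppr_lt0.
have fi2 : leb.-integrable `]0, A] (EFin \o f).
  apply: (integrableS _ _ _ fi) => //.
  by move=> t /=; rewrite !in_itv/= => /andP[/ltW t0 ->]; rewrite andbT (le_trans (ltW N0)).
(* Split at 0, where |k| has its corner; on each half the integrand is affine times a cosine. *)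
have := @Rintegral_itvB _ f (BLeft (- A)) (BRight A) 0 fi.
rewrite !bnd_simp => /(_ (ltW N0) (ltW A0)) /eqP; rewrite subr_eq => /eqP ->.
rewrite Rintegral_itv_obnd_cbnd//.
rewrite (eq_Rintegral leb (g := fun k => (A + -1 * k) * cos (r * k + th))); last first.
  move=> k; rewrite inE /= in_itv/= => /andP[k0 kA].
  by rewrite /f ger0_norm// (max_idPl _) ?subr_ge0// mulN1r.
rewrite [X in _ + X](eq_Rintegral leb (g := fun k => (A + 1 * k) * cos (r * k + th))); last first.
  move=> k; rewrite inE /= in_itv/= => /andP[k0 kA].
  by rewrite /f ler0_norm// opprK mul1r (max_idPl _)// addrC -lerBlDr sub0r.
rewrite !Rint_affine_cos//.
have -> : r * - A + th = th - r * A by ring.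
by rewrite cosB cosD !mulr0 add0r; field.
Qed.

End ramp.

(** * Complex transforms expressed through K and J *)

Section complex_transforms.
Variables (R : realType) (n : nat).
Local Notation V := 'rV[R]_n.
Local Notation C := R[i].
Local Notation leb := (@lebesgue_measure R).
Local Notation mu := (vol R n).
Local Notation mu2 := (mu \x leb)%E.
Implicit Types (F : V -> R -> R) (f g : V -> R) (h phi : V -> C) (x w : V).
Implicit Types (r th k a b c : R) (z : C).

Local Notation re h := (fun x => cre (h x)).
Local Notation im h := (fun x => cim (h x)).

Lemma cmulE z1 z2 : z1 * z2 =
  Complex (cre z1 * cre z2 - cim z1 * cim z2) (cre z1 * cim z2 + cim z1 * cre z2).
Proof. by case: z1 z2 => [a b] [c d]. Qed.

Lemma creM z1 z2 : cre (z1 * z2) = cre z1 * cre z2 - cim z1 * cim z2.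
Proof. by rewrite cmulE. Qed.

Lemma cimM z1 z2 : cim (z1 * z2) = cre z1 * cim z2 + cim z1 * cre z2.
Proof. by rewrite cmulE. Qed.

Lemma caddE z1 z2 : z1 + z2 = Complex (cre z1 + cre z2) (cim z1 + cim z2).
Proof. by case: z1 z2 => [a b] [c d]. Qed.

Lemma creD z1 z2 : cre (z1 + z2) = cre z1 + cre z2.
Proof. by rewrite caddE. Qed.

Lemma cimD z1 z2 : cim (z1 + z2) = cim z1 + cim z2.
Proof. by rewrite caddE. Qed.

Lemma coppE z : - z = Complex (- cre z) (- cim z).
Proof. by case: z. Qed.

Lemma complex_eta z : z = Complex (cre z) (cim z).
Proof. by case: z. Qed.

Lemma KZ f th w c : L1 mu f -> K (fun x => c * f x) th w = c * K f th w.
Proof.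
move=> Lf; rewrite /K -(RintZ c (L1_K th w Lf)).
by apply: eq_Rint => x; rewrite mulrA.
Qed.

Lemma KD f g th w : L1 mu f -> L1 mu g ->
  K (fun x => f x + g x) th w = K f th w + K g th w.
Proof.
move=> Lf Lg; rewrite /K -(RintD (L1_K th w Lf) (L1_K th w Lg)).
by apply: eq_Rint => x; rewrite mulrDl.
Qed.

Lemma K_dilate f th w c : c != 0 -> L1 mu f ->
  K (fun x => f (c *: x)) th w = `|c|^-1 ^+ n * K f th (c^-1 *: w).
Proof.
move=> c0 Lf; have [_ <-] := L1_affine 0 c0 (L1_K th (c^-1 *: w) Lf).
by apply: eq_Rint => x; rewrite add0r vdotZl vdotZr mulrA mulVf// mul1r.
Qed.

Lemma K_sin_even f w : L1 mu f -> (forall x, f (- x) = f x) ->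
  K f (- (pi / 2)) w = 0.
Proof.
move=> Lf fE; have [_] := Rint_reflect (L1_K (- (pi / 2)) w Lf).
rewrite -/(K _ _ _) => H.
suff : K f (- (pi / 2)) w = - K f (- (pi / 2)) w by lra.
rewrite -{1}H /K -(RintN (L1_K (- (pi / 2)) w Lf)); apply: eq_Rint => x.
by rewrite fE vdotNr !cosBpihalf sinN; ring.
Qed.

Lemma fine_eint f : L1 mu f -> fine (eint (fun x => (f x)%:E)) = \int[mu]_x f x.
Proof. by move=> Lf; rewrite eint_integrable. Qed.

Lemma fine_eintD f g : L1 mu f -> L1 mu g ->
  fine (eint (fun x => (f x + g x)%:E)) = \int[mu]_x f x + \int[mu]_x g x.
Proof. by move=> Lf Lg; rewrite -(RintD Lf Lg) -(fine_eint (L1D Lf Lg)). Qed.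

Lemma fine_eintB f g : L1 mu f -> L1 mu g ->
  fine (eint (fun x => (f x - g x)%:E)) = \int[mu]_x f x - \int[mu]_x g x.
Proof. by move=> Lf /[dup] /RintN <- /L1N; exact: fine_eintD. Qed.

(** Real part (s = 1) and imaginary part (s = -1) of the ramp transform at once. The ramp is even in
    k, so the sine term vanishes already in the inner integral. *)
Lemma ramp_real f g r w s : r != 0 -> L1 mu f ->
  fine (eint (fun x => \int[leb]_k
    (Num.max (`|vdot w x| - `|k|) 0 * cos (r * k + 0) * f x +
     s * (Num.max (`|vdot w x| - `|k|) 0 * cos (r * k - pi / 2) * g x))%:E)%E) =
  2 / r ^+ 2 * (K f 0 0 - K f 0 (r *: w)).
Proof.
move=> r0 Lf.
have E x : (\int[leb]_k
    (Num.max (`|vdot w x| - `|k|) 0 * cos (r * k + 0) * f x +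
     s * (Num.max (`|vdot w x| - `|k|) 0 * cos (r * k - pi / 2) * g x))%:E =
    (2 / r ^+ 2 * (f x * cos (vdot 0 x + 0) - f x * cos (vdot (r *: w) x + 0)))%:E)%E.
  have [L0 I0] := tri_transform 0 r0 (normr_ge0 (vdot w x)).
  have [L1' I1] := tri_transform (- (pi / 2)) r0 (normr_ge0 (vdot w x)).
  have L2 := L1D (L1Z (f x) L0) (L1Z (s * g x) L1').
  have := Rint_EFin L2.
  rewrite (RintD (L1Z (f x) L0) (L1Z (s * g x) L1')) (RintZ _ L0) (RintZ _ L1') I0 I1.
  rewrite cosN cos_pihalf cos0 => H.
  transitivity (\int[leb]_k (f x * (Num.max (`|vdot w x| - `|k|) 0 * cos (r * k + 0)) +
     s * g x * (Num.max (`|vdot w x| - `|k|) 0 * cos (r * k + - (pi / 2))))%:E)%E.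
    by apply: eq_integral => k _; congr EFin; ring.
  rewrite H; congr EFin.
  have -> : cos (r * `|vdot w x|) = cos (vdot (r *: w) x).
    rewrite vdotZl; have [|] := ger0P (vdot w x) => //.
    by rewrite mulrN cosN.
  by rewrite vdot0l !addr0 cos0; field.
have LK w' := L1_K 0 w' Lf.
under eq_fun do rewrite E.
rewrite fine_eint; last first.
  apply: L1Z; have := L1D (LK 0) (L1Z (-1) (LK (r *: w))).
  by apply: L1_ext => x; rewrite mulN1r.
rewrite RintZ ?RintB//.
have := L1D (LK 0) (L1Z (-1) (LK (r *: w))).
by apply: L1_ext => x; rewrite mulN1r.
Qed.

Lemma ramp_theta0 r h w : r != 0 -> schwartz h ->
  ramp_transform (theta0 r h) w =
  RC (2 / r ^+ 2) * Complex (K (re h) 0 0 - K (re h) 0 (r *: w))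
                            (K (im h) 0 0 - K (im h) 0 (r *: w)).
Proof.
move=> r0 [S1 S2].
have L1' : L1 mu (re h) := rschwartz_L1 S1.
have L2' : L1 mu (im h) := rschwartz_L1 S2.
rewrite cmulE /= !mul0r subr0 addr0.
rewrite -(ramp_real (im h) w 1 r0 L1') -(ramp_real (re h) w (-1) r0 L2').
rewrite /ramp_transform /cint2; congr Complex; congr (fine (eint _));
  apply/funext => x; apply: eq_integral => k _; congr EFin;
  rewrite /theta0 /cexpi !cmulE /= addr0 cosN sinN cosBpihalf; ring.
Qed.

(** Real and imaginary parts of the integral of F(x, k) h(x) e^{-irk}, with sin(rk) written as the
    cosine of phase -pi/2. *)
Definition JC F r h : C :=
  Complex (J F r 0 (re h) + J F r (- (pi / 2)) (im h))
          (J F r 0 (im h) - J F r (- (pi / 2)) (re h)).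

Lemma cint2_JC F r h : admissible F -> schwartz h ->
  cint2 (fun x k => RC (F x k) * theta0 r h x k) = JC F r h.
Proof.
move=> AF [S1 S2].
have S1' : rschwartz (re h) := S1.
have S2' : rschwartz (im h) := S2.
have P1 := L1_J r 0 AF S1'. have P2 := L1_J r 0 AF S2'.
have Q1 := L1_J r (- (pi / 2)) AF S1'. have Q2 := L1_J r (- (pi / 2)) AF S2'.
have Q1' := L1N Q1.
rewrite /JC /J -(RintD P1 Q2) -(RintN Q1) -(RintD P2 Q1').
rewrite -(fine_eint_product (L1D P1 Q2)) -(fine_eint_product (L1D P2 Q1')).
rewrite /cint2; congr Complex; congr (fine (eint _));
  apply/funext => x; apply: eq_integral => k _; congr EFin;
  rewrite /theta0 /cexpi !cmulE /= addr0 cosN sinN cosBpihalf; ring.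
Qed.

Lemma finvE phi s : in_Se phi ->
  Defs.finv phi s = Complex ((2 * pi) ^- n * K (re phi) 0 s)
                       ((2 * pi) ^- n * K (im phi) 0 s).
Proof.
move=> [[S1 S2] ev].
have P1 : L1 mu (re phi) := rschwartz_L1 S1.
have P2 : L1 mu (im phi) := rschwartz_L1 S2.
have e1 x : (re phi) (- x) = (re phi) x by rewrite /= ev.
have e2 x : (im phi) (- x) = (im phi) x by rewrite /= ev.
have N1 : L1 mu (fun x => -1 * (cim (phi x) * cos (vdot s x - pi / 2))).
  by apply: L1Z; exact: (L1_K _ s P2).
have E1 : fine (eint (fun x => (cre (phi x * cexpi (vdot s x)))%:E)) = K (re phi) 0 s.
  transitivity (\int[mu]_x (cre (phi x) * cos (vdot s x + 0) +
      -1 * (cim (phi x) * cos (vdot s x - pi / 2)))).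
    rewrite -(fine_eint (L1D (L1_K 0 s P1) N1)); congr (fine (eint _)).
    by apply/funext => x; rewrite cmulE /= addr0 cosBpihalf mulN1r.
  rewrite (RintD (L1_K 0 s P1) N1) (RintZ _ (L1_K (- (pi / 2)) s P2)).
  by rewrite -/(K (im phi) (- (pi / 2)) s) K_sin_even// mulr0 addr0.
have E2 : fine (eint (fun x => (cim (phi x * cexpi (vdot s x)))%:E)) = K (im phi) 0 s.
  transitivity (\int[mu]_x (cim (phi x) * cos (vdot s x + 0) +
      cre (phi x) * cos (vdot s x - pi / 2))).
    rewrite -(fine_eint (L1D (L1_K 0 s P2) (L1_K (- (pi / 2)) s P1))); congr (fine (eint _)).
    by apply/funext => x; rewrite cmulE /= addr0 cosBpihalf addrC.
  rewrite (RintD (L1_K 0 s P2) (L1_K (- (pi / 2)) s P1)).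
  by rewrite -/(K (re phi) (- (pi / 2)) s) K_sin_even// addr0.
by rewrite /Defs.finv /cint E1 E2 cmulE /= !mul0r subr0 addr0.
Qed.

Lemma schwartz_finv phi : in_Se phi -> schwartz (Defs.finv phi).
Proof.
move=> Sphi; have [[S1 S2] _] := Sphi; split.
  under eq_fun do rewrite finvE//=.
  by apply: rschwartz_scal; exact: rschwartz_K.
under eq_fun do rewrite finvE//=.
by apply: rschwartz_scal; exact: rschwartz_K.
Qed.

(** [TF] integrates in k first. [Rint_scal] brings the value of [finv phi] inside that integral at
    every x, and Fubini then passes to the product measure. *)
Lemma TF_JC F phi : admissible F -> in_Se phi ->
  TF F phi = - RC (1 / 2) * JC F 1 (Defs.finv phi).
Proof.
move=> AF Sphi; rewrite /TF; congr (_ * _).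
have [S1 S2] := schwartz_finv Sphi; set u := Defs.finv phi in S1 S2 *.
have [_ cF _] := AF.
have mk x th : measurable_fun setT (fun k => F x k * cos (1 * k + th)).
  apply: measurable_funM; first by apply: continuous_measurable_fun; exact: cF.
  apply: measurable_cos_comp; exact: measurable_funD.
have P1 := (L1_section1 (L1_J 1 0 AF S1)). have P2 := (L1_section1 (L1_J 1 0 AF S2)).
have Q1 := (L1_section1 (L1_J 1 (- (pi / 2)) AF S1)).
have Q2 := (L1_section1 (L1_J 1 (- (pi / 2)) AF S2)).
have Fc x : cre (Fk1 F x) = \int[leb]_k (F x k * cos (1 * k + 0)).
  congr fine; apply: eq_integral => k _; congr EFin.
  by rewrite cmulE /= mul0r subr0 cosN mul1r addr0.
have Fs x : cim (Fk1 F x) = - \int[leb]_k (F x k * cos (1 * k + - (pi / 2))).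
  rewrite -mulN1r -(Rint_scal leb (-1) (mk x _)).
  congr fine; apply: eq_integral => k _; congr EFin.
  by rewrite cmulE /= mul0r addr0 sinN mul1r cosBpihalf; ring.
have T c th x : c * \int[leb]_k (F x k * cos (1 * k + th)) =
    \int[leb]_k (F x k * c * cos (1 * k + th)).
  by rewrite -(Rint_scal leb c (mk x th)); apply: eq_Rint => k; ring.
rewrite /cint /JC /J; congr Complex.
  rewrite -P1.2 -Q2.2 -(fine_eintD P1.1 Q2.1); congr (fine (eint _)).
  by apply/funext => x; congr EFin; rewrite creM Fc Fs mulrN opprK !T.
rewrite -P2.2 -Q1.2 -(fine_eintB P2.1 Q1.1); congr (fine (eint _)).
by apply/funext => x; congr EFin; rewrite cimM Fc Fs addrC mulrN !T.
Qed.

End complex_transforms.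

(** * The spanning problem *)

Section spanning.
Variables (R : realType) (n : nat).
Local Notation V := 'rV[R]_n.
Local Notation C := R[i].
Implicit Types (F : V -> R -> R) (f g : V -> R) (h phi psi : V -> C) (x w : V).
Implicit Types (r th k a b c : R) (z : C).
Local Notation re h := (fun x => cre (h x)).
Local Notation im h := (fun x => cim (h x)).

Lemma schwartz_scal z h : schwartz h -> schwartz (fun x => z * h x).
Proof.
move=> [h1 h2]; split.
  have := rschwartz_lin (cre z) (- cim z) h1 h2.
  by under eq_fun do rewrite mulNr -creM.
have := rschwartz_lin (cre z) (cim z) h2 h1.
by under eq_fun do rewrite -cimM.
Qed.

Lemma schwartzD phi h : schwartz phi -> schwartz h ->
  schwartz (fun x => phi x + h x).
Proof.
move=> [g1 g2] [h1 h2]; split.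
  by have := rschwartzD g1 h1; under eq_fun do rewrite -creD.
by have := rschwartzD g2 h2; under eq_fun do rewrite -cimD.
Qed.

Lemma schwartz_dilate c h : c != 0 -> schwartz h -> schwartz (fun x => h (c *: x)).
Proof.
by move=> c0 [h1 h2]; split; [exact: rschwartz_dilate h1|exact: rschwartz_dilate h2].
Qed.

Lemma JC_scal F r z h : admissible F -> schwartz h ->
  JC F r (fun x => z * h x) = z * JC F r h.
Proof.
move=> AF [h1 h2].
have E1 th : J F r th (re (fun x => z * h x)) =
    cre z * J F r th (re h) - cim z * J F r th (im h).
  rewrite -mulNr -!JZ// -JD//; try exact: rschwartz_scal.
  by congr J; apply/funext => x; rewrite creM mulNr.
have E2 th : J F r th (im (fun x => z * h x)) =
    cre z * J F r th (im h) + cim z * J F r th (re h).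
  rewrite -!JZ// -JD//; try exact: rschwartz_scal.
  by congr J; apply/funext => x; rewrite cimM.
by rewrite /JC !E1 !E2 cmulE /=; congr Complex; ring.
Qed.

Lemma JCD F r phi h : admissible F -> schwartz phi -> schwartz h ->
  JC F r (fun x => phi x + h x) = JC F r phi + JC F r h.
Proof.
move=> AF [g1 g2] [h1 h2].
have E1 th : J F r th (re (fun x => phi x + h x)) = J F r th (re phi) + J F r th (re h).
  by rewrite -JD//; congr J; apply/funext => x; rewrite creD.
have E2 th : J F r th (im (fun x => phi x + h x)) = J F r th (im phi) + J F r th (im h).
  by rewrite -JD//; congr J; apply/funext => x; rewrite cimD.
by rewrite /JC !E1 !E2 caddE /=; congr Complex; ring.
Qed.

Definition phi_ramp r h w : C :=
  RC (- (2 / r ^+ 2)) * Complex (K (re h) 0 (r *: w)) (K (im h) 0 (r *: w)).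

Lemma phi_rampE r h w : phi_ramp r h w =
  Complex (- (2 / r ^+ 2) * K (re h) 0 (r *: w)) (- (2 / r ^+ 2) * K (im h) 0 (r *: w)).
Proof. by rewrite /phi_ramp cmulE /= !mul0r subr0 addr0. Qed.

Lemma ramp_phi r h : r != 0 -> schwartz h ->
  ramp_transform (theta0 r h) = fun w => phi_ramp r h w - phi_ramp r h 0.
Proof.
move=> r0 Sh; apply/funext => w; rewrite ramp_theta0// /phi_ramp scaler0.
by rewrite !cmulE coppE caddE /=; congr Complex; ring.
Qed.

Lemma phi_ramp_Se r h : r != 0 -> schwartz h -> in_Se (phi_ramp r h).
Proof.
move=> r0 [h1 h2].
have ev f w : K f 0 (r *: - w) = K f 0 (r *: w).
  by apply: eq_Rint => x; rewrite scalerN vdotNl !addr0 cosN.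
split; last by move=> x; rewrite /phi_ramp !ev.
apply: schwartz_scal; split.
  exact: (rschwartz_dilate r0 (rschwartz_K 0 h1)).
exact: (rschwartz_dilate r0 (rschwartz_K 0 h2)).
Qed.

Lemma twopiX_gt0 : 0 < (2 * pi) ^+ n :> R.
Proof. by rewrite exprn_gt0// mulr_gt0// pi_gt0. Qed.

(** The dilation by r contributes |r|^-n, the 1/2 of [K_inversion] cancels the 2 of 2/r^2, and its
    (2 pi)^n cancels the normalization of [finv]. *)
Lemma finv_phi_ramp r h s : r != 0 -> schwartz h ->
  Defs.finv (phi_ramp r h) s =
  RC (- (r ^- 2 * `|r|^-1 ^+ n)) * (h (r^-1 *: s) + h (- r^-1 *: s)).
Proof.
move=> r0 Sh; rewrite finvE; last exact: phi_ramp_Se.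
have E f : rschwartz f ->
    K (fun w => - (2 / r ^+ 2) * K f 0 (r *: w)) 0 s =
    (2 * pi) ^+ n * (- (r ^- 2 * `|r|^-1 ^+ n) * (f (r^-1 *: s) + f (- r^-1 *: s))).
  move=> Sf; have LK := rschwartz_L1 (rschwartz_K 0 Sf).
  have LKr : L1 (vol R n) (fun w => K f 0 (r *: w)).
    by apply: L1_ext (L1_affine 0 r0 LK).1 => w; rewrite add0r.
  rewrite (KZ _ _ _ LKr) (K_dilate _ _ r0 LK) K_inversion// scaleNr.
  by field.
have [h1 h2] := Sh.
have c1 : (fun w => cre (phi_ramp r h w)) = fun w => - (2 / r ^+ 2) * K (re h) 0 (r *: w).
  by apply/funext => w; rewrite phi_rampE.
have c2 : (fun w => cim (phi_ramp r h w)) = fun w => - (2 / r ^+ 2) * K (im h) 0 (r *: w).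
  by apply/funext => w; rewrite phi_rampE.
rewrite c1 c2 !E//.
have p0 := lt0r_neq0 twopiX_gt0.
rewrite cmulE caddE /= !mul0r subr0 addr0.
by congr Complex; rewrite mulrA mulVf// mul1r.
Qed.

Lemma TF_phi_ramp F r h : admissible F -> r != 0 -> schwartz h ->
  TF F (phi_ramp r h) = RC (r ^- 2 * `|r|^-1 ^+ n / 2) *
    JC F 1 (fun x => h (r^-1 *: x) + h (- r^-1 *: x)).
Proof.
move=> AF r0 Sh; rewrite TF_JC//; last exact: phi_ramp_Se.
have ri0 : r^-1 != 0 by rewrite invr_eq0.
have nri0 : - r^-1 != 0 by rewrite oppr_eq0.
have SS := schwartzD (schwartz_dilate ri0 Sh) (schwartz_dilate nri0 Sh).
have -> : Defs.finv (phi_ramp r h) = _ := funext (fun s => finv_phi_ramp s r0 Sh).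
rewrite JC_scal// mulrA; congr (_ * _).
by rewrite coppE cmulE /=; congr Complex; ring.
Qed.

Lemma solves_TF F (N : (V -> C) -> C) : admissible F -> solves_P F N ->
  forall phi, in_Se phi -> N (fun w => phi w - phi 0) = TF F phi.
Proof.
move=> AF [_ NE] phi Sphi.
have Sf := schwartz_finv Sphi.
have Sh := schwartz_scal (- RC (1 / 2)) Sf.
rewrite TF_JC// -JC_scal// -cint2_JC// NE ?oner_eq0//; congr N.
rewrite ramp_phi ?oner_eq0//.
(* At r = 1 the factor -2 of [phi_ramp] cancels -1/2, and [K_inversion] returns (2 pi)^n phi since
   phi is even. *)
suff E w : phi_ramp 1 (fun x => - RC (1 / 2) * Defs.finv phi x) w = phi w.
  by apply/funext => w; rewrite !E.
have [[s1 s2] ev] := Sphi.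
have E f : rschwartz f -> (forall x, f (- x) = f x) ->
    - (2 / 1 ^+ 2) * K (fun x => - (1 / 2) * ((2 * pi) ^- n * K f 0 x)) 0 w = f w.
  move=> Sf' fe; have LK := rschwartz_L1 (rschwartz_K 0 Sf').
  rewrite (KZ _ _ _ (L1Z _ LK)) (KZ _ _ _ LK) K_inversion// fe.
  have := lt0r_neq0 twopiX_gt0; move: (_ ^+ n) => p p0.
  by field.
have c1 : (fun x => cre (- RC (1 / 2) * Defs.finv phi x)) =
    fun x => - (1 / 2) * ((2 * pi) ^- n * K (re phi) 0 x).
  by apply/funext => x; rewrite finvE// coppE creM /= oppr0 mul0r subr0.
have c2 : (fun x => cim (- RC (1 / 2) * Defs.finv phi x)) =
    fun x => - (1 / 2) * ((2 * pi) ^- n * K (im phi) 0 x).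
  by apply/funext => x; rewrite finvE// coppE cimM /= oppr0 mul0r addr0.
rewrite phi_rampE c1 c2 scale1r [RHS]complex_eta.
by congr Complex; apply: E => // x; rewrite ev.
Qed.

Lemma J_symmetrize F (N : (V -> C) -> C) r f th :
  admissible F -> solves_P F N -> r != 0 -> rschwartz f ->
  th = 0 \/ th = - (pi / 2) ->
  J F r th f = r ^- 2 * `|r|^-1 ^+ n / 2 *
    J F 1 th (fun x => f (r^-1 *: x) + f (- r^-1 *: x)).
Proof.
move=> AF SN r0 Sf hth.
pose h x := RC (f x).
have Sh : schwartz h.
  split => //; have := rschwartz_scal 0 Sf.
  by under eq_fun do rewrite mul0r.
have [_ NE] := SN.
have J0 r' th' (g : V -> R) : (forall x, g x = 0) -> J F r' th' g = 0.
  move=> g0; rewrite /J /Rintegral; under eq_integral do rewrite g0 mulr0 mul0r.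
  by rewrite integral0.
have := NE r h r0 Sh; rewrite cint2_JC// ramp_phi//.
rewrite (solves_TF AF SN (phi_ramp_Se r0 Sh)) TF_phi_ramp//.
(* For real h the two parts of [JC] are J at phase 0 and minus J at phase -pi/2, so one complex
   equation gives both cases of th. *)
rewrite /JC cmulE /= !mul0r subr0.
rewrite !(J0 r _ (fun=> 0))// !(J0 1 _ (fun=> 0 + 0) (fun=> addr0 0)) !addr0 !sub0r => -[E1 E2].
case: hth => ->; first exact: E1.
by apply: oppr_inj; rewrite E2 mulrN.
Qed.

Lemma solves_P_dilate F (N : (V -> C) -> C) a b : admissible F -> solves_P F N ->
  `|a| = `|b| -> b != 0 -> forall x k, F (a *: x) (b * k) = `|b| * F x k.
Proof.
move=> AF SN ab b0 x k; have a0 : a != 0 by rewrite -normr_eq0 ab normr_eq0.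
apply/eqP; rewrite -subr_eq0; apply/eqP; move: x k.
have AFd := admissible_dilate a0 b0 AF.
apply: (admissible_eq0 (admissible_subZ `|b| AFd AF)) => r f r0 Sf.
have ai0 : a^-1 != 0 by rewrite invr_eq0.
suff H th : th = 0 \/ th = - (pi / 2) ->
    J (fun x k => F (a *: x) (b * k) - `|b| * F x k) r th f = 0.
  by split; apply: H; [left|right].
move=> hth; rewrite J_subZ// J_dilate//.
have rb0 : r / b != 0 by rewrite mulf_neq0// invr_eq0.
rewrite (J_symmetrize AF SN rb0 (rschwartz_dilate ai0 Sf) hth).
rewrite (J_symmetrize AF SN r0 Sf hth).
have [e [e1 E]] : exists e : R, (e = 1 \/ e = -1) /\ a = e * b.
  move/eqP: ab; rewrite eqr_norm2 => /orP[]/eqP ->.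
    by exists 1; split; [left|rewrite mul1r].
  by exists (-1); split; [right|rewrite mulN1r].
(* With a = e b and e = 1 or -1, the dilation factors are e/r and -e/r; the sign e merely swaps the
   summands. *)
have -> : J F 1 th (fun x => f (a^-1 *: ((r / b)^-1 *: x)) + f (a^-1 *: (- (r / b)^-1 *: x)))
    = J F 1 th (fun x => f (r^-1 *: x) + f (- r^-1 *: x)).
  congr J; apply/funext => x; rewrite !scalerA.
  have -> : a^-1 * (r / b)^-1 = e * r^-1 by rewrite E; case: e1 => ->; field; apply/andP.
  have -> : a^-1 * - (r / b)^-1 = - e * r^-1 by rewrite E; case: e1 => ->; field; apply/andP.
  by case: e1 => ->; rewrite ?opprK ?mul1r ?mulN1r // addrC.
(* What remains is the scalar identity |b|^-1 |b|^-n (r/b)^-2 |r/b|^-n = |b| r^-2 |r|^-n. *)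
rewrite ab normrM normfV.
have bn0 : `|b| != 0 by rewrite normr_eq0.
have rn0 : `|r| != 0 by rewrite normr_eq0.
have bnX : `|b| ^+ n != 0 by rewrite expf_neq0.
have rnX : `|r| ^+ n != 0 by rewrite expf_neq0.
have -> : (r / b) ^- 2 = r ^- 2 * `|b| ^+ 2.
  by rewrite real_normK ?num_real//; field; apply/andP.
rewrite invf_div exprMn !exprVn.
move: (`|b| ^+ n) (`|r| ^+ n) bnX rnX (J F 1 _ _) => B D B0 D0 j.
by field; repeat (apply/andP; split).
Qed.

Lemma solves_P_AHa F (N : (V -> C) -> C) : admissible F -> solves_P F N -> AHa F.
Proof.
move=> AF SN; split.
  by move=> c x k c0; exact: (solves_P_dilate AF SN).
move=> x k; split.
  have := @solves_P_dilate F N 1 (-1) AF SN; rewrite normrN => /(_ erefl).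
  rewrite oppr_eq0 oner_eq0 => /(_ isT x k).
  by rewrite scale1r mulN1r normr1 mul1r.
have := @solves_P_dilate F N (-1) 1 AF SN; rewrite normrN => /(_ erefl).
rewrite oner_eq0 => /(_ isT x k).
by rewrite scaleN1r mul1r normr1 mul1r.
Qed.

Lemma in_Se_lin z phi1 phi2 : in_Se phi1 -> in_Se phi2 ->
  in_Se (fun w => z * phi1 w + phi2 w).
Proof.
move=> [S1 e1] [S2 e2]; split; last by move=> x; rewrite e1 e2.
by apply: schwartzD => //; exact: schwartz_scal.
Qed.

Lemma finv_lin z phi1 phi2 s : in_Se phi1 -> in_Se phi2 ->
  Defs.finv (fun w => z * phi1 w + phi2 w) s = z * Defs.finv phi1 s + Defs.finv phi2 s.
Proof.
move=> Se1 Se2; rewrite !finvE//; last exact: in_Se_lin.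
have [[/rschwartz_L1 a1 /rschwartz_L1 a2] _] := Se1.
have [[/rschwartz_L1 b1 /rschwartz_L1 b2] _] := Se2.
have -> : K (re (fun w => z * phi1 w + phi2 w)) 0 s =
    cre z * K (re phi1) 0 s - cim z * K (im phi1) 0 s + K (re phi2) 0 s.
  rewrite -mulNr -!KZ// -KD; [|exact: L1Z|exact: L1Z].
  rewrite -KD//; last by apply: L1D; exact: L1Z.
  by congr K; apply/funext => w; rewrite creD creM mulNr.
have -> : K (im (fun w => z * phi1 w + phi2 w)) 0 s =
    cre z * K (im phi1) 0 s + cim z * K (re phi1) 0 s + K (im phi2) 0 s.
  rewrite -!KZ// -KD; [|exact: L1Z|exact: L1Z].
  rewrite -KD//; last by apply: L1D; exact: L1Z.
  by congr K; apply/funext => w; rewrite cimD cimM.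
by rewrite cmulE caddE /=; congr Complex; ring.
Qed.

Lemma TF_lin F z phi1 phi2 : admissible F -> in_Se phi1 -> in_Se phi2 ->
  TF F (fun w => z * phi1 w + phi2 w) = z * TF F phi1 + TF F phi2.
Proof.
move=> AF Se1 Se2; rewrite !TF_JC//; last exact: in_Se_lin.
have -> : Defs.finv (fun w => z * phi1 w + phi2 w) = _ :=
  funext (fun s => finv_lin z s Se1 Se2).
have f1 := schwartz_finv Se1; have f2 := schwartz_finv Se2.
rewrite (JCD 1 AF (schwartz_scal z f1) f2) (JC_scal 1 z AF f1).
by rewrite mulrDr mulrCA.
Qed.

(* For [n = 0] every constant is a Schwartz function. *)
Lemma rschwartz_const0 c : (1 <= n)%N -> rschwartz (fun _ : V => c) -> c = 0.
Proof.
move=> n0 Sc; pose j := Ordinal n0.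
have [M HM] := rschwartz_monom (fun i => 0 + (i == j))%N Sc.
apply/eqP/negPn/negP => c0.
have := HM ((`|M| + 1) / c *: ev R j); apply/negP; rewrite -ltNge.
rewrite monomS /monom big1 => [|i _]; last by rewrite expr0.
rewrite mulr1 !mxE !eqxx mulr1 divfK//.
apply: (le_lt_trans (ler_norm M)).
by rewrite [X in _ < X]ger0_norm ?addr_ge0// ltrDl.
Qed.

(** The difference of the two functions is a constant Schwartz function, hence 0 in positive
    dimension; a form on S_e therefore descends to Sigma_e. *)
Lemma Sigmae_inj phi1 phi2 : (1 <= n)%N -> in_Se phi1 -> in_Se phi2 ->
  (forall w, phi1 w - phi1 0 = phi2 w - phi2 0) -> phi1 = phi2.
Proof.
move=> n0 S1 S2 E; pose z := phi1 0 - phi2 0.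
have E1 w : phi1 w - phi2 w = z.
  have := E w; rewrite /z => /eqP; rewrite subr_eq => /eqP ->.
  by rewrite addrAC [phi2 w - _ + _]addrAC; ring.
have [Sd _] := in_Se_lin (-1) S2 S1.
have Ez : (fun w => -1 * phi2 w + phi1 w) = fun=> z.
  by apply/funext => w; rewrite -(E1 w) mulN1r addrC.
rewrite Ez in Sd; have [/(rschwartz_const0 n0) r0 /(rschwartz_const0 n0) i0] := Sd.
have z0 : z = 0 by rewrite [LHS]complex_eta r0 i0.
by apply/funext => w; apply/eqP; rewrite -subr_eq0 E1 z0.
Qed.

Lemma JFZ F r th f c : admissible F -> rschwartz f ->
  J (fun x k => c * F x k) r th f = c * J F r th f.
Proof.
move=> AF Sf; rewrite /J -(RintZ c (L1_J r th AF Sf)).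
by apply: eq_Rint => p; rewrite !mulrA.
Qed.

Lemma AHa_J F r f th : AHa F -> admissible F -> r != 0 -> rschwartz f ->
  J F 1 th (fun x => f (r^-1 *: x) + f (- r^-1 *: x)) =
  2 * (r ^+ 2 * `|r| ^+ n) * J F r th f.
Proof.
move=> [H1 H2] AF r0 Sf.
have ri0 : r^-1 != 0 by rewrite invr_eq0.
have nr0 : - r != 0 by rewrite oppr_eq0.
have nri0 : - r^-1 != 0 by rewrite oppr_eq0.
have rn0 : `|r| != 0 by rewrite normr_eq0.
have rnX : `|r| ^+ n != 0 by rewrite expf_neq0.
rewrite JD//; try exact: rschwartz_dilate.
(* Used with e = r by homogeneity and with e = -r by adding evenness in x. The factor is |r| from F
   times |r| |r|^n from the substitution. *)
have key (e : R) : e != 0 -> `|e| = `|r| -> (forall x k, F (e *: x) (r * k) = `|r| * F x k) ->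
    J F 1 th (fun x => f (e^-1 *: x)) = r ^+ 2 * `|r| ^+ n * J F r th f.
  move=> e0 en Fe; have := J_dilate r th e0 r0 AF Sf.
  rewrite divff// en.
  have -> : J (fun x k => F (e *: x) (r * k)) r th f = `|r| * J F r th f.
    rewrite -(JFZ _ _ _ AF Sf); congr J.
    by apply/funext => x; apply/funext => k; exact: Fe.
  move: (J F 1 _ _) (J F r _ _) => A B.
  rewrite exprVn => E.
  have -> : A = `|r| * `|r| ^+ n * (`|r| * B).
    by rewrite E; field; apply/andP.
  by rewrite -[r ^+ 2]real_normK ?num_real//; ring.
rewrite (key r)//; last by move=> x k; exact: H1.
rewrite -invrN (key (- r)) ?normrN//; first by ring.
by move=> x k; rewrite -H1// scaleNr -(H2 (r *: x) _).2.
Qed.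

Lemma AHa_TF F r h : AHa F -> admissible F -> r != 0 -> schwartz h ->
  JC F r h = TF F (phi_ramp r h).
Proof.
move=> HF AF r0 Sh; rewrite TF_phi_ramp//; have [h1 h2] := Sh.
have E1 th : J F 1 th (re (fun x => h (r^-1 *: x) + h (- r^-1 *: x))) =
    2 * (r ^+ 2 * `|r| ^+ n) * J F r th (re h).
  by rewrite -AHa_J//; congr J; apply/funext => x; rewrite creD.
have E2 th : J F 1 th (im (fun x => h (r^-1 *: x) + h (- r^-1 *: x))) =
    2 * (r ^+ 2 * `|r| ^+ n) * J F r th (im h).
  by rewrite -AHa_J//; congr J; apply/funext => x; rewrite cimD.
rewrite /JC !E1 !E2 cmulE /= !mul0r subr0 addr0 exprVn.
have rnX : `|r| ^+ n != 0 by rewrite expf_neq0// normr_eq0.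
by congr Complex; field; apply/andP.
Qed.

Lemma AHa_solves F : (1 <= n)%N -> admissible F -> AHa F ->
  exists N, solves_P F N.
Proof.
move=> n0 AF HF.
(* [xget] picks the representative of psi in S_e, unique by [Sigmae_inj]; the default [fun=> 0] is
   met only outside Sigma_e. *)
pose P psi phi := in_Se phi /\ forall w, psi w = phi w - phi 0.
pose N psi := TF F (xget (fun=> 0) (P psi)).
have NE phi : in_Se phi -> N (fun w => phi w - phi 0) = TF F phi.
  move=> Sphi; rewrite /N; case: xgetP => [phi' _ [Sphi' E]|/(_ phi)[]//].
  by congr (TF F); apply: Sigmae_inj.
exists N; split.
  move=> z psi1 psi2 [phi1 [S1 E1]] [phi2 [S2 E2]].
  have -> : (fun w => z * psi1 w + psi2 w) =
      fun w => (z * phi1 w + phi2 w) - (z * phi1 0 + phi2 0).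
    by apply/funext => w; rewrite E1 E2; ring.
  rewrite (NE _ (in_Se_lin z S1 S2)) TF_lin//.
  by rewrite (funext E1) (funext E2) !NE.
move=> r h r0 Sh; rewrite cint2_JC// ramp_phi// NE; last exact: phi_ramp_Se.
exact: AHa_TF.
Qed.

End spanning.

(** The second conjunct is uniqueness: every element of Sigma_e has the form phi - phi(0), so N is
    determined there, and T(phi) is N(phi - phi(0)). *)
Theorem mainTheorem1 (R : realType) (d : nat) (F : 'rV[R]_d -> R -> R) :
  (1 <= d)%N ->
  assumptionA F ->
  ((exists N : ('rV[R]_d -> R[i]) -> R[i], solves_P F N) <-> AHa F) /\
  (forall N : ('rV[R]_d -> R[i]) -> R[i], solves_P F N ->
     forall phi : 'rV[R]_d -> R[i], in_Se phi ->
       N (fun w => phi w - phi 0) = TF F phi).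
Proof.
move=> d0 /assumptionA_admissible AF; split.
  split; first by move=> [N SN]; exact: solves_P_AHa AF SN.
  exact: AHa_solves.
by move=> N SN phi; exact: (solves_TF AF SN).
Qed.
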